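(* Let $n\ge 2$, let $\Omega\subset\mathbb{R}^n$ be a bounded open set, let $p_k>1$ and $q_k\in(p_k,+\infty)$ for $k=1,\dots,n$, and suppose $\overline p<n$. Let $0\le h\in L^{\tau}(\Omega)$ with $\tau=\max_{k=1,\dots,n}\frac{q_k}{p_k}$, and let $a_i:\Omega\times\mathbb{R}^n\to\mathbb{R}$, $i=1,\dots,n$, be Carathéodory functions for which there are constants $c_1>0$ and $\tilde\nu\in(0,+\infty)$ such that, for almost every $x\in\Omega$ and all $z,\tilde z\in\mathbb{R}^n$, $$|a_i(x,z)|\le c_1\Big(h(x)+\sum_{j=1}^n|z_j|^{p_j}\Big)^{1-1/p_i}\quad (i=1,\dots,n),$$ $$\tilde\nu\sum_{i=1}^n|z_i-\tilde z_i|^{p_i}\le\sum_{i=1}^n\big(a_i(x,z)-a_i(x,\tilde z)\big)(z_i-\tilde z_i).$$ Let $\theta\in W^{1,(q_k)}(\Omega)$. Let $b$ be any number satisfying $$0<b\le\min_{j=1,\dots,n}\Big(1-\frac{p_j}{q_j}\Big)\min_{i=1,\dots,n}\Big(1-\frac1{p_i}\Big)\quad\text{and}\quad b<\frac{p_m-1}{p_m}\,\frac{\overline p}{\overline p^*},$$ and suppose $f^i\in L^{p_i/(p_i-1-bp_i)}(\Omega)$ for $i=1,\dots,n$. Then every solution $u\in\theta+W_0^{1,(p_k)}(\Omega)$ to the boundary value problem $$\sum_{i=1}^nD_i(a_i(x,Du(x)))=\sum_{i=1}^nD_if^i(x)\ \text{ in }\Omega,\qquad u=\theta\ \text{ on }\partial\Omega,$$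 satisfies $$u\in\theta+L^t_{weak}(\Omega),\qquad\text{where}\quad t=\frac{\overline p^*}{1-\frac{b\,\overline p^*}{\overline p}\,\frac{p_m}{p_m-1}}>\overline p^*.$$
   Context: Notation: $p_m=\max_{k=1,\dots,n}p_k$; $\overline p$ is the harmonic mean of the $p_k$, i.e. $\frac1{\overline p}=\frac1n\sum_{k=1}^n\frac1{p_k}$; for $\overline p<n$, $\overline p^*=\frac{n\overline p}{n-\overline p}$ is the Sobolev exponent of $\overline p$. $D_k v=\partial v/\partial x_k$ denotes the weak partial derivative and $Du=(D_1u,\dots,D_nu)$. For exponents $r_k>1$, $k=1,\dots,n$, the anisotropic Sobolev spaces are $W^{1,(r_k)}(\Omega)=\{v\in W^{1,1}(\Omega): D_kv\in L^{r_k}(\Omega)\text{ for every }k=1,\dots,n\}$ and $W_0^{1,(r_k)}(\Omega)=\{v\in W_0^{1,1}(\Omega): D_kv\in L^{r_k}(\Omega)\text{ for every }k=1,\dots,n\}$. For $t>0$, the weak Lebesgue (Marcinkiewicz) space $L^t_{weak}(\Omega)$ consists of all measurable functions $f$ on $\Omega$ for which there is a positive constant $k=k(f)$ with $|\{x\in\Omega:|f(x)|>\tau\}|\le k/\tau^t$ for every $\tau>0$, where $|E|$ is the $n$-dimensional Lebesgue measure of $E$. A function $u\in\theta+W_0^{1,(p_k)}(\Omega)$ is called a solution to the boundary value problem $$\sum_{i=1}^nD_i(a_i(x,Du(x)))=\sum_{i=1}^nD_if^i(x)\ \text{ in }\Omega,\qquad u=\theta\ \text{ on }\partial\Omega,$$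 if $$\int_\Omega\sum_{i=1}^na_i(x,Du(x))D_i\varphi(x)\,dx=\int_\Omega\sum_{i=1}^nf^i(x)D_i\varphi(x)\,dx$$ for every $\varphi\in W_0^{1,(p_k)}(\Omega)$. *)

(* Defs.v *)
From HB Require Import structures.
From mathcomp Require Import all_boot all_order all_algebra.
From mathcomp Require Import all_classical all_reals all_analysis.

Set Implicit Arguments.
Unset Strict Implicit.
Unset Printing Implicit Defensive.

Import Order.TTheory GRing.Theory Num.Theory.
Import numFieldNormedType.Exports.

Local Open Scope classical_set_scope.
Local Open Scope ring_scope.

(* Product (Borel) sigma-algebra on 'rV[R]_n, generated by the coordinates. *)
Definition rV_display : measure_display.
Proof. exact: default_measure_display. Qed.

Section rV_measurable.
Variables (R : realType) (n : nat).

Let coord (i : 'I_n) (x : 'rV[R]_n) : R := x ord0 i.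

Let rV_set0 : g_sigma_preimage coord set0.
Proof. exact: sigma_algebra0. Qed.

Let rV_setC A : g_sigma_preimage coord A -> g_sigma_preimage coord (~` A).
Proof. exact: sigma_algebraC. Qed.

Let rV_bigcup (F : (set 'rV[R]_n)^nat) :
  (forall i, g_sigma_preimage coord (F i)) ->
  g_sigma_preimage coord (\bigcup_i (F i)).
Proof. exact: sigma_algebra_bigcup. Qed.

HB.instance Definition _ := @isMeasurable.Build rV_display
  'rV[R]_n (g_sigma_preimage coord) rV_set0 rV_setC rV_bigcup.

Lemma measurable_coord (i : 'I_n) :
  measurable_fun [set: 'rV[R]_n] (fun x => x ord0 i).
Proof.
move=> _ Y mY; rewrite setTI; apply: sub_sigma_algebra => /=.
rewrite -bigcup_seq/=; exists i => /=; first by rewrite mem_index_enum.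
by exists Y => //; rewrite setTI.
Qed.

Lemma measurable_fun_rVP d (T : measurableType d) (f : T -> 'rV[R]_n) :
  measurable_fun [set: T] f <->
  forall i, measurable_fun [set: T] (fun x => f x ord0 i).
Proof.
split=> [mf i|mf].
  exact: (measurableT_comp (measurable_coord i) mf).
apply: (@measurability _ _ _ _ _ _ (\big[setU/set0]_(i < n)
  preimage_set_system setT (@coord i) measurable)); first by [].
move=> _ [A + <-]; rewrite -bigcup_seq => -[i _ [B mB <-]].
by rewrite !setTI -[X in measurable X]setTI; exact: (mf i measurableT B mB).
Qed.

End rV_measurable.

Section rV_lebesgue.
Variable R : realType.

Section rV_lebesgueS.
Variable n : nat.

Definition rV_cons (xy : R * 'rV[R]_n) : 'rV[R]_n.+1 :=
  \row_j (if unlift ord0 j is Some k then xy.2 ord0 k else xy.1).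

Lemma measurable_rV_cons : measurable_fun setT rV_cons.
Proof.
apply/measurable_fun_rVP => i; under eq_fun do rewrite mxE.
case: (unlift ord0 i) => [k|]; last exact: measurable_fst.
exact: (measurableT_comp (measurable_coord k) measurable_snd).
Qed.

Variable m : {sigma_finite_measure set 'rV[R]_n -> \bar R}.

Definition rV_lebesgueS : set 'rV[R]_n.+1 -> \bar R :=
  pushforward (@lebesgue_measure R \x m)%E rV_cons.

Let m0 : rV_lebesgueS set0 = 0%E.
Proof. by rewrite /rV_lebesgueS /pushforward preimage_set0 measure0. Qed.

Let m_ge0 A : (0 <= rV_lebesgueS A)%E.
Proof. by rewrite /rV_lebesgueS /pushforward; exact: measure_ge0. Qed.

Let m_additive : semi_sigma_additive rV_lebesgueS.
Proof.
move=> F mF tF mUF; rewrite /rV_lebesgueS /pushforward preimage_bigcup.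
apply: measure_semi_sigma_additive.
- by move=> k; rewrite -[X in measurable X]setTI; exact: measurable_rV_cons.
- apply/trivIsetP => /= i j _ _ ij; rewrite -preimage_setI.
  by move/trivIsetP : tF => /(_ _ _ _ _ ij) ->//; rewrite preimage_set0.
- by rewrite -preimage_bigcup -[X in measurable X]setTI;
    exact: measurable_rV_cons.
Qed.

HB.instance Definition _ := isMeasure.Build _ _ _ rV_lebesgueS
  m0 m_ge0 m_additive.

Let rV_uncons (x : 'rV[R]_n.+1) : R * 'rV[R]_n :=
  (x ord0 ord0, \row_j x ord0 (lift ord0 j)).

Let measurable_rV_uncons : measurable_fun setT rV_uncons.
Proof.
apply/measurable_fun_pair; first exact: measurable_coord.
by apply/measurable_fun_rVP => i; under eq_fun do rewrite mxE;
  exact: measurable_coord.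
Qed.

Let rV_consK : cancel rV_cons rV_uncons.
Proof.
move=> [x y]; rewrite /rV_uncons; congr pair; first by rewrite mxE unlift_none.
by apply/rowP => j; rewrite !mxE liftK.
Qed.

Let m_sigma_finite : sigma_finite setT rV_lebesgueS.
Proof.
have /sigma_finiteP[F [FT ndF Foo]] := sigma_finiteT (@lebesgue_measure R).
have /sigma_finiteP[G [GT ndG Goo]] := sigma_finiteT m.
exists (fun k => rV_uncons @^-1` (F k `*` G k)) => [|k].
  apply/esym; rewrite -subTset => x _.
  have [i _ Fi] : (\bigcup_k F k) (rV_uncons x).1 by rewrite -FT.
  have [j _ Gj] : (\bigcup_k G k) (rV_uncons x).2 by rewrite -GT.
  exists (maxn i j) => //; split.
    by move: Fi; exact/subsetPset/ndF/leq_maxl.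
  by move: Gj; exact/subsetPset/ndG/leq_maxr.
have [mF Fk] := Foo k; have [mG Gk] := Goo k; split.
  by rewrite -[X in measurable X]setTI; apply: measurable_rV_uncons => //;
    exact: measurableX.
rewrite /rV_lebesgueS /pushforward -comp_preimage.
rewrite (_ : _ \o _ = id); last by apply/funext => x /=; exact: rV_consK.
by rewrite preimage_id product_measure1E// lte_mul_pinfty// ge0_fin_numE.
Qed.

HB.instance Definition _ := @Measure_isSigmaFinite.Build _ _ _ rV_lebesgueS
  m_sigma_finite.

End rV_lebesgueS.

(* Iterated product of the one-dimensional Lebesgue measure, on the Borel
   sets; see rV_borel_lebesgue_box for its values on boxes. *)
Fixpoint rV_borel_lebesgue n : {sigma_finite_measure set 'rV[R]_n -> \bar R} :=
  match n with
  | 0 => \d_(0 : 'rV[R]_0)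
  | k.+1 => rV_lebesgueS (rV_borel_lebesgue k)
  end.

Lemma rV_borel_lebesgue_box n (A : 'I_n -> set R) :
  (forall i, measurable (A i)) ->
  rV_borel_lebesgue n [set x | forall i, A i (x ord0 i)] =
  (\prod_(i < n) lebesgue_measure (A i))%E.
Proof.
elim: n => [|n ih] in A * => mA.
  rewrite big_ord0 /= diracE mem_set //.
  by case.
rewrite big_ord_recl -ih // -product_measure1E //; last first.
  rewrite (_ : mkset _ =
      \bigcap_(i in [set: 'I_n]) [set x | A (lift ord0 i) (x ord0 i)]).
    apply: fin_bigcap_measurable => // i _.
    by rewrite -[X in measurable X]setTI; exact: measurable_coord.
  by apply/seteqP; split => x /= xA i; [move=> _|]; exact: xA.
- exact: (mA ord0).
rewrite /= /rV_lebesgueS /pushforward; congr (_ _).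
apply/seteqP; split => -[x y] /=.
  move=> xyA; split; first by have := xyA ord0; rewrite mxE unlift_none.
  by move=> i; have := xyA (lift ord0 i); rewrite mxE liftK.
by move=> [xA yA] i; rewrite mxE; case: unliftP => [k|] ->.
Qed.

End rV_lebesgue.

(* 'rV[R]_n with the completion of the Borel sigma-algebra, i.e. the Lebesgue
   measurable sets, presented as the Caratheodory sets of the outer measure. *)
Notation rV_leb R n := (caratheodory_type (mu_ext (rV_borel_lebesgue R n))).

Definition rV_lebesgue (R : realType) (n : nat) : set (rV_leb R n) -> \bar R :=
  @completed_measure_extension _ _ _ (rV_borel_lebesgue R n).
HB.instance Definition _ (R : realType) (n : nat) :=
  Measure.on (@rV_lebesgue R n).
Arguments rV_lebesgue {R n}.

Section function_spaces.
Variables (R : realType) (n : nat).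
Implicit Types (Omega : set 'rV[R]_n) (v g phi : 'rV[R]_n -> R).

Local Notation mu := (@rV_lebesgue R n).

(* All functions below are total, but only their values on Omega matter. *)

Definition lebesgue_measurable Omega v : Prop :=
  measurable_fun (Omega : set (rV_leb R n)) (v : rV_leb R n -> R).

Definition in_Lp Omega (r : R) v : Prop :=
  lebesgue_measurable Omega v /\
  (\int[mu]_(x in Omega) (`|v x| `^ r)%:E < +oo)%E.

Definition in_weak_Lp Omega (t : R) v : Prop :=
  lebesgue_measurable Omega v /\
  exists2 k : R, 0 < k & forall tau : R, 0 < tau ->
    (mu [set x | Omega x /\ (tau < `|v x|)%R] <= (k / tau `^ t)%:E)%E.

Definition in_L1loc Omega v : Prop :=
  lebesgue_measurable Omega v /\
  forall K : set 'rV[R]_n, K `<=` Omega -> compact K ->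
    (\int[mu]_(x in K) `|v x|%:E < +oo)%E.

Definition partial (i : 'I_n) v : 'rV[R]_n -> R :=
  fun x => 'D_(delta_mx ord0 i) v x.

(* All iterated partial derivatives exist and are continuous. *)
Definition smooth v : Prop :=
  forall s : seq 'I_n,
    continuous (foldr partial v s) /\
    forall i x, derivable (foldr partial v s) x (delta_mx ord0 i).

(* C_c^oo(Omega). *)
Definition test_function Omega phi : Prop :=
  [/\ smooth phi, compact (closure [set x | phi x != 0]) &
      closure [set x | phi x != 0] `<=` Omega].

Definition is_weak_partial Omega (i : 'I_n) v g : Prop :=
  [/\ in_L1loc Omega v, in_L1loc Omega g &
      forall phi, test_function Omega phi ->
        \int[mu]_(x in Omega) (v x * partial i phi x) =
        - \int[mu]_(x in Omega) (g x * phi x)].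

(* D_i v is determined up to a null set; a representative is chosen. It is
   meaningful only when v has a weak i-th partial derivative on Omega. *)
Definition weakD Omega (i : 'I_n) v : 'rV[R]_n -> R :=
  xget (fun=> 0) [set g | is_weak_partial Omega i v g].

Definition weak_grad Omega v : 'rV[R]_n -> 'rV[R]_n :=
  fun x => \row_i weakD Omega i v x.

Definition in_W11 Omega v : Prop :=
  in_Lp Omega 1 v /\
  forall i, exists2 g, is_weak_partial Omega i v g & in_Lp Omega 1 g.

Definition normW11 Omega v : \bar R :=
  (\int[mu]_(x in Omega) `|v x|%:E +
   \sum_(i < n) \int[mu]_(x in Omega) `|weakD Omega i v x|%:E)%E.

(* Closure of C_c^oo(Omega) in W^{1,1}(Omega). *)
Definition in_W011 Omega v : Prop :=
  in_W11 Omega v /\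
  forall e : R, 0 < e ->
    exists2 phi, test_function Omega phi & (normW11 Omega (v \- phi)%R < e%:E)%E.

Definition in_W1 Omega (r : 'I_n -> R) v : Prop :=
  in_W11 Omega v /\ forall i, in_Lp Omega (r i) (weakD Omega i v).

Definition in_W01 Omega (r : 'I_n -> R) v : Prop :=
  in_W011 Omega v /\ forall i, in_Lp Omega (r i) (weakD Omega i v).

(* Measurable in x for every z, continuous in z for almost every x. *)
Definition caratheodory_function Omega (a : 'rV[R]_n -> 'rV[R]_n -> R) : Prop :=
  (forall z, lebesgue_measurable Omega (a ^~ z)) /\
  {ae mu, forall x, Omega x -> continuous (a x)}.

Definition bvp_solution Omega (p : 'I_n -> R)
    (a : 'I_n -> 'rV[R]_n -> 'rV[R]_n -> R) (f : 'I_n -> 'rV[R]_n -> R)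
    (theta u : 'rV[R]_n -> R) : Prop :=
  in_W01 Omega p (u \- theta) /\
  forall phi, in_W01 Omega p phi ->
    \int[mu]_(x in Omega)
      (\sum_(i < n) a i x (weak_grad Omega u x) * weakD Omega i phi x) =
    \int[mu]_(x in Omega) (\sum_(i < n) f i x * weakD Omega i phi x).

Definition exponent_hmean (p : 'I_n -> R) : R :=
  (n%:R^-1 * \sum_(k < n) (p k)^-1)^-1.

Definition sobolev_exponent (r : R) : R := n%:R * r / (n%:R - r).

(* The default value 0 plays no role for n > 0 and positive families. *)
Definition max_exponent (p : 'I_n -> R) : R := \big[Num.max/0]_(k < n) p k.

(* The minimum of the family for n > 0 and values at most 1: the default value
   1 then plays no role. *)
Definition min_le1 (s : 'I_n -> R) : R := \big[Num.min/1]_(k < n) s k.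

End function_spaces.

(* Main.v *)
Require Import Defs.
From mathcomp Require Import all_boot all_order all_algebra.
From mathcomp Require Import all_classical all_reals all_analysis.
From mathcomp Require Import measurable_realfun.
From mathcomp Require Import ring lra.
Import Order.TTheory GRing.Theory Num.Theory.
Import numFieldNormedType.Exports.
Local Open Scope classical_set_scope.
Local Open Scope ring_scope.

Set Implicit Arguments.
Unset Strict Implicit.
Unset Printing Implicit Defensive.

(** Write w = u - theta, let m(s) be the measure of the set where |w| > s, let
p_i' = p_i / (p_i - 1), and put beta = b pm', where pm' = pm / (pm - 1). The
theorem is a decay estimate for m, obtained by playing an energy estimate
against an isoperimetric one, level by level.

Energy. Let G be a smooth version of sign(s) max(|s| - c, 0). The equation
tested with G(w) and monotonicity give
  nu int G'(w) sum_i |D_i w|^p_i <= int G'(w) sum_i (f^i - a_i(x, D theta)) D_i w.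
By the growth condition, the integrability of h and D theta and the first
bound on b, the functions f^i - a_i(x, D theta) lie in L^r_i with
r_i = p_i / (p_i - 1 - b p_i), which is better than the dual exponent p_i'. The
Young inequality absorbs the gradient, and interpolation between L^r_i and the
mass J of G'(w) leaves a right-hand side of order J^(b p_i'), hence of order
J^beta. Interpolating once more, int G'(w) |D_i w| is of order
J^(1 - (1 - beta) / p_i): this is energy_decay, applied to solutions in
solution_energy_decay.

Isoperimetry. A function v of W_0^{1,1} satisfies
  |{|v| > 2s}|^(n-1) <= prod_i (1/s) int |D_i v|
up to replacing each integral by a strictly larger number (W011_gagliardo).
For a test function this is the Loomis-Whitney inequality, because on every
line in direction i through a point of {|v| > s} the integral of |D_i v| / s is
at least 1; the general case follows by density. This weak inequality replaces
the anisotropic Sobolev embedding: only distribution functions matter here.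

Iteration. For c between s and 2s, both estimates applied to G(w) yield
  m(2s)^(n-1) <= C s^(-n) J^Gamma for all J > m(s) below a fixed bound,
where Gamma = n - (1 - beta) n / pbar (level_set_step). The second bound on b
says that Gamma < n - 1, and then an induction over dyadic levels gives
m(s) <= K s^(-t) with t = n / (n - 1 - Gamma), which is the exponent of the
theorem (decay_iteration, stampacchia_exponents).

What precedes these steps is the calculus they rest on: weak derivatives are
unique almost everywhere (variations_lemma), G(w) is again in W_0^{1,1} with
the expected gradient (W011_comp), and x |-> a_i(x, Du(x)) is measurable
(measurable_caratheodory). *)

(** * Fubini for the iterated product measure *)

Section finite_sets.
Context d (T : measurableType d) (R : realType).
Variable mu : {measure set T -> \bar R}.

Lemma integrable_indic_fin (A : set T) : measurable A -> (mu A < +oo)%E ->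
  mu.-integrable setT (fun x => (\1_A x)%:E).
Proof.
move=> mA muA; apply/integrableP; split.
  by apply/measurable_EFinP; exact: measurable_indic.
under eq_integral do rewrite gee0_abs ?lee_fin//.
by rewrite integral_indic// setIT.
Qed.

End finite_sets.

Section borel_fubini.
Context {R : realType}.
Implicit Types (n : nat).
Local Notation leb := (@lebesgue_measure R).
Local Notation borel n := (rV_borel_lebesgue R n).

Definition set_coord n (i : 'I_n) (s : R) (x : 'rV[R]_n) : 'rV[R]_n :=
  \row_j (if j == i then s else x ord0 j).

Lemma set_coord_cons0 n (s r : R) (y : 'rV[R]_n) :
  set_coord ord0 s (rV_cons (r, y)) = rV_cons (s, y).
Proof.
apply/rowP => j; rewrite !mxE; case: unliftP => [k ->|->]; last by rewrite eqxx.
by rewrite eq_sym (negbTE (neq_lift _ _)).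
Qed.

Lemma set_coord_consS n (i : 'I_n) (s r : R) (y : 'rV[R]_n) :
  set_coord (lift ord0 i) s (rV_cons (r, y)) = rV_cons (r, set_coord i s y).
Proof.
apply/rowP => j; rewrite !mxE; case: unliftP => [k ->|->].
  by rewrite (inj_eq (@lift_inj _ _)) mxE.
by rewrite (negbTE (neq_lift _ _)).
Qed.

Lemma measurable_cons_r n (s : R) :
  measurable_fun setT (fun y : 'rV[R]_n => rV_cons (s, y)).
Proof.
by apply: (measurableT_comp (@measurable_rV_cons R n)); exact: pair1_measurable.
Qed.

Lemma measurable_set_coord n (i : 'I_n) (x : 'rV[R]_n) :
  measurable_fun setT (fun s : R => set_coord i s x).
Proof.
apply/measurable_fun_rVP => j; under eq_fun do rewrite mxE.
by case: (j == i); [exact: measurable_id|exact: measurable_cst].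
Qed.

Local Open Scope ereal_scope.

Let mcons n : measurable_fun [set: measurableTypeR R * 'rV[R]_n] (@rV_cons R n).
Proof. exact: measurable_rV_cons. Qed.

(** The measure in dimension n + 1 is the image under rV_cons of a product
measure, so both orders of integration come from the Tonelli theorem. *)
Lemma borel_fubini1 n (F : 'rV[R]_n.+1 -> \bar R) :
  measurable_fun setT F -> (forall x, 0 <= F x) ->
  \int[borel n.+1]_x F x = \int[leb]_s \int[borel n]_y F (rV_cons (s, y)).
Proof.
move=> mF F0.
transitivity (\int[pushforward (leb \x borel n) (@rV_cons R n)]_x F x).
  by [].
rewrite (ge0_integral_pushforward (@mcons n))//.
rewrite preimage_setT fubini_tonelli1//.
  by apply: measurableT_comp => //; exact: mcons.
by move=> x; exact: F0.
Qed.

Lemma borel_fubini2 n (F : 'rV[R]_n.+1 -> \bar R) :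
  measurable_fun setT F -> (forall x, 0 <= F x) ->
  \int[borel n.+1]_x F x = \int[borel n]_y \int[leb]_s F (rV_cons (s, y)).
Proof.
move=> mF F0.
transitivity (\int[pushforward (leb \x borel n) (@rV_cons R n)]_x F x).
  by [].
rewrite (ge0_integral_pushforward (@mcons n))//.
rewrite preimage_setT fubini_tonelli2//.
  by apply: measurableT_comp => //; exact: mcons.
by move=> x; exact: F0.
Qed.

Lemma measurable_borel_slice_integral n (F : 'rV[R]_n.+1 -> \bar R) :
  measurable_fun setT F -> (forall x, 0 <= F x) ->
  measurable_fun setT (fun s => \int[borel n]_y F (rV_cons (s, y))).
Proof.
move=> mF F0; apply: (@measurable_fun_fubini_tonelli_F _ _ _ _ _ (borel n)
  (F \o @rV_cons R n)) => [|x]; last exact: F0.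
by apply: measurableT_comp => //; exact: measurable_rV_cons.
Qed.

Lemma measurable_borel_line_integral n (F : 'rV[R]_n.+1 -> \bar R) :
  measurable_fun setT F -> (forall x, 0 <= F x) ->
  measurable_fun setT (fun y => \int[leb]_s F (rV_cons (s, y))).
Proof.
move=> mF F0; apply: (@measurable_fun_fubini_tonelli_G _ _ _ _ _ leb
  (F \o @rV_cons R n)) => [|x]; last exact: F0.
by apply: measurableT_comp => //; exact: measurable_rV_cons.
Qed.

Lemma integral_slice_indic n (E : set 'rV[R]_n.+1) (s : R) : measurable E ->
  \int[borel n]_y (\1_E (rV_cons (s, y)))%:E =
  borel n [set y | E (rV_cons (s, y))].
Proof.
move=> mE.
have mS : measurable [set y | E (rV_cons (s, y))].
  by rewrite -[X in measurable X]setTI; exact: measurable_cons_r.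
by rewrite -[X in borel n X]setIT -integral_indic.
Qed.

Lemma borel_slice_measure n (E : set 'rV[R]_n.+1) : measurable E ->
  borel n.+1 E = \int[leb]_s borel n [set y | E (rV_cons (s, y))].
Proof.
move=> mE; transitivity (\int[borel n.+1]_x (\1_E x)%:E).
  by rewrite integral_indic// setIT.
rewrite borel_fubini1//; last first.
  by apply/measurable_EFinP; exact: measurable_indic.
by apply: eq_integral => s _; exact: integral_slice_indic.
Qed.

Lemma measurable_slice_measure n (E : set 'rV[R]_n.+1) : measurable E ->
  measurable_fun setT (fun s => borel n [set y | E (rV_cons (s, y))]).
Proof.
move=> mE; under eq_fun do rewrite -integral_slice_indic//.
apply: (@measurable_borel_slice_integral _ (fun x => (\1_E x)%:E)) => //.
by apply/measurable_EFinP; exact: measurable_indic.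
Qed.

Definition cube n (M : R) : set 'rV[R]_n :=
  [set x | forall i, (`|x ord0 i| <= M)%R].

Lemma cubeE n (M : R) :
  @cube n M = [set x | forall i, `[(- M)%R, M]%classic (x ord0 i)].
Proof.
by apply/seteqP; split => x /= h i; have := h i;
  rewrite in_itv/= ler_norml.
Qed.

Lemma measurable_cube n (M : R) : measurable (@cube n M).
Proof.
rewrite cubeE (_ : mkset _ =
    \bigcap_(i in [set: 'I_n]) [set x | `[(- M)%R, M]%classic (x ord0 i)]).
  apply: fin_bigcap_measurable => // i _.
  by rewrite -[X in measurable X]setTI; exact: measurable_coord.
by apply/seteqP; split => x /= xA i; [move=> _|]; exact: xA.
Qed.

Lemma cube_fin n (M : R) : borel n (@cube n M) < +oo.
Proof.
rewrite cubeE (@rV_borel_lebesgue_box R n (fun=> `[(- M)%R, M]%classic))//.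
have prod_fin (x : R) : \prod_(i < n) x%:E < +oo.
  suff [r ->] : exists r, \prod_(i < n) x%:E = r%:E by rewrite ltry.
  elim/big_ind : _ => [|_ _ [a ->] [b ->]|_ _]; [by exists 1%R| |by exists x].
  by exists (a * b)%R.
rewrite lebesgue_measure_itv/= lte_fin.
by case: ifPn => _; rewrite -?EFinB; exact: prod_fin.
Qed.

End borel_fubini.

(** * The Loomis-Whitney inequality *)

Section loomis_whitney.
Context {R : realType}.
Local Notation leb := (@lebesgue_measure R).
Local Notation borel n := (rV_borel_lebesgue R n).

Lemma borel_fin n (E : set 'rV[R]_n) (M : R) : measurable E ->
  E `<=` cube M -> (borel n E < +oo)%E.
Proof.
move=> mE EM; apply: le_lt_trans (cube_fin n M).
by apply: le_measure => //; rewrite inE; [|exact: measurable_cube].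
Qed.

Lemma measurable_slice n (E : set 'rV[R]_n.+1) (s : R) : measurable E ->
  measurable [set y | E (rV_cons (s, y))].
Proof.
by move=> mE; rewrite -[X in measurable X]setTI; exact: measurable_cons_r.
Qed.

Lemma AGM_prod_bound n (E : 'I_n.+1 -> R) : (forall i, 0 <= E i) ->
  \prod_i E i <= ((\sum_i E i) / n.+1%:R) ^+ n.+1.
Proof.
move=> E0; have := @leif_AGM R 'I_n.+1 predT E (fun i _ => E0 i).
by rewrite cardT size_enum_ord => -[].
Qed.

(** A functional form of the inequality: H_i has integral at least 1 on every
line in direction i that meets E, so its total integral plays the role of the
measure of the projection of E along that direction.

Induction on the dimension, slicing orthogonally to the first axis. For the
slice of measure m at height s the induction hypothesis gives
m^(n+1) <= m prod_j a_j(s), where a_j(s) is the integral of H_(j+1) over the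
slice, and m <= A_0 because every line in the first direction through the
slice carries mass at least 1. By the arithmetic-geometric inequality m is then
at most a fixed linear combination of the a_j(s), which can be integrated in s;
this avoids the Hoelder inequality for several functions. The factor |E| on
both sides covers null sets without a division. *)
Lemma loomis_whitney n (E : set 'rV[R]_n.+1) (H : 'I_n.+1 -> 'rV[R]_n.+1 -> \bar R)
    (A : 'I_n.+1 -> R) (M : R) :
  measurable E -> E `<=` cube M ->
  (forall i, measurable_fun setT (H i)) -> (forall i x, 0 <= H i x)%E ->
  (forall i x, E x -> 1 <= \int[leb]_s H i (set_coord i s x))%E ->
  (forall i, 0 < A i) -> (forall i, \int[borel n.+1]_x H i x <= (A i)%:E)%E ->
  fine (borel n.+1 E) ^+ n.+1 <= fine (borel n.+1 E) * \prod_i A i.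
Proof.
elim: n => [|n IH] in E H A *.
  move=> mE EM mH H0 EH A0 HA; rewrite big_ord_recl big_ord0 mulr1 expr1.
  have [->|/set0P[x Ex]] := eqVneq E set0; first by rewrite measure0 mul0r.
  rewrite ler_peMr//; first by rewrite fine_ge0.
  rewrite -lee_fin (le_trans _ (HA ord0))// borel_fubini1//.
  rewrite (le_trans (EH ord0 x Ex))//; apply: ge0_le_integral => //.
  - by apply: measurableT_comp => //; exact: measurable_set_coord.
  - exact: measurable_borel_slice_integral.
  move=> s _; rewrite integral_dirac//; last first.
    by apply: measurableT_comp => //; exact: measurable_cons_r.
  rewrite diracT mul1e le_eqVlt; apply/orP; left; apply/eqP; congr (H _ _).
  by apply/rowP => j; rewrite !mxE !ord1 eqxx unlift_none.
move=> mE EM mH H0 EH A0 HA.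
pose a (j : 'I_n.+1) s := (\int[borel n.+1]_y H (lift ord0 j) (rV_cons (s, y)))%E.
pose Es s := [set y | E (rV_cons (s, y))].
have mEs s : measurable (Es s) by exact: measurable_slice.
have EsM s : Es s `<=` cube M.
  by move=> y /EM + i => /(_ (lift ord0 i)); rewrite mxE liftK.
have a0 j s : (0 <= a j s)%E by exact: integral_ge0.
have ma j : measurable_fun setT (a j) by exact: measurable_borel_slice_integral.
have PA0 : 0 < \prod_i A i by apply: prodr_gt0.
set c := (\prod_i A i) `^ (n.+1%:R^-1).
have c0 : 0 < c by rewrite powR_gt0.
have cE : c ^+ n.+1 = \prod_i A i.
  by rewrite -powR_mulrn ?powR_ge0// -powRrM mulVf// powRr1// ltW.
(* AM-GM is applied to a j / A (lift ord0 j), whose integral is at most 1. *)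
pose w j := c / n.+1%:R / A (lift ord0 j).
have w0 j : 0 < w j by rewrite !divr_gt0.
have EsA0 s : (borel n.+1 (Es s) <= (A ord0)%:E)%E.
  rewrite -[Es s]setIT -integral_indic// (le_trans _ (HA ord0))// borel_fubini2//.
  apply: ge0_le_integral => //.
  - by apply/measurable_EFinP; exact: measurable_indic.
  - exact: measurable_borel_line_integral.
  move=> y _; rewrite indicE; have [|_] := boolP (y \in Es s); last first.
    exact: integral_ge0.
  rewrite inE => Ey; rewrite (le_trans (EH ord0 _ Ey))//.
  by under eq_integral do rewrite set_coord_cons0.
have Es_le s : (borel n.+1 (Es s) <= \sum_(j < n.+1) (w j)%:E * a j s)%E.
  have [afin|] := boolP [forall j, a j s < +oo]%E; last first.
    rewrite negb_forall => /existsP[j]; rewrite -leNgt leye_eq => /eqP ajy.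
    rewrite (bigD1 j)//= ajy gt0_muley ?lte_fin// addye ?leey//.
    rewrite gt_eqF// (lt_le_trans (ltNyr 0))//.
    by apply: sume_ge0 => k _; rewrite mule_ge0// lee_fin ltW.
  have /forallP {}afin := afin.
  have aE j : a j s = (fine (a j s))%:E by rewrite fineK// ge0_fin_numE.
  have mfin : borel n.+1 (Es s) \is a fin_num.
    by rewrite ge0_fin_numE//; exact: borel_fin (EsM s).
  rewrite -(fineK mfin); set m := fine _.
  have m0 : 0 <= m by rewrite fine_ge0.
  have mA0 : m <= A ord0 by rewrite -lee_fin fineK.
  under eq_bigr do rewrite aE -EFinM; rewrite sumEFin lee_fin.
  apply/ler_addgt0Pr => e e0.
  (* The induction hypothesis wants positive bounds, hence the shift by e'. *)
  pose e' := e / (\sum_j w j).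
  have sw0 : 0 < \sum_j w j.
    by rewrite big_ord_recl ltr_pwDl// sumr_ge0// => i _; rewrite ltW.
  have e'0 : 0 < e' by rewrite divr_gt0.
  have : m ^+ n.+1 <= m * \prod_j (fine (a j s) + e').
    apply: (IH (Es s) (fun j y => H (lift ord0 j) (rV_cons (s, y)))) => //.
    - by move=> j; apply: measurableT_comp => //; exact: measurable_cons_r.
    - by move=> j y /(EH (lift ord0 j)); under eq_integral do rewrite set_coord_consS.
    - by move=> j; rewrite ltr_wpDl ?fine_ge0.
    - by move=> j; rewrite -/(a j s) aE lee_fin lerDl ltW.
  have -> : \sum_(i < n.+1) w i * fine (a i s) + e =
      c * ((\sum_(j < n.+1) (fine (a j s) + e') / A (lift ord0 j)) / n.+1%:R).
    transitivity (\sum_(i < n.+1) w i * (fine (a i s) + e')).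
      under [RHS]eq_bigr do rewrite mulrDr; rewrite big_split/= -mulr_suml.
      by rewrite /e' mulrCA divff ?mulr1// gt_eqF.
    rewrite mulr_suml mulr_sumr; apply: eq_bigr => i _; rewrite /w; ring.
  move=> mle; have nn : (0 < n.+1)%N by [].
  have Q0 j : 0 <= (fine (a j s) + e') / A (lift ord0 j).
    by apply: divr_ge0; [apply: addr_ge0; [exact: fine_ge0|exact: ltW]|exact: ltW].
  rewrite -(ler_pXn2r nn) ?nnegrE//; last first.
    by rewrite mulr_ge0 ?divr_ge0 ?sumr_ge0// ltW.
  rewrite exprMn (le_trans mle)// (@le_trans _ _ (c ^+ n.+1 *
      \prod_(j < n.+1) ((fine (a j s) + e') / A (lift ord0 j))))//; last first.
    apply: ler_wpM2l; [by rewrite cE ltW|exact: AGM_prod_bound].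
  have PE : \prod_i A i = A ord0 * \prod_(j < n.+1) A (lift ord0 j).
    exact: big_ord_recl.
  rewrite cE PE big_split/= prodfV -mulrA [X in _ <= _ * X]mulrCA divff ?mulr1; last first.
    by rewrite gt_eqF// prodr_gt0.
  by rewrite ler_wpM2r// prodr_ge0// => j _; rewrite addr_ge0 ?fine_ge0// ltW.
have mEc : (borel n.+2 E <= c%:E)%E.
  rewrite borel_slice_measure//.
  apply: (@le_trans _ _ (\int[leb]_s \sum_(j < n.+1) (w j)%:E * a j s)%E).
    apply: ge0_le_integral => //.
    - exact: measurable_slice_measure.
    - by apply: emeasurable_sum => j; apply: measurable_funeM; exact: ma.
    - by move=> s _; exact: Es_le.
  rewrite ge0_integral_sum//; last 2 first.
  - by move=> j; apply: measurable_funeM; exact: ma.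
  - by move=> j s _; rewrite mule_ge0// lee_fin ltW.
  apply: (@le_trans _ _ (\sum_(j < n.+1) (w j * A (lift ord0 j))%:E)%E).
    apply: lee_sum => j _; have wj0 := ltW (w0 j).
    rewrite ge0_integralZl_EFin//; last exact: ma.
    rewrite (EFinM (w j)) lee_wpmul2l ?lee_fin//.
    by rewrite /a -(borel_fubini1 (mH _)).
  rewrite sumEFin lee_fin (eq_bigr (fun=> c / n.+1%:R)); last first.
    by move=> j _; rewrite /w divfK// gt_eqF.
  by rewrite sumr_const card_ord/= -[(_ / _) *+ _]mulr_natr divfK// pnatr_eq0.
have m0 : 0 <= fine (borel n.+2 E) by rewrite fine_ge0.
rewrite [leLHS]exprS ler_wpM2l// -cE lerXn2r ?nnegrE//; first by rewrite ltW.
rewrite -lee_fin fineK// ge0_fin_numE//; exact: borel_fin EM.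
Qed.

End loomis_whitney.

(** * Open sets and the completed measure *)

Section borel_topology.
Context {R : realType} {n : nat}.
Local Notation borel := (rV_borel_lebesgue R n).
Local Notation mu := (@rV_lebesgue R n).

Lemma rV_ballP (x y : 'rV[R]_n) (e : R) : 0 < e ->
  ball x e y <-> forall i, `|x ord0 i - y ord0 i| < e.
Proof.
move=> e0; split=> [[_ xy] i|xy]; first exact: xy.
by split => // j i; rewrite ord1; exact: xy.
Qed.

Definition obox (a b : 'I_n -> R) : set 'rV[R]_n :=
  [set x | forall i, a i < x ord0 i < b i].
Definition cbox (a b : 'I_n -> R) : set 'rV[R]_n :=
  [set x | forall i, a i <= x ord0 i <= b i].

Lemma obox_measurable (a b : 'I_n -> R) : measurable (obox a b).
Proof.
rewrite (_ : obox a b = \bigcap_(i in [set: 'I_n]) [set x | `]a i, b i[%classic (x ord0 i)]).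
  apply: fin_bigcap_measurable => // i _.
  by rewrite -[X in measurable X]setTI; exact: measurable_coord.
apply/seteqP; split => x /=.
  by move=> h i _; rewrite /= in_itv/=; exact: h.
by move=> h i; have := h i I; rewrite /= in_itv.
Qed.

Definition rat_box_l (ck : {ffun 'I_n -> rat} * nat) (i : 'I_n) : R :=
  ratr (ck.1 i) - ck.2.+1%:R^-1.
Definition rat_box_r (ck : {ffun 'I_n -> rat} * nat) (i : 'I_n) : R :=
  ratr (ck.1 i) + ck.2.+1%:R^-1.

(** A neighbourhood base made of countably many boxes; the closed box has to stay
in U because it will carry the support of test functions. *)
Lemma open_rat_box (U : set 'rV[R]_n) (x : 'rV[R]_n) : open U -> U x ->
  exists ck, obox (rat_box_l ck) (rat_box_r ck) x /\
             cbox (rat_box_l ck) (rat_box_r ck) `<=` U.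
Proof.
move=> oU Ux.
have /nbhs_ballP[e /= e0 xeU] : nbhs x U by exact: open_nbhs_nbhs.
have e20 : 0 < e / 2 by rewrite divr_gt0.
have [k kle] : exists k : nat, k.+1%:R^-1 < e / 2.
  exists (Num.bound ((e / 2)^-1)).
  rewrite invf_plt ?posrE// (lt_le_trans (archi_boundP _)) ?ler_nat//.
  by rewrite invr_ge0 ltW.
have /choice[c cP] : forall i, exists q : rat, `|x ord0 i - ratr q| < k.+1%:R^-1.
  move=> i; have k0 : 0 < k.+1%:R^-1 :> R by rewrite invr_gt0.
  have [|q] := @rat_in_itvoo R (x ord0 i - k.+1%:R^-1) (x ord0 i + k.+1%:R^-1).
    by rewrite ltrBlDr -addrA ltrDl addr_gt0.
  by rewrite in_itv/= => /andP[a b]; exists q; rewrite distrC ltr_distl a b.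
exists ([ffun i => c i], k); split.
  by move=> i; rewrite /rat_box_l /rat_box_r /= ffunE -ltr_distl.
move=> y yb; apply: xeU; apply/rV_ballP => // i.
have := yb i; rewrite /rat_box_l /rat_box_r /= ffunE -ler_distl => yc.
rewrite (_ : x ord0 i - y ord0 i =
  (x ord0 i - ratr (c i)) - (y ord0 i - ratr (c i))); last by ring.
rewrite (le_lt_trans (ler_normB _ _))// (splitr e) ltrD//.
  exact: lt_trans (cP i) kle.
exact: le_lt_trans yc kle.
Qed.

Lemma open_borel (U : set 'rV[R]_n) : open U -> measurable U.
Proof.
move=> oU; pose box ck := obox (rat_box_l ck) (rat_box_r ck).
have -> : U = \bigcup_ck (if pselect (box ck `<=` U) then box ck else set0).
  apply/seteqP; split => [x Ux|x [ck _]]; last by case: pselect => // bU; exact: bU.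
  have [ck [xck ckU]] := open_rat_box oU Ux; exists ck => //.
  case: (pselect _) => //= nU; exfalso; apply: nU => y yb; apply: ckU => i.
  by have /andP[/ltW -> /ltW ->] := yb i.
apply: countable_bigcupT_measurable => // ck.
by case: (pselect _) => h /=; [exact: obox_measurable|exact: measurable0].
Qed.

Lemma continuous_borel (f : 'rV[R]_n -> R) : continuous f -> measurable_fun setT f.
Proof.
move=> /continuousP cf; apply: (measurability _ (RGenOInfty.measurableE R)) => //.
move=> _ [_ [a ->] <-]; rewrite setTI; apply: open_borel.
by apply: cf; exact: interval_open.
Qed.

Lemma borel_lebesgue (A : set 'rV[R]_n) :
  measurable A -> measurable (A : set (rV_leb R n)).
Proof. by move=> mA; exact: caratheodory_measurable_mu_ext. Qed.

Lemma lebesgue_borelE (A : set 'rV[R]_n) : measurable A -> mu A = borel A.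
Proof. by move=> mA; rewrite /rV_lebesgue/completed_measure_extension measurable_mu_extE. Qed.

Lemma borel_measurable_leb (d : measure_display) (T : measurableType d)
    (f : 'rV[R]_n -> T) :
  measurable_fun setT f -> measurable_fun [set: rV_leb R n] (f : rV_leb R n -> T).
Proof.
move=> mf _ Y mY; rewrite setTI; apply: borel_lebesgue.
by rewrite -[X in measurable X]setTI; exact: mf.
Qed.

Lemma lebesgue_complete : measure_is_complete (@rV_lebesgue R n).
Proof. exact: measure_is_complete_caratheodory. Qed.

#[global] Instance lebesgue_ae_filter :
  Filter (nbhs (almost_everywhere (@rV_lebesgue R n))).
Proof. exact: (ae_filter_ringOfSetsType mu). Qed.

(** The completion agrees with the iterated product measure on Borel sets. *)
Lemma integral_lebesgue_borel (F : 'rV[R]_n -> \bar R) :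
  measurable_fun setT F -> (forall x, 0 <= F x)%E ->
  (\int[mu]_x F x = \int[borel]_x F x)%E.
Proof.
move=> mF F0.
have mid : measurable_fun [set: rV_leb R n] (id : rV_leb R n -> 'rV[R]_n).
  by apply: borel_measurable_leb; exact: measurable_id.
rewrite -[RHS](@eq_measure_integral _ _ _ setT _ (pushforward mu (id : rV_leb R n -> 'rV[R]_n))).
  by rewrite (ge0_integral_pushforward mid).
by move=> A mA _; exact: lebesgue_borelE.
Qed.

Lemma bounded_cube (A : set 'rV[R]_n) : bounded_set A ->
  exists M, 0 < M /\ A `<=` cube M.
Proof.
move=> [M [_ AM]]; exists (Num.max M 0 + 1); split.
  by rewrite ltr_wpDl// le_max lexx orbT.
move=> x Ax i; have : `|x| <= Num.max M 0 + 1.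
  by apply: AM => //; rewrite (le_lt_trans (_ : _ <= Num.max M 0)) ?ltrDl ?le_max ?lexx.
apply: le_trans; have -> : `|x| = mx_norm x by []; rewrite mx_normrE.
by apply: (le_bigmax _ (fun ij : 'I_1 * 'I_n => `|x ij.1 ij.2|) (ord0, i)).
Qed.

Lemma bounded_lebesgue_fin (A : set 'rV[R]_n) :
  measurable (A : set (rV_leb R n)) -> bounded_set A -> (mu A < +oo)%E.
Proof.
move=> mA /bounded_cube[M [_ AM]].
apply: (@le_lt_trans _ _ (mu (cube M))).
  apply: le_measure => //; rewrite inE//.
  by apply: borel_lebesgue; exact: measurable_cube.
by rewrite lebesgue_borelE; [exact: cube_fin|exact: measurable_cube].
Qed.

End borel_topology.

(** * Functions along lines *)

Section lines.
Context {R : realType}.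
Local Notation leb := (@lebesgue_measure R).
Local Open Scope ereal_scope.

(** The measure is an iterated product, so lines in direction i are reached by
first slicing off the coordinates before i. *)
Lemma eq_integral_lines n (i : 'I_n) (G H : 'rV[R]_n -> \bar R) :
  measurable_fun setT G -> (forall x, 0 <= G x) ->
  measurable_fun setT H -> (forall x, 0 <= H x) ->
  (forall x, \int[leb]_s G (set_coord i s x) = \int[leb]_s H (set_coord i s x)) ->
  \int[rV_borel_lebesgue R n]_x G x = \int[rV_borel_lebesgue R n]_x H x.
Proof.
elim: n => [|n IH] in i G H *; first by case: i.
move=> mG G0 mH H0 GH; case: (unliftP ord0 i) => [j ij|i0].
  rewrite (borel_fubini1 mG G0) (borel_fubini1 mH H0); apply: eq_integral => s _; apply: (IH j) => //.
  - by apply: measurableT_comp => //; exact: measurable_cons_r.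
  - by apply: measurableT_comp => //; exact: measurable_cons_r.
  move=> y; have := GH (rV_cons (s, y)); rewrite ij.
  by under eq_integral do rewrite set_coord_consS;
     under [RHS]eq_integral do rewrite set_coord_consS.
rewrite (borel_fubini2 mG G0) (borel_fubini2 mH H0); apply: eq_integral => y _.
have := GH (rV_cons (0%R, y)); rewrite i0.
by under eq_integral do rewrite set_coord_cons0;
   under [RHS]eq_integral do rewrite set_coord_cons0.
Qed.

Lemma FTC_line (g g' : R -> R) (a b : R) : (a < b)%R ->
  (forall s : R, is_derive s 1%R g (g' s)) -> continuous g' ->
  \int[leb]_(s in `[a, b]) (g' s)%:E = (g b)%:E - (g a)%:E.
Proof.
move=> ab gg' cg'.
have cg : continuous g.
  by move=> s; apply: differentiable_continuous; apply/derivable1_diffP; have [] := gg' s.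
apply: continuous_FTC2 => //.
- exact: continuous_subspaceT.
- split.
  + by move=> s _; have [] := gg' s.
  + by apply: cvg_at_right_filter; exact: cg.
  + by apply: cvg_at_left_filter; exact: cg.
by move=> s _; rewrite derive1E; exact: derive_val.
Qed.

(** Integrate g' from a point where g vanishes up to t. *)
Lemma line_bound (g g' : R -> R) (M t : R) :
  (forall s : R, is_derive s 1%R g (g' s)) -> continuous g' ->
  (forall s, (M < `|s|)%R -> g s = 0%R) ->
  (`|g t|)%:E <= \int[leb]_s (`|g' s|)%:E.
Proof.
move=> gg' cg' g0.
pose a := (- (Num.max M `|t| + 1))%R.
have Mt0 : (0 <= Num.max M `|t|)%R by rewrite le_max normr_ge0 orbT.
have at_ : (a < t)%R.
  rewrite /a ltrNl (@le_lt_trans _ _ `|t|%R)//; first by rewrite ler_normr lexx orbT.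
  by rewrite (@le_lt_trans _ _ (Num.max M `|t|))%R ?ltrDl// le_max lexx orbT.
have ga : g a = 0%R.
  apply: g0; rewrite /a normrN ger0_norm ?addr_ge0//.
  by rewrite (@le_lt_trans _ _ (Num.max M `|t|))%R ?ltrDl// le_max lexx.
have mg' : measurable_fun setT (EFin \o g').
  by apply/measurable_EFinP; exact: continuous_measurable_fun.
have mng' : measurable_fun setT (fun s => `|g' s|%:E).
  by apply/measurable_EFinP; apply: measurableT_comp => //; exact: continuous_measurable_fun.
have := FTC_line at_ gg' cg'; rewrite ga sube0 => E.
rewrite -abse_EFin -E (le_trans (le_abse_integral _ _ _))//.
  exact: measurable_funTS.
by apply: ge0_subset_integral.
Qed.

(** Stated through positive and negative parts because only nonnegative
integrands can be compared line by line with eq_integral_lines. *)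
Lemma line_mean0 (g g' : R -> R) (M : R) :
  (forall s : R, is_derive s 1%R g (g' s)) -> continuous g' ->
  (forall s, (M < `|s|)%R -> g s = 0%R) -> 
  (forall s, (M < `|s|)%R -> g' s = 0%R) ->
  \int[leb]_s (EFin \o g')^\+ s = \int[leb]_s (EFin \o g')^\- s.
Proof.
move=> gg' cg' g0 g'0.
pose b := (Num.max M 0 + 1)%R.
have b0 : (0 < b)%R by rewrite ltr_wpDl// le_max lexx orbT.
have Mb : (M < b)%R.
  by rewrite (@le_lt_trans _ _ (Num.max M 0))%R ?ltrDl// le_max lexx.
have bb : (- b < b)%R by rewrite gtrN.
have mg' : measurable_fun setT (EFin \o g').
  by apply/measurable_EFinP; exact: continuous_measurable_fun.
have := FTC_line bb gg' cg'.
rewrite !g0 ?subee//; last 2 first.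
- by rewrite normrN gtr0_norm.
- by rewrite gtr0_norm.
rewrite integralE.
have out s : ~ (`[(- b)%R, b]%classic s) -> g' s = 0%R.
  rewrite /= in_itv/= => /negP; rewrite -ler_norml -ltNge => /(lt_trans Mb).
  exact: g'0.
have ip : leb.-integrable `[(- b)%R, b] (EFin \o g').
  apply: continuous_compact_integrable; first exact: segment_compact.
  exact: continuous_subspaceT.
have -> : \int[leb]_s (EFin \o g')^\+ s = \int[leb]_(s in `[(- b)%R, b]) (EFin \o g')^\+ s.
  rewrite [RHS]integral_mkcond; apply: eq_integral => s _; rewrite patchE.
  case: ifPn => // /negP; rewrite inE => /out g's0.
  by rewrite funeposE/= g's0 maxxx.
have -> : \int[leb]_s (EFin \o g')^\- s = \int[leb]_(s in `[(- b)%R, b]) (EFin \o g')^\- s.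
  rewrite [RHS]integral_mkcond; apply: eq_integral => s _; rewrite patchE.
  case: ifPn => // /negP; rewrite inE => /out g's0.
  by rewrite funenegE/= g's0 oppr0 maxxx.
have := integrable_pos_fin_num _ ip; have := integrable_neg_fin_num _ ip.
move=> /(_ (measurable_itv _)) + /(_ (measurable_itv _)).
by move=> fn fp /eqP; rewrite sube_eq ?fin_num_adde_defr// add0e => /eqP.
Qed.

End lines.

(** * Smooth functions *)

Section directional_smoothness.
Context {R : realType} {V : normedModType R}.
Implicit Types (v w : V -> R) (x : V).

Lemma line_growth v x (e : V) (t : R) :
  (fun h : R => h^-1 *: (((fun s : R => v (s *: e + x)) \o shift t) (h *: (1 : R)) -
     v (t *: e + x))) =
  (fun h : R => h^-1 *: ((v \o shift (t *: e + x)) (h *: e) - v (t *: e + x))).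
Proof.
apply/funext => h /=; congr (_ *: (v _ - _)).
by rewrite -[h *: (1 : R)]/(h * 1) mulr1 scalerDl addrA.
Qed.

(** A directional derivative is the derivative of the restriction to a line, which
gives access to the one-variable chain rule. *)
Lemma is_derive_line v x (e : V) (t d : R) :
  is_derive (t *: e + x) e v d <-> is_derive t 1 (fun s : R => v (s *: e + x)) d.
Proof.
by split => -[h <-]; split; move: h; rewrite /derivable /derive line_growth.
Qed.

Lemma is_derive_comp (g : R -> R) v x (e : V) (dg dv : R) :
  is_derive x e v dv -> is_derive (v x) 1 g dg ->
  is_derive x e (g \o v) (dg * dv).
Proof.
rewrite -[X in is_derive X](add0r x) -(scale0r e) => /is_derive_line dvx.
rewrite -[X in v X](add0r x) -(scale0r e) => dgx.
apply/is_derive_line.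
have := @is_derive1_comp R g (fun s : R => v (s *: e + x)) 0 dg dv.
exact.
Qed.

Section smooth_algebra.
Context {I : Type} (e : I -> V).

Definition dpartial (i : I) v : V -> R := fun x => 'D_(e i) v x.

(** Smoothness along a family of directions: the coordinate directions give the
smoothness required of test functions, the direction 1 of the line gives
ordinary smoothness (smooth1), and the same algebra serves both. *)
Definition dsmooth v := forall s : seq I,
  continuous (foldr dpartial v s) /\
  forall i x, derivable (foldr dpartial v s) x (e i).

Inductive generated (S : (V -> R) -> Prop) : (V -> R) -> Prop :=
| Gen_base v : S v -> generated S v
| Gen_cst c : generated S (fun=> c)
| Gen_add v w : generated S v -> generated S w -> generated S (v \+ w)
| Gen_mul v w : generated S v -> generated S w -> generated S (v \* w).

Lemma dsmooth_coind (P : (V -> R) -> Prop) :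
  (forall v, P v -> continuous v /\ forall i x, derivable v x (e i)) ->
  (forall v i, P v -> P (dpartial i v)) ->
  forall v, P v -> dsmooth v.
Proof.
move=> Pc Pd v Pv s; apply: Pc; elim: s => //= i s IH; exact: Pd.
Qed.

(** Derivatives of sums and products stay in the algebra generated by S as soon as
derivatives of its generators do; no bookkeeping of higher derivatives is
needed. *)
Lemma dsmooth_generated S :
  (forall v, S v -> continuous v /\ forall i x, derivable v x (e i)) ->
  (forall v i, S v -> generated S (dpartial i v)) ->
  forall v, generated S v -> dsmooth v.
Proof.
move=> Sc Sd; have Gc v : generated S v -> continuous v /\ forall i x, derivable v x (e i).
  elim=> [w|c|a b _ [ca da] _ [cb db]|a b _ [ca da] _ [cb db]].
  - exact: Sc.
  - split=> [x|i x]; [exact: cvg_cst|exact: derivable_cst].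
  - split=> [x|i x]; first by apply: cvgD; [exact: ca|exact: cb].
    exact: (derivableD (da i x) (db i x)).
  - split=> [x|i x]; first by apply: cvgM; [exact: ca|exact: cb].
    exact: (derivableM (da i x) (db i x)).
apply: (dsmooth_coind Gc) => v i; elim=> [w|c|a b Ga IHa Gb IHb|a b Ga IHa Gb IHb].
- exact: Sd.
- rewrite (_ : dpartial i _ = fun=> 0); first exact: Gen_cst.
  by apply/funext => x; rewrite /dpartial (derive_cst c).
- rewrite (_ : dpartial i _ = dpartial i a \+ dpartial i b); first exact: Gen_add.
  apply/funext => x; rewrite /dpartial.
  by apply: (deriveD ((Gc _ Ga).2 i x) ((Gc _ Gb).2 i x)).
- rewrite (_ : dpartial i _ = (a \* dpartial i b) \+ (b \* dpartial i a)).
    by apply: Gen_add; apply: Gen_mul.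
  apply/funext => x; rewrite /dpartial.
  by apply: (deriveM ((Gc _ Ga).2 i x) ((Gc _ Gb).2 i x)).
Qed.

Lemma dsmooth_continuous v : dsmooth v -> continuous v.
Proof. by move=> /(_ [::])[]. Qed.

Lemma dsmooth_derivable v i x : dsmooth v -> derivable v x (e i).
Proof. by move=> /(_ [::])[]. Qed.

Lemma dsmooth_partial v i : dsmooth v -> dsmooth (dpartial i v).
Proof. by move=> sv s; have := sv (rcons s i); rewrite foldr_rcons. Qed.

Let gen_smooth v : generated dsmooth v -> dsmooth v.
Proof.
apply: dsmooth_generated => [w sw|w i sw].
  by split; [exact: dsmooth_continuous|move=> i x; exact: dsmooth_derivable].
by apply: Gen_base; exact: dsmooth_partial.
Qed.

Lemma dsmooth_cst c : dsmooth (fun=> c).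
Proof. by apply: gen_smooth; exact: Gen_cst. Qed.

Lemma dsmoothD v w : dsmooth v -> dsmooth w -> dsmooth (v \+ w).
Proof. by move=> sv sw; apply: gen_smooth; apply: Gen_add; exact: Gen_base. Qed.

Lemma dsmoothM v w : dsmooth v -> dsmooth w -> dsmooth (v \* w).
Proof. by move=> sv sw; apply: gen_smooth; apply: Gen_mul; exact: Gen_base. Qed.

Lemma dsmooth_prod (J : Type) (r : seq J) (F : J -> V -> R) :
  (forall j, dsmooth (F j)) -> dsmooth (fun x => \prod_(j <- r) F j x).
Proof.
move=> sF; elim: r => [|j r IH].
  rewrite (_ : (fun=> _) = fun=> 1); first exact: dsmooth_cst.
  by apply/funext => x; rewrite big_nil.
rewrite (_ : (fun=> _) = F j \* (fun x => \prod_(k <- r) F k x)).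
  exact: (dsmoothM (sF j) IH).
by apply/funext => x; rewrite big_cons.
Qed.

End smooth_algebra.
End directional_smoothness.

Section smooth_composition.
Context {R : realType}.

Definition smooth1 (g : R -> R) := dsmooth (fun _ : unit => 1 : R^o) (g : R^o -> R).

Lemma smooth1_is_derive g (s : R) : smooth1 g -> is_derive s 1 g (derive1 g s).
Proof.
move=> sg; split; last by rewrite derive1E.
exact: (@dsmooth_derivable _ _ _ _ g tt s sg).
Qed.

Lemma smooth1_derive1 g : smooth1 g -> smooth1 (derive1 g).
Proof.
move=> sg; rewrite (_ : (derive1 g) = dpartial (fun _ : unit => 1 : R^o) tt g).
  exact: dsmooth_partial.
by apply/funext => s; rewrite derive1E.
Qed.

Lemma smooth1_generated (S : (R -> R) -> Prop) :
  (forall g, S g -> exists2 g' : R -> R, forall s : R, is_derive s 1 g (g' s) &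
     @generated R R^o S g') ->
  forall g, @generated R R^o S g -> smooth1 g.
Proof.
move=> Sd; apply: dsmooth_generated => [g /Sd[g' dg _]|g [] /Sd[g' dg Sg']].
  split=> [s|_ s]; last by have [] := dg s.
  by apply: differentiable_continuous; apply/derivable1_diffP; have [] := dg s.
rewrite (_ : dpartial _ _ _ = g')//; apply/funext => s; have := dg s.
by rewrite /dpartial => h; rewrite derive_val.
Qed.

Context {V : normedModType R} {I : Type} (e : I -> V).

(** By the chain rule, smooth functions and the functions k o v with k smooth
generate an algebra that is stable under derivation. *)
Lemma dsmooth_comp (g : R -> R) (v : V -> R) :
  smooth1 g -> dsmooth e v -> dsmooth e (g \o v).
Proof.
move=> sg sv.
pose S w := dsmooth e w \/ exists2 k, smooth1 k & w = k \o v.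
apply: (@dsmooth_generated _ _ _ e S); last by apply: Gen_base; right; exists g.
  move=> w [sw|[k sk ->]].
    by split; [exact: dsmooth_continuous sw|move=> i x; exact: dsmooth_derivable].
  split=> [x|i x].
    by apply: continuous_comp; [exact: (dsmooth_continuous sv)|exact: (dsmooth_continuous sk)].
  have dv := derivableP (@dsmooth_derivable _ _ _ e v i x sv).
  by have [] := is_derive_comp dv (smooth1_is_derive (v x) sk).
move=> w i [sw|[k sk ->]]; first by apply: Gen_base; left; exact: dsmooth_partial.
rewrite (_ : dpartial e i _ = ((derive1 k) \o v) \* dpartial e i v).
  apply: Gen_mul; apply: Gen_base; last by left; exact: dsmooth_partial.
  by right; exists (derive1 k); [exact: smooth1_derive1|].
apply/funext => x; have dv := derivableP (@dsmooth_derivable _ _ _ e v i x sv).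
have h := is_derive_comp dv (smooth1_is_derive (v x) sk).
by rewrite /dpartial/= derive_val.
Qed.

End smooth_composition.

Section sqrt_primitive.
Context {R : realType} (e : R) (e0 : 0 < e).

(** Smooth approximation of the absolute value, up to an error of at most e. *)
Definition soft_abs (s : R) : R := Num.sqrt (e ^+ 2 + s ^+ 2).

Lemma soft_abs_arg_gt0 s : 0 < e ^+ 2 + s ^+ 2.
Proof. by rewrite ltr_pwDl ?exprn_gt0// sqr_ge0. Qed.

Lemma soft_abs_gt0 s : 0 < soft_abs s.
Proof. by rewrite sqrtr_gt0 soft_abs_arg_gt0. Qed.

Lemma sqr_soft_abs s : soft_abs s ^+ 2 = e ^+ 2 + s ^+ 2.
Proof. by rewrite sqr_sqrtr// ltW// soft_abs_arg_gt0. Qed.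

Lemma is_derive_soft_abs (s : R) : is_derive s 1 soft_abs (s / soft_abs s).
Proof.
have dq : is_derive s 1 (fun t : R => e ^+ 2 + t ^+ 2) (2 * s).
  rewrite (_ : (fun t : R => _) = cst (e ^+ 2) + (id : R -> R) ^+ 2); last first.
    by apply/funext => t; rewrite /= fctE.
  have hX := @is_deriveX R R^o id 2 s 1 1 (is_derive_id _ _).
  have hD := @is_deriveD R R^o R^o _ _ s 1 _ _ (is_derive_cst (e ^+ 2) s 1) hX.
  apply: (is_derive_eq hD).
  by rewrite add0r -[_ *: _]/(_ * _) mulr1 expr1.
have h := @is_derive1_comp R Num.sqrt (fun t : R => e ^+ 2 + t ^+ 2) s _ _
  (is_derive1_sqrt (soft_abs_arg_gt0 s)) dq.
apply: (is_derive_eq h); rewrite /soft_abs invfM; field.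
by rewrite gt_eqF// soft_abs_gt0.
Qed.

Lemma is_derive_soft_absV (s : R) :
  is_derive s 1 (fun t => (soft_abs t)^-1) (- (s * (soft_abs s)^-1 ^+ 3)).
Proof.
have h := is_derive_soft_abs s.
split; first by apply: derivableV; [rewrite gt_eqF// soft_abs_gt0|have [] := h].
rewrite (@deriveV _ _ soft_abs); [|by rewrite gt_eqF// soft_abs_gt0|by have [] := h].
rewrite derive_val -[_ *: _]/(_ * _).
field. by rewrite gt_eqF// soft_abs_gt0.
Qed.

(** The derivative of soft_abs is s / soft_abs(s), so s, soft_abs and its inverse
generate an algebra that is stable under derivation. *)
Lemma smooth1_soft_abs : smooth1 soft_abs.
Proof.
pose S (g : R -> R) := [\/ g = soft_abs, g = (fun t => (soft_abs t)^-1) | g = id].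
have Sid : @generated R R^o S id by apply: Gen_base; apply: Or33.
have Sinv : @generated R R^o S (fun t => (soft_abs t)^-1) by apply: Gen_base; apply: Or32.
apply: (@smooth1_generated _ S); last by apply: Gen_base; apply: Or31.
move=> g [->|->|->].
- exists (id \* (fun t => (soft_abs t)^-1)); last exact: Gen_mul.
  exact: is_derive_soft_abs.
- exists ((fun=> -1) \* (id \* ((fun t => (soft_abs t)^-1) \* ((fun t => (soft_abs t)^-1) \* (fun t => (soft_abs t)^-1))))).
    move=> s; apply: is_derive_eq; first exact: is_derive_soft_absV.
    by rewrite /= mulN1r !exprS expr0 mulr1.
  by do ?[apply: Gen_mul] => //; exact: Gen_cst.
- exists (fun=> 1); last exact: Gen_cst.
  by move=> s; exact: is_derive_id.
Qed.

End sqrt_primitive.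

(** * Bump functions and test functions *)

Section flat_exponential.
Context {R : realType}.

(** The derivatives of exp(-1/x), extended by 0, are linear combinations of these
functions (is_derive_flat_exp). *)
Definition flat_exp (m : nat) (x : R) : R :=
  if 0 < x then x^-1 ^+ m * expR (- x^-1) else 0.

Lemma flat_exp_le0 m x : x <= 0 -> flat_exp m x = 0.
Proof. by rewrite /flat_exp leNgt => /negbTE ->. Qed.

Lemma flat_exp_ge0 m x : 0 <= flat_exp m x.
Proof.
rewrite /flat_exp; case: ifP => // x0.
by rewrite mulr_ge0 ?exprn_ge0 ?invr_ge0 ?ltW ?expR_gt0.
Qed.

(** The series of exp gives exp y >= y^(m+1) / (m+1)! at y = 1/x; this flatness at
0 is what makes the derivatives continuous there. *)
Lemma flat_exp_le_lin m x : 0 < x -> flat_exp m x <= m.+1`!%:R * x.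
Proof.
move=> x0; rewrite /flat_exp x0; set y := x^-1.
have y0 : 0 < y by rewrite invr_gt0.
have f0 : 0 < (m.+1`!)%:R :> R by rewrite ltr0n fact_gt0.
have : y ^+ m.+1 / (m.+1)`!%:R <= expR y.
  by apply: le_trans (expR_ge1Dxn m (ltW y0)); rewrite lerDr.
rewrite ler_pdivrMr// expRN ler_pdivrMr ?expR_gt0// => h.
have -> : y ^+ m = x * y ^+ m.+1 by rewrite exprS mulrA mulfV ?gt_eqF// mul1r.
by rewrite (le_trans (ler_wpM2l (ltW x0) h))// le_eqVlt; apply/orP; left; apply/eqP; ring.
Qed.

Lemma is_derive_flat_exp m (x : R) :
  is_derive x 1 (flat_exp m) (- m%:R * flat_exp m.+1 x + flat_exp m.+2 x).
Proof.
have [x0|x0|->] := ltgtP x 0.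
- rewrite !flat_exp_le0 ?ltW// mulr0 addr0.
  have hc := @is_derive_cst R R^o R^o 0 x 1.
  apply: (@near_eq_is_derive R R^o R^o (cst 0) _ x 1 0 _ hc).
  near=> y; rewrite flat_exp_le0// ltW//.
  by near: y; exact: lt_nbhsl.
- apply: (@near_eq_is_derive R R^o R^o (fun t => t^-1 ^+ m * expR (- t^-1))).
    near=> y; rewrite /flat_exp ifT//.
    by near: y; exact: lt_nbhsr.
  have xN0 : x != 0 by rewrite gt_eqF.
  have hV : is_derive x 1 (fun t : R => t^-1) (- x ^- 2).
    split; first by apply: (@derivableV _ R^o id).
    by rewrite (@deriveV _ R^o id)// derive_id -[_ *: _]/(_ * _) mulr1.
  have hX := @is_deriveX R R^o (fun t : R => t^-1) m x 1 _ hV.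
  have hN := @is_deriveN R R^o R^o (fun t : R => t^-1) x 1 _ hV.
  have hE := @is_derive1_comp R expR (fun t : R => - t^-1) x _ _ (is_derive_expR _) hN.
  have hM := @is_deriveM R R^o _ _ x 1 _ _ hX hE.
  rewrite (_ : (fun t : R^o => _) =
    (fun t : R => t^-1) ^+ m * (expR \o (fun t : R => - t^-1))); last first.
    by apply/funext => t; rewrite /= !fctE.
  apply: (is_derive_eq hM); rewrite /flat_exp x0 !fctE /=.
  case: m {hX hM} => [|m] /=.
    rewrite /GRing.scale/= !exprS !expr0. field. by [].
  rewrite /GRing.scale/= !exprS. field. by [].
rewrite !flat_exp_le0// mulr0 addr0.
have F0 : h^-1 *: ((flat_exp m \o shift (0 : R)) (h *: (1 : R)) - flat_exp m 0)
    @[h --> (0 : R)^'] --> (0 : R).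
  apply/cvgr0Pnorm_le => eps eps0.
  have f0 : 0 < (m.+2`!)%:R :> R by rewrite ltr0n fact_gt0.
  near=> h; rewrite /= addr0 -[h *: (1 : R)]/(h * 1) mulr1 (flat_exp_le0 m (lexx 0)).
  rewrite subr0 -[h^-1 *: _]/(h^-1 * _).
  have [h0|h0] := leP h 0; first by rewrite flat_exp_le0// mulr0 normr0 ltW.
  have -> : h^-1 * flat_exp m h = flat_exp m.+1 h.
    by rewrite /flat_exp h0 mulrA -exprS.
  rewrite ger0_norm ?flat_exp_ge0// (le_trans (flat_exp_le_lin _ h0))//.
  rewrite -ler_pdivlMl// -(gtr0_norm h0).
  near: h; apply: dnbhs0_le.
  by rewrite mulr_gt0// invr_gt0.
by split; [apply/cvg_ex; exists 0|exact: cvg_lim].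
Unshelve. all: by end_near. Qed.

Lemma smooth1_flat_exp : smooth1 (flat_exp 0).
Proof.
pose S (g : R -> R) := exists m, g = flat_exp m.
have Sm m : @generated R R^o S (flat_exp m) by apply: Gen_base; exists m.
apply: (@smooth1_generated _ S) (Sm 0%N) => g [m ->].
exists (((fun=> - m%:R) \* flat_exp m.+1) \+ flat_exp m.+2).
  exact: is_derive_flat_exp.
by apply: Gen_add => //; apply: Gen_mul => //; exact: Gen_cst.
Qed.

Lemma flat_exp0_le1 x : flat_exp 0 x <= 1.
Proof.
rewrite /flat_exp; case: ifP => // x0.
by rewrite expr0 mul1r -expR0 ler_expR oppr_le0 invr_ge0 ltW.
Qed.

Lemma flat_exp0_neq0 x : flat_exp 0 x != 0 -> 0 < x.
Proof. by rewrite ltNge; apply: contraNN => /flat_exp_le0 ->. Qed.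

Lemma flat_exp0_cvg x : 0 < x -> flat_exp 0 (k.+1%:R * x) @[k --> \oo] --> (1 : R).
Proof.
move=> x0.
have E : (fun k : nat => flat_exp 0 (k.+1%:R * x)) = (fun k => expR (- (k.+1%:R^-1 * x^-1))).
  by apply/funext => k; rewrite /flat_exp mulr_gt0// expr0 mul1r invfM.
have h : - (k.+1%:R^-1 * x^-1) @[k --> \oo] --> (- (0 * x^-1) : R).
  by apply: cvgN; apply: cvgM; [exact: cvg_harmonic|exact: cvg_cst].
rewrite mul0r oppr0 in h.
have := @continuous_cvg _ _ _ _ _ _ expR 0 (@continuous_expR R 0) h.
by move=> /(_ _); rewrite E expR0.
Qed.

End flat_exponential.

Section test_functions.
Context {R : realType} {n : nat}.
Implicit Types (Omega K : set 'rV[R]_n) (v phi psi : 'rV[R]_n -> R).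
Local Notation dir := (fun i : 'I_n => delta_mx ord0 i : 'rV[R]_n).

Lemma smoothE v : smooth v = dsmooth dir v.
Proof. by []. Qed.

Lemma smoothM v w : smooth v -> smooth w -> smooth (v \* w).
Proof. exact: (@dsmoothM _ _ _ dir). Qed.

Lemma smooth_comp (g : R -> R) v : smooth1 g -> smooth v -> smooth (g \o v).
Proof. exact: (@dsmooth_comp _ _ _ dir). Qed.

Lemma smooth_affine_coord (i : 'I_n) (k c : R) :
  smooth (fun x : 'rV[R]_n => k * (x ord0 i - c)).
Proof.
have sc : dsmooth dir (fun x : 'rV[R]_n => x ord0 i).
  pose S v := v = (fun x : 'rV[R]_n => x ord0 i).
  have dS j x : is_derive x (dir j) (fun x : 'rV[R]_n => x ord0 i) (dir j ord0 i).
    rewrite -[x]add0r -(scale0r (dir j)); apply/is_derive_line.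
    rewrite (_ : (fun s : R => _) = (fun s : R => s * dir j ord0 i + x ord0 i)); last first.
      by apply/funext => s; rewrite !mxE.
    have h := @is_deriveM R R^o id (cst (dir j ord0 i)) 0 1 _ _ (is_derive_id _ _) (@is_derive_cst R R^o R^o _ _ _).
    have hD := @is_deriveD R R^o R^o _ _ 0 1 _ _ h (@is_derive_cst R R^o R^o (x ord0 i) 0 1).
    by apply: (is_derive_eq hD); rewrite /GRing.scale/= mul0r mulr1 add0r addr0.
  apply: (@dsmooth_generated _ _ _ dir S); last by apply: Gen_base.
    move=> w ->; split; first exact: coord_continuous.
    by move=> j x; have [] := dS j x.
  move=> w j ->; rewrite (_ : dpartial _ _ _ = fun=> dir j ord0 i); first exact: Gen_cst.
  by apply/funext => x; have h := dS j x; rewrite /dpartial derive_val.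
change (dsmooth dir ((fun=> k) \* ((fun x : 'rV[R]_n => x ord0 i) \+ (fun=> - c)))).
apply: dsmoothM; first exact: dsmooth_cst.
exact: (dsmoothD sc (dsmooth_cst _ _)).
Qed.

Lemma rV_compact_closed K : compact K -> closed K.
Proof. by apply: compact_closed; exact: norm_hausdorff. Qed.

Lemma test_functionI Omega K phi : smooth phi -> compact K ->
  (forall x, phi x != 0 -> K x) -> K `<=` Omega -> test_function Omega phi.
Proof.
move=> sphi cK phiK KO; have clK : closure [set x | phi x != 0] `<=` K.
  by rewrite closureE; apply: smallest_sub => //; exact: rV_compact_closed.
split=> //; last exact: subset_trans KO.
by apply: subclosed_compact cK clK; exact: closed_closure.
Qed.

Lemma test_function_supp Omega phi : test_function Omega phi ->
  exists K, [/\ compact K, K `<=` Omega & forall x, ~ K x -> phi x = 0].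
Proof.
move=> [_ cK KO]; exists (closure [set x | phi x != 0]); split => // x nKx.
by apply/eqP; apply: contra_notT nKx => h; exact: subset_closure.
Qed.

(** Off the closed set K the function vanishes in a whole neighbourhood. *)
Lemma partial_supp K phi i : closed K -> (forall x, ~ K x -> phi x = 0) ->
  forall x, ~ K x -> partial i phi x = 0.
Proof.
move=> cK phi0 x nKx; rewrite /partial -[RHS](derive_cst (0 : R) x (dir i)).
apply: near_eq_derive; have : nbhs x (~` K) by apply: open_nbhs_nbhs; split => //; exact: closed_openC.
by apply: filterS => y /phi0.
Qed.

Lemma test_function_comp Omega (g : R -> R) phi :
  smooth1 g -> g 0 = 0 -> test_function Omega phi -> test_function Omega (g \o phi).
Proof.
move=> sg g0 tphi; have [K [cK KO K0]] := test_function_supp tphi.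
have [sphi _ _] := tphi.
apply: (test_functionI (smooth_comp sg sphi) cK _ KO) => x.
 apply: contra_neqP => nKx /=; by rewrite K0.
Qed.

Lemma partial_comp (g : R -> R) phi i x : smooth1 g -> smooth phi ->
  partial i (g \o phi) x = derive1 g (phi x) * partial i phi x.
Proof.
move=> sg sphi.
have dv := derivableP (@dsmooth_derivable _ _ _ dir phi i x sphi).
have h := is_derive_comp dv (smooth1_is_derive (phi x) sg).
by rewrite /partial/= derive_val.
Qed.

Lemma compact_bounded_fun K phi : compact K -> continuous phi ->
  (forall x, ~ K x -> phi x = 0) -> exists2 B, 0 < B & forall x, `|phi x| <= B.
Proof.
move=> cK cphi phi0.
have /compact_bounded[M [_ MK]] : compact (phi @` K).
  by apply: continuous_compact => //; exact: continuous_subspaceT.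
exists (`|M| + 1) => [|x]; first by rewrite ltr_wpDl.
have [Kx|nKx] := pselect (K x); last by rewrite phi0// normr0 addr_ge0.
by apply: (MK (`|M| + 1)); [rewrite (le_lt_trans (ler_norm _))// ltrDl|exists x].
Qed.

Lemma cbox_compact (a b : 'I_n -> R) : compact (cbox a b).
Proof.
rewrite (_ : cbox a b = [set x | forall i, `[a i, b i]%classic (x ord0 i)]).
  by apply: (@rV_compact R n (fun i => `[a i, b i]%classic)) => i; exact: segment_compact.
by apply/seteqP; split => x /= h i; have := h i; rewrite /= in_itv.
Qed.

(** Test functions that converge to the indicator of an open box (box_bump_cvg). *)
Definition box_bump (a b : 'I_n -> R) (k : R) (x : 'rV[R]_n) : R :=
  \prod_(i < n) (flat_exp 0 (k * (x ord0 i - a i)) * flat_exp 0 (- k * (x ord0 i - b i))).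

Lemma box_bump_ge0 a b k x : 0 <= box_bump a b k x.
Proof. by apply: prodr_ge0 => i _; rewrite mulr_ge0 ?flat_exp_ge0. Qed.

Lemma box_bump_le1 a b k x : box_bump a b k x <= 1.
Proof.
apply: prodr_ile1 => // i _; apply/andP; split; first by rewrite mulr_ge0 ?flat_exp_ge0.
by rewrite mulr_ile1 ?flat_exp_ge0 ?flat_exp0_le1.
Qed.

Lemma box_bump_neq0 a b k x : 0 < k -> box_bump a b k x != 0 -> obox a b x.
Proof.
move=> k0 /prodf_neq0 h i; have := h i isT; rewrite mulf_eq0 negb_or => /andP[].
move=> /flat_exp0_neq0; rewrite pmulr_rgt0// subr_gt0 => -> /flat_exp0_neq0.
by rewrite mulNr -mulrN pmulr_rgt0// opprB subr_gt0 => ->.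
Qed.

Lemma test_function_box_bump Omega a b k : 0 < k -> cbox a b `<=` Omega ->
  test_function Omega (box_bump a b k).
Proof.
move=> k0 abO; apply: (@test_functionI _ (cbox a b)) => //.
- rewrite smoothE; apply: dsmooth_prod => i.
  apply: dsmoothM; apply: (dsmooth_comp smooth1_flat_exp); exact: smooth_affine_coord.
- exact: cbox_compact.
- by move=> x /(box_bump_neq0 k0) h i; have /andP[/ltW -> /ltW ->] := h i.
Qed.

Lemma cvg_prod1 (J : Type) (r : seq J) (F : J -> nat -> R) :
  (forall j, F j k @[k --> \oo] --> (1 : R)) ->
  \prod_(j <- r) F j k @[k --> \oo] --> (1 : R).
Proof.
move=> F1; elim: r => [|j r IH].
  by under eq_fun do rewrite big_nil; exact: cvg_cst.
under eq_fun do rewrite big_cons.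
by have := cvgM (F1 j) IH; move=> /(_ _); rewrite mulr1.
Qed.

Lemma box_bump_cvg a b x : box_bump a b k.+1%:R x @[k --> \oo] --> (\1_(obox a b) x : R).
Proof.
have [h|h] := pselect (obox a b x); last first.
  rewrite indicE memNset// (_ : (fun k => _) = fun=> 0); first exact: cvg_cst.
  apply/funext => k; apply/eqP; apply: contra_notT h; exact: box_bump_neq0.
rewrite indicE mem_set// /box_bump; apply: cvg_prod1 => i.
have /andP[ai bi] := h i.
have ai0 : 0 < x ord0 i - a i by rewrite subr_gt0.
have bi0 : 0 < b i - x ord0 i by rewrite subr_gt0.
have E k : - k.+1%:R * (x ord0 i - b i) = k.+1%:R * (b i - x ord0 i).
  by rewrite mulNr -mulrN opprB.
under eq_fun do rewrite E.
by have := cvgM (flat_exp0_cvg ai0) (flat_exp0_cvg bi0); move=> /(_ _); rewrite mulr1.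
Qed.

End test_functions.

(* From here on the iterated product enters only through the results above. *)
Opaque rV_borel_lebesgue.
(** * Integration by parts for test functions *)

Section test_function_integrals.
Context {R : realType} {n : nat}.
Implicit Types (Omega K : set 'rV[R]_n) (v phi psi : 'rV[R]_n -> R).
Local Notation mu := (@rV_lebesgue R n).
Local Notation borel := (rV_borel_lebesgue R n).
Local Notation leb := (@lebesgue_measure R).

Lemma continuous_leb phi : continuous phi ->
  measurable_fun [set: rV_leb R n] (phi : rV_leb R n -> R).
Proof. by move=> cphi; apply: borel_measurable_leb; exact: continuous_borel. Qed.

Lemma open_leb Omega : open Omega -> measurable (Omega : set (rV_leb R n)).
Proof. by move=> oO; apply: borel_lebesgue; exact: open_borel. Qed.

Lemma compact_leb K : compact K -> measurable (K : set (rV_leb R n)).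
Proof.
move=> /rV_compact_closed cK; rewrite -(setCK K).
by apply: measurableC; apply: open_leb; exact: closed_openC.
Qed.

Lemma compact_leb_fin K : compact K -> (mu K < +oo)%E.
Proof.
move=> cK; apply: bounded_lebesgue_fin; first exact: compact_leb.
exact: compact_bounded.
Qed.

Lemma compact_support_integrable K phi : compact K -> continuous phi ->
  (forall x, ~ K x -> phi x = 0) -> mu.-integrable setT (EFin \o phi).
Proof.
move=> cK cphi phi0; have [B B0 phiB] := compact_bounded_fun cK cphi phi0.
have mK := compact_leb cK.
apply: (@le_integrable _ _ _ mu setT measurableT _ (fun x => (B * \1_K x)%:E)).
- by apply/measurable_EFinP; exact: continuous_leb.
- move=> x _ /=; rewrite lee_fin normrM (gtr0_norm B0) indicE normr_nat.
  have [Kx|nKx] := boolP (x \in K); first by rewrite mulr1.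
  by rewrite phi0 ?normr0 ?mulr0// => Kx; rewrite mem_set in nKx.
- under eq_fun do rewrite EFinM; apply: integrableZl => //.
  apply: integrable_indic_fin => //; exact: compact_leb_fin.
Qed.

Lemma line_through (i : 'I_n) (x : 'rV[R]_n) (s : R) :
  set_coord i s x = s *: delta_mx ord0 i + set_coord i 0 x.
Proof.
apply/rowP => j; rewrite !mxE eqxx /=; case: (j == i) => /=.
  by rewrite mulr1 addr0.
by rewrite mulr0 add0r.
Qed.

Lemma is_derive_set_coord (i : 'I_n) phi x (s : R) : smooth phi ->
  is_derive s 1 (fun t : R => phi (set_coord i t x))
    (partial i phi (set_coord i s x)).
Proof.
move=> sphi; under eq_fun do rewrite line_through; rewrite (line_through i x s).
have d := derivableP (@dsmooth_derivable R 'rV[R]_n _ (fun i => delta_mx ord0 i)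
  phi i (s *: delta_mx ord0 i + set_coord i 0 x) sphi).
exact: (iffLR (is_derive_line phi (set_coord i 0 x) (delta_mx ord0 i) s _) d).
Qed.

Lemma continuous_set_coord (i : 'I_n) phi x : continuous phi ->
  continuous (fun t : R => phi (set_coord i t x)).
Proof.
move=> cphi; under eq_fun do rewrite line_through.
move=> s; apply: (@continuous_comp _ _ _ (fun t : R => t *: delta_mx ord0 i + set_coord i 0 x) phi); last exact: cphi.
by apply: cvgD; [apply: cvgZr_tmp; exact: cvg_id|exact: cvg_cst].
Qed.

Lemma smooth_continuous phi : smooth phi -> continuous phi.
Proof. by move=> /(_ [::])[]. Qed.

Lemma smooth_partial phi i : smooth phi -> smooth (partial i phi).
Proof. exact: (@dsmooth_partial _ _ _ (fun i => delta_mx ord0 i)). Qed.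

Lemma compact_cube K : compact K -> exists M, 0 < M /\ K `<=` cube M.
Proof. by move=> /compact_bounded; exact: bounded_cube. Qed.

Lemma cube_line_out (M : R) (i : 'I_n) x s : M < `|s| -> ~ cube M (set_coord i s x).
Proof. by move=> Ms /(_ i); rewrite mxE eqxx leNgt Ms. Qed.

(** On each line in direction i the derivative of a compactly supported function
has mean zero; Fubini is applied to its two parts separately. *)
Lemma integral_partial_posneg K phi i : compact K -> smooth phi ->
  (forall x, ~ K x -> phi x = 0) ->
  (\int[mu]_x (EFin \o partial i phi)^\+ x = \int[mu]_x (EFin \o partial i phi)^\- x)%E.
Proof.
move=> cK sphi phi0.
have [M [M0 KM]] := compact_cube cK.
have sp := smooth_partial i sphi.
have mp : measurable_fun [set: 'rV[R]_n] (EFin \o partial i phi).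
  by apply/measurable_EFinP; apply: continuous_borel; exact: smooth_continuous.
have p0 := @partial_supp _ _ _ _ i (rV_compact_closed cK) phi0.
rewrite !integral_lebesgue_borel//; last 2 first.
- exact: measurable_funeneg.
- exact: measurable_funepos.
apply: (eq_integral_lines (i := i)) => //.
- exact: measurable_funepos.
- exact: measurable_funeneg.
move=> x.
have L := @line_mean0 R (fun t => phi (set_coord i t x))
  (fun t => partial i phi (set_coord i t x)) M.
have hp s : (EFin \o partial i phi)^\+%E (set_coord i s x) =
    (EFin \o (fun t => partial i phi (set_coord i t x)))^\+%E s by rewrite !funeposE.
have hn s : (EFin \o partial i phi)^\-%E (set_coord i s x) =
    (EFin \o (fun t => partial i phi (set_coord i t x)))^\-%E s by rewrite !funenegE.
under eq_integral do rewrite hp.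
under [RHS]eq_integral do rewrite hn.
apply: L.
- by move=> s; exact: is_derive_set_coord.
- by apply: continuous_set_coord; exact: smooth_continuous.
- by move=> s Ms; apply: phi0 => /KM; exact: cube_line_out.
- by move=> s Ms; apply: p0 => /KM; exact: cube_line_out.
Qed.

Lemma Rintegral_partial0 K phi i : compact K -> smooth phi ->
  (forall x, ~ K x -> phi x = 0) -> \int[mu]_x (partial i phi x) = 0.
Proof.
move=> cK sphi phi0; rewrite /Rintegral.
suff -> : (\int[mu]_x (partial i phi x)%:E = 0)%E by [].
rewrite integralE.
have := integral_partial_posneg i cK sphi phi0.
have ip : mu.-integrable setT (EFin \o partial i phi).
  apply: (compact_support_integrable cK); first exact/smooth_continuous/smooth_partial.
  exact: partial_supp (rV_compact_closed cK) phi0.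
have := integrable_neg_fin_num measurableT ip.
by rewrite -/(EFin \o partial i phi) => fn ->; rewrite subee.
Qed.

Lemma Rintegral_supp Omega phi :
  (forall x, ~ Omega x -> phi x = 0) ->
  \int[mu]_(x in Omega) phi x = \int[mu]_x phi x.
Proof.
move=> phi0; rewrite Rintegral_mkcond; apply: eq_Rintegral => x _.
rewrite patchE; case: ifPn => // /negP; rewrite inE => /phi0 ->. by [].
Qed.

(** The product phi psi is compactly supported, so the integral of its partial
derivative vanishes. *)
Lemma integration_by_parts_test Omega phi psi i : measurable (Omega : set (rV_leb R n)) ->
  smooth phi -> test_function Omega psi ->
  \int[mu]_(x in Omega) (phi x * partial i psi x) =
  - \int[mu]_(x in Omega) (partial i phi x * psi x).
Proof.
move=> mO sphi tpsi; have [spsi _ _] := tpsi.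
have [K [cK KO psi0]] := test_function_supp tpsi.
have ppsi0 := @partial_supp _ _ _ _ i (rV_compact_closed cK) psi0.
have i1 : mu.-integrable setT (EFin \o (phi \* partial i psi)).
  apply: (compact_support_integrable cK); last by move=> x /= /ppsi0 ->; rewrite mulr0.
  exact: (smooth_continuous (smoothM sphi (smooth_partial i spsi))).
have i2 : mu.-integrable setT (EFin \o (partial i phi \* psi)).
  apply: (compact_support_integrable cK); last by move=> x /= /psi0 ->; rewrite mulr0.
  exact: (smooth_continuous (smoothM (smooth_partial i sphi) spsi)).
rewrite (@Rintegral_supp Omega (phi \* partial i psi)); last first.
  by move=> x nOx /=; rewrite ppsi0 ?mulr0// => /KO.
rewrite (@Rintegral_supp Omega (partial i phi \* psi)); last first.
  by move=> x nOx /=; rewrite psi0 ?mulr0// => /KO.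
apply/eqP; rewrite -addr_eq0 -RintegralD//.
have <- : partial i (phi \* psi) = fun x => phi x * partial i psi x + partial i phi x * psi x.
  apply/funext => x; rewrite /partial.
  have dphi := @dsmooth_derivable _ _ _ (fun i => delta_mx ord0 i) phi i x sphi.
  have dpsi := @dsmooth_derivable _ _ _ (fun i => delta_mx ord0 i) psi i x spsi.
  by rewrite [LHS](deriveM dphi dpsi) /GRing.scale/= [X in _ + X]mulrC.
have h0 x : ~ K x -> (phi \* psi) x = 0 by move=> /= /psi0 ->; rewrite mulr0.
by rewrite (Rintegral_partial0 i cK (smoothM sphi spsi) h0).
Qed.

Lemma continuous_L1loc Omega phi : measurable (Omega : set (rV_leb R n)) ->
  continuous phi -> in_L1loc Omega phi.
Proof.
move=> mO cphi; split; first by apply: measurable_funTS; exact: continuous_leb.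
move=> K KO cK; have mK := compact_leb cK.
have [M MK] : exists M, forall x, K x -> `|phi x| <= M.
  have /compact_bounded[M [_ MK]] : compact (phi @` K).
    by apply: continuous_compact => //; exact: continuous_subspaceT.
  exists (`|M| + 1) => x Kx; apply: (MK (`|M| + 1)); last by exists x.
  by rewrite (le_lt_trans (ler_norm _))// ltrDl.
apply: (@le_lt_trans _ _ (\int[mu]_(x in K) `|M|%:E)%E); last first.
  rewrite integral_cst// lte_mul_pinfty ?lee_fin//; exact: compact_leb_fin.
apply: ge0_le_integral.
- exact: mK.
- by move=> x _; rewrite lee_fin.
- apply/measurable_EFinP; apply: measurableT_comp; first exact: normr_measurable.
  by apply: measurable_funTS; exact: continuous_leb.
- by apply/measurable_EFinP; exact: measurable_cst.
- by move=> x Kx; rewrite lee_fin (le_trans (MK _ Kx))// ler_norm.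
Qed.

Lemma test_weak_partial Omega phi i : measurable (Omega : set (rV_leb R n)) ->
  smooth phi -> is_weak_partial Omega i phi (partial i phi).
Proof.
move=> mO sphi; split.
- by apply: continuous_L1loc => //; exact: smooth_continuous.
- by apply: continuous_L1loc => //; exact/smooth_continuous/smooth_partial.
- by move=> psi tpsi; exact: integration_by_parts_test.
Qed.

End test_function_integrals.

(** * The fundamental lemma of the calculus of variations *)

Section variations_lemma.
Context {R : realType} {n : nat}.
Implicit Types (Omega K : set 'rV[R]_n) (g : 'rV[R]_n -> R).
Local Notation mu := (@rV_lebesgue R n).
Local Notation borel := (rV_borel_lebesgue R n).

Definition oboxes : set (set 'rV[R]_n) := [set B | exists a b, B = obox a b].

Lemma oboxI (a b c d : 'I_n -> R) : obox a b `&` obox c d =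
  obox (fun i => Num.max (a i) (c i)) (fun i => Num.min (b i) (d i)).
Proof.
apply/seteqP; split => x /=.
  by move=> [h1 h2] i; rewrite gt_max lt_min; have /andP[-> ->] := h1 i; have /andP[-> ->] := h2 i.
move=> h; split => i; have := h i; rewrite gt_max lt_min.
  by move=> /andP[/andP[-> _] /andP[-> _]].
by move=> /andP[/andP[_ ->] /andP[_ ->]].
Qed.

Lemma borel_oboxes : @measurable _ 'rV[R]_n = <<s oboxes >>.
Proof.
apply/seteqP; split => [E mE|]; last first.
  apply: smallest_sub; first exact: sigma_algebra_measurable.
  by move=> _ [a [b ->]]; exact: obox_measurable.
pose T := g_sigma_algebraType oboxes.
have mid : measurable_fun [set: T] (id : T -> 'rV[R]_n).
  apply/measurable_fun_rVP => i.
  apply: (measurability _ (RGenOInfty.measurableE R)) => //.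
  move=> _ [_ [c ->] <-]; rewrite setTI.
  rewrite (_ : _ @^-1` _ = \bigcup_k obox (fun j => if j == i then c else - k%:R) (fun=> k%:R)).
    by apply: bigcupT_measurable => k; apply: sub_sigma_algebra; eexists; eexists.
  apply/seteqP; split => x /=.
    rewrite in_itv/= andbT => cx; pose M := \sum_j `|x ord0 j| + 1.
    have Mx j : `|x ord0 j| < M.
      by rewrite /M (bigD1 j)//= -addrA ltrDl ltr_wpDl// sumr_ge0.
    have [k Mk] : exists k : nat, M <= k%:R.
      by exists (Num.bound M); rewrite ltW// archi_boundP// addr_ge0// sumr_ge0.
    exists k => // j; have := lt_le_trans (Mx j) Mk; rewrite ltr_norml => /andP[a b].
    by rewrite b andbT; case: eqP => [->|].
  by move=> [k _ /(_ i)]; rewrite eqxx in_itv/= andbT => /andP[].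
by have := mid measurableT _ mE; rewrite setTI.
Qed.

(** The outer measure is an infimum over countable Borel covers: intersect covers
whose excess over the measure of A is at most 1 / (k + 1). *)
Lemma lebesgue_borel_hull (A : set 'rV[R]_n) :
  measurable (A : set (rV_leb R n)) -> (mu A < +oo)%E ->
  exists B, [/\ measurable B, A `<=` B & mu (B `\` A) = 0%E].
Proof.
move=> mA muA.
have mAfin : mu A \is a fin_num by rewrite ge0_fin_numE.
have /choice[F hF] : forall k : nat, exists F : (set 'rV[R]_n)^nat,
    [/\ forall i, measurable (F i), A `<=` \bigcup_i F i &
        (\sum_(i <oo) borel (F i) < mu A + k.+1%:R^-1%:E)%E].
  move=> k; have k0 : 0 < k.+1%:R^-1 :> R by rewrite invr_gt0.
  have [_ [F [mF AF] <-] lt] := lb_ereal_inf_adherent k0 mAfin.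
  by exists F.
pose B := \bigcap_k \bigcup_i F k i.
have mFk k : measurable (\bigcup_i F k i) by apply: bigcupT_measurable => i; have [] := hF k.
have mB : measurable B by exact: bigcapT_measurable.
have AB : A `<=` B by move=> x Ax k _; have [_ AF _] := hF k; exact: AF.
exists B; split => //.
have mBl := borel_lebesgue mB.
have muB k : (mu B <= mu A + k.+1%:R^-1%:E)%E.
  have [mF AF /ltW lt] := hF k; apply: le_trans lt.
  apply: (@le_trans _ _ (mu (\bigcup_i F k i))).
    by apply: le_measure; rewrite ?inE//; [exact: borel_lebesgue|exact: bigcap_inf].
  by rewrite lebesgue_borelE//; exact: measure_sigma_subadditive.
have muBA : mu B = mu A.
  apply/eqP; rewrite eq_le; apply/andP; split; last by apply: le_measure; rewrite ?inE.
  apply/lee_addgt0Pr => e e0.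
  have [k ke] : exists k : nat, k.+1%:R^-1 < e.
    exists (Num.bound e^-1); rewrite invf_plt ?posrE// (lt_le_trans (archi_boundP _)) ?ler_nat//.
    by rewrite invr_ge0 ltW.
  by rewrite (le_trans (muB k))// leeD2l// lee_fin ltW.
have BAE : (B `&` A : set (rV_leb R n)) = A by exact: setIidr.
have muB_fin : (mu B < +oo)%E by rewrite muBA.
transitivity (mu B - mu (B `&` A))%E; first exact: (measureD mBl mA muB_fin).
by rewrite (setIidr AB) muBA subee.
Qed.

(** The Borel sets over which g integrates to 0 form a Dynkin system containing
the boxes. A measurable set is a Borel set up to a null set, so g integrates to
0 over every measurable set. *)
Lemma integral_box0_ae0 (a b : 'I_n -> R) g :
  mu.-integrable (obox a b) (EFin \o g) ->
  (forall c d, cbox c d `<=` cbox a b ->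
     (\int[mu]_(x in obox c d) (g x)%:E = 0)%E) ->
  {ae mu, forall x, obox a b x -> g x = 0}.
Proof.
set U := obox a b => ig box0.
have mU : measurable (U : set (rV_leb R n)) by apply: borel_lebesgue; exact: obox_measurable.
have mg := measurable_int _ ig.
have muU : (mu U < +oo)%E.
  apply: (@le_lt_trans _ _ (mu (cbox a b))); last exact/compact_leb_fin/cbox_compact.
  apply: le_measure; rewrite ?inE//; first exact/compact_leb/cbox_compact.
  by move=> x Ux i; have /andP[/ltW -> /ltW ->] := Ux i.
have igS (E : set (rV_leb R n)) : measurable E -> mu.-integrable (U `&` E) (EFin \o g).
  by move=> mE; apply: integrableS ig => //; exact: measurableI.
pose P (E : set 'rV[R]_n) := (\int[mu]_(x in U `&` E) (g x)%:E = 0)%E.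
have PT : P setT.
  by rewrite /P setIT box0.
have bor E : measurable E -> P E.
  rewrite borel_oboxes; apply: (@dynkin_induction _ 'rV[R]_n oboxes P borel_oboxes) => //.
  - by move=> _ _ [c [d ->]] [c' [d' ->]]; rewrite oboxI; eexists; eexists.
  - move=> _ [c [d ->]]; rewrite /P /U oboxI; apply: box0 => x h i.
    by have := h i; rewrite ge_max le_min => /andP[/andP[-> _] /andP[-> _]].
  - move=> S mS PS; have mS' := borel_lebesgue mS.
    have : (\int[mu]_(x in U) (g x)%:E = 0)%E by move: PT; rewrite /P setIT.
    rewrite -{1}(setIT U) -(setUv S) setIUr integral_setU.
    + by rewrite PS add0e.
    + exact: measurableI.
    + by apply: measurableI => //; exact: measurableC.
    + by rewrite -setIUr setUv setIT.
    + by apply/disj_setPS => x [[_ Sx] [_ /=]].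
  - move=> F mF tF PF; rewrite /P setI_bigcupr integral_bigcup.
    + by apply: eseries0 => i _ _; exact: PF.
    + exact: trivIset_setIl.
    + by move=> k; apply: measurableI => //; exact: borel_lebesgue.
    + rewrite -setI_bigcupr; apply: igS; apply: bigcupT_measurable => k.
      exact: borel_lebesgue.
have h0 : measurable_fun U (cst 0%E : rV_leb R n -> \bar R) by exact: measurable_cst.
have [N [mN muN NU]] : ae_eq mu U (EFin \o g) (cst 0%E).
  have := @integral_ae_eq _ _ _ mu U mU (cst 0%E) (EFin \o g) ig (measurable_cst _).
  apply.
  move=> E EU mE; rewrite integral0.
  have muE : (mu E < +oo)%E by apply: le_lt_trans muU; apply: le_measure; rewrite ?inE.
  have [B [mB EB BE0]] := lebesgue_borel_hull mE muE.
  have mB' := borel_lebesgue mB.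
  have := bor B mB; rewrite /P => <-.
  have H := @negligible_integral _ _ _ mu (U `&` B) (B `\` E) (EFin \o g)
    (measurableD mB' mE) (measurableI _ _ mU mB') (igS _ mB') BE0.
  rewrite [RHS]H.
  congr (integral _ _ _); apply/seteqP; split => x.
    by move=> Ex; split; [split; [exact: EU|exact: EB]|move=> []].
  by move=> [[Ux Bx] nBE]; apply: contrapT => nEx; exact: nBE.
exists N; split => // x /= h; apply: NU => /= h'.
by apply: h => Ux; have := h' Ux => -[].
Qed.

End variations_lemma.

(** * Weak derivatives *)

Section weak_derivatives.
Context {R : realType} {n : nat}.
Variable Omega : set 'rV[R]_n.
Hypothesis openO : open Omega.
Implicit Types (g v w phi psi : 'rV[R]_n -> R).
Local Notation mu := (@rV_lebesgue R n).

Let mO : measurable (Omega : set (rV_leb R n)).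
Proof. exact: open_leb. Qed.

Lemma test_bounded phi : test_function Omega phi ->
  exists2 B, 0 < B & forall x, `|phi x| <= B.
Proof.
move=> tphi; have [K [cK _ phi0]] := test_function_supp tphi.
have [sphi _ _] := tphi.
exact: compact_bounded_fun cK (smooth_continuous sphi) phi0.
Qed.

Lemma test_partial_bounded i phi : test_function Omega phi ->
  exists2 B, 0 < B & forall x, `|partial i phi x| <= B.
Proof.
move=> tphi; have [K [cK _ phi0]] := test_function_supp tphi.
have [sphi _ _] := tphi.
apply: (compact_bounded_fun cK); first exact: smooth_continuous (smooth_partial i sphi).
exact: partial_supp (rV_compact_closed cK) phi0.
Qed.

Lemma L1loc_integrable g K : in_L1loc Omega g -> compact K -> K `<=` Omega ->
  mu.-integrable K (EFin \o g).
Proof.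
move=> [mg gK] cK KO; apply/integrableP; split; last exact: gK.
apply/measurable_EFinP; exact: measurable_funS mO KO mg.
Qed.

Lemma L1loc_mul_integrable g phi K : in_L1loc Omega g -> compact K -> K `<=` Omega ->
  continuous phi -> (forall x, ~ K x -> phi x = 0) ->
  mu.-integrable Omega (EFin \o (g \* phi)).
Proof.
move=> lg cK KO cphi phi0; have mK := compact_leb cK.
have [B B0 phiB] := compact_bounded_fun cK cphi phi0.
suff iK : mu.-integrable K (EFin \o (g \* phi)).
  apply/(integrable_mkcond _ mO).
  rewrite (_ : _ \_ Omega = (EFin \o (g \* phi)) \_ K); first exact/(integrable_mkcond _ mK).
  apply/funext => x; rewrite !patchE.
  have [Kx|nKx] := pselect (K x); first by rewrite !mem_set//; exact: KO.
  by rewrite [in RHS]memNset//; case: ifPn => //= _; rewrite phi0// mulr0.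
have iB : mu.-integrable K (fun x => (B%:E * (`|g x|)%:E)%E).
  apply: integrableZl => //.
  exact: (integrable_norm (L1loc_integrable lg cK KO)).
apply: (le_integrable mK _ _ iB).
  apply/measurable_EFinP; apply: measurable_funM.
    by have [mg _] := lg; exact: measurable_funS mO KO mg.
  by apply: measurable_funTS; exact: continuous_leb.
move=> x Kx /=; rewrite lee_fin normrM mulrC normrM normr_id (gtr0_norm B0).
by rewrite ler_wpM2r.
Qed.

Lemma L1loc_test_integrable g phi : in_L1loc Omega g -> test_function Omega phi ->
  mu.-integrable Omega (EFin \o (g \* phi)).
Proof.
move=> lg tphi; have [K [cK KO phi0]] := test_function_supp tphi.
have [sphi _ _] := tphi.
exact: L1loc_mul_integrable lg cK KO (smooth_continuous sphi) phi0.
Qed.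

Lemma L1loc_partial_integrable g phi i : in_L1loc Omega g -> test_function Omega phi ->
  mu.-integrable Omega (EFin \o (g \* partial i phi)).
Proof.
move=> lg tphi; have [K [cK KO phi0]] := test_function_supp tphi.
have [sphi _ _] := tphi.
apply: (L1loc_mul_integrable lg cK KO); first exact: smooth_continuous (smooth_partial i sphi).
exact: partial_supp (rV_compact_closed cK) phi0.
Qed.

Lemma in_L1locD g w : in_L1loc Omega g -> in_L1loc Omega w -> in_L1loc Omega (g \+ w).
Proof.
move=> lg lw; split; first by apply: measurable_funD; [have [] := lg|have [] := lw].
move=> K KO cK; have mK := compact_leb cK.
have ig := L1loc_integrable lg cK KO; have iw := L1loc_integrable lw cK KO.
by have /integrableP[] := integrableD mK ig iw.
Qed.

Lemma in_L1locZ (c : R) g : in_L1loc Omega g -> in_L1loc Omega (fun x => c * g x).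
Proof.
move=> lg; split; first by apply: measurable_funM; [exact: measurable_cst|have [] := lg].
move=> K KO cK; have mK := compact_leb cK.
have ig := L1loc_integrable lg cK KO.
by have /integrableP[_] := integrableZl mK c ig.
Qed.

Lemma in_L1locB g w : in_L1loc Omega g -> in_L1loc Omega w -> in_L1loc Omega (g \- w).
Proof.
move=> lg lw; rewrite (_ : g \- w = g \+ (fun x => -1 * w x)).
  by apply: in_L1locD => //; exact: in_L1locZ.
by apply/funext => x /=; rewrite mulN1r.
Qed.

(** By dominated convergence along box bumps, g integrates to 0 over every box
whose closure lies in Omega; countably many such boxes cover Omega. *)
Lemma variations_lemma g : in_L1loc Omega g ->
  (forall phi, test_function Omega phi -> \int[mu]_(x in Omega) (g x * phi x) = 0) ->
  {ae mu, forall x, Omega x -> g x = 0}.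
Proof.
move=> lg g0.
have box ck : cbox (rat_box_l ck) (rat_box_r ck) `<=` Omega ->
    {ae mu, forall x, obox (rat_box_l ck) (rat_box_r ck) x -> g x = 0}.
  set a := rat_box_l ck; set b := rat_box_r ck => abO.
  have oc (c d : 'I_n -> R) : obox c d `<=` cbox c d.
    by move=> x h i; have /andP[/ltW -> /ltW ->] := h i.
  have mo (c d : 'I_n -> R) : measurable (obox c d : set (rV_leb R n)).
    by apply: borel_lebesgue; exact: obox_measurable.
  have ibox c d : cbox c d `<=` Omega -> mu.-integrable (obox c d) (EFin \o g).
    move=> cdO; apply: (integrableS _ (mo c d) (oc c d)).
      exact: compact_leb (@cbox_compact _ _ c d).
    exact: L1loc_integrable lg (@cbox_compact _ _ c d) cdO.
  apply: integral_box0_ae0; first exact: ibox.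
  move=> c d /subset_trans/(_ abO) cdO.
  have ig := ibox c d cdO; have mU := mo c d.
  have mgU : measurable_fun (obox c d : set (rV_leb R n)) g.
    by apply/measurable_EFinP; exact: measurable_int ig.
  pose G k x := (g x * box_bump c d k.+1%:R x)%:E.
  have tk k : test_function Omega (box_bump c d k.+1%:R) by exact: test_function_box_bump.
  have Gk0 k : (\int[mu]_(x in obox c d) G k x = 0)%E.
    have iG := L1loc_test_integrable lg (tk k).
    have iGU : mu.-integrable (obox c d) (G k).
      by apply: integrableS iG => //; apply: subset_trans cdO; exact: oc.
    rewrite -[LHS]fineK; last exact: integrable_fin_num.
    congr (_%:E); rewrite -[RHS](g0 _ (tk k)) /Rintegral; congr fine.
    rewrite [RHS]integral_mkcond [LHS]integral_mkcond; apply: eq_integral => x _.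
    rewrite !patchE; have [xU|nxU] := pselect (obox c d x).
      by rewrite !mem_set//; apply: cdO; exact: oc.
    rewrite memNset//; case: ifPn => // _.
    suff -> : box_bump c d k.+1%:R x = 0 by rewrite mulr0.
    by apply/eqP; apply: contra_notT nxU; exact: box_bump_neq0.
  have := @dominated_convergence _ _ _ mu (obox c d) mU G (EFin \o g) (EFin \o (fun x => `|g x|)).
  case.
  - move=> k; apply/measurable_EFinP; apply: measurable_funM => //.
    by apply: measurable_funTS; apply: continuous_leb; have [/smooth_continuous] := tk k.
  - exact: measurable_int ig.
  - apply: aeW => x xU; apply: cvg_EFin; first exact: nearW.
    have := cvgM (@cvg_cst _ (g x) _ \oo _) (@box_bump_cvg _ _ c d x).
    by move=> /(_ _) /(_ _); rewrite indicE mem_set// mulr1.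
  - exact: integrable_norm.
  - apply: aeW => x k xU; rewrite lee_fin normrM ler_piMr//.
    by rewrite ger0_norm ?box_bump_ge0 ?box_bump_le1.
  move=> _ _; rewrite (_ : [sequence _]_k = fun=> 0%E); last by apply/funext => k; exact: Gk0.
  by move=> /(cvg_unique _ (cvg_cst _)) <-.
pose N (m : nat) : set (rV_leb R n) :=
  if unpickle m is Some ck then
    if pselect (cbox (rat_box_l ck) (rat_box_r ck) `<=` Omega) then
      [set x | ~ (obox (rat_box_l ck) (rat_box_r ck) x -> g x = 0)] else set0
  else set0.
have : mu.-negligible (\bigcup_m N m).
  apply: negligible_bigcup => m; rewrite /N.
  case: (unpickle m) => [ck|]; last exact: negligible_set0.
  case: (pselect _) => /= [h|_]; last exact: negligible_set0.
  exact: box.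
apply: negligibleS => x /= nx; apply: contrapT => nN; apply: nx => Ox.
have [ck [xck ckO]] := open_rat_box openO Ox.
apply: contrapT => gx; apply: nN; exists (pickle ck) => //.
by rewrite /N pickleK; case: (pselect _) => //= _; move=> /(_ xck).
Qed.

Lemma weak_partial_unique i v g1 g2 : is_weak_partial Omega i v g1 ->
  is_weak_partial Omega i v g2 -> {ae mu, forall x, Omega x -> g1 x = g2 x}.
Proof.
move=> [lv lg1 h1] [_ lg2 h2].
have : {ae mu, forall x, Omega x -> (g1 \- g2) x = 0}.
  apply: variations_lemma; first exact: in_L1locB.
  move=> phi tphi; have i1 := L1loc_test_integrable lg1 tphi.
  have i2 := L1loc_test_integrable lg2 tphi.
  under eq_Rintegral do rewrite /= mulrBl.
  rewrite RintegralB//; apply/eqP; rewrite subr_eq0; apply/eqP.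
  by apply: oppr_inj; rewrite -h1// -h2.
by apply: filterS => x h Ox; apply/eqP; rewrite -subr_eq0; apply/eqP; exact: h.
Qed.

Lemma weakDP i v g : is_weak_partial Omega i v g ->
  is_weak_partial Omega i v (weakD Omega i v).
Proof. by move=> h; rewrite /weakD; apply: (xgetPex (fun=> 0)); exists g. Qed.

Lemma weakD_ae i v g : is_weak_partial Omega i v g ->
  {ae mu, forall x, Omega x -> weakD Omega i v x = g x}.
Proof. by move=> h; exact: weak_partial_unique (weakDP h) h. Qed.

Lemma weak_partialD i v w gv gw : is_weak_partial Omega i v gv ->
  is_weak_partial Omega i w gw -> is_weak_partial Omega i (v \+ w) (gv \+ gw).
Proof.
move=> [lv lgv hv] [lw lgw hw]; split; [exact: in_L1locD|exact: in_L1locD|].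
move=> phi tphi.
under eq_Rintegral do rewrite /= mulrDl.
rewrite (RintegralD mO (L1loc_partial_integrable i lv tphi) (L1loc_partial_integrable i lw tphi)).
under [in RHS]eq_Rintegral do rewrite /= mulrDl.
rewrite (RintegralD mO (L1loc_test_integrable lgv tphi) (L1loc_test_integrable lgw tphi)).
by rewrite opprD hv// hw.
Qed.

Lemma weak_partialZ i (c : R) v gv : is_weak_partial Omega i v gv ->
  is_weak_partial Omega i (fun x => c * v x) (fun x => c * gv x).
Proof.
move=> [lv lgv hv]; split; [exact: in_L1locZ|exact: in_L1locZ|].
move=> phi tphi.
under eq_Rintegral do rewrite -mulrA.
rewrite (RintegralZl _ mO (L1loc_partial_integrable i lv tphi)).
under [in RHS]eq_Rintegral do rewrite -mulrA.
by rewrite (RintegralZl _ mO (L1loc_test_integrable lgv tphi)) hv// mulrN.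
Qed.

Lemma weak_partialB i v w gv gw : is_weak_partial Omega i v gv ->
  is_weak_partial Omega i w gw -> is_weak_partial Omega i (v \- w) (gv \- gw).
Proof.
move=> hv hw; have := weak_partialD hv (weak_partialZ (-1) hw).
rewrite (_ : v \+ _ = v \- w); last by apply/funext => x /=; rewrite mulN1r.
by rewrite (_ : gv \+ _ = gv \- gw)//; apply/funext => x /=; rewrite mulN1r.
Qed.

End weak_derivatives.

(** * Integral estimates *)

Section integral_estimates.
Context d (T : measurableType d) (R : realType).
Variables (mu : {measure set T -> \bar R}) (D : set T) (mD : measurable D).
Implicit Types (f g : T -> R).

Lemma measurable_norm f : measurable_fun D f -> measurable_fun D (fun x => (`|f x|)%:E).
Proof.
by move=> mf; apply/measurable_EFinP; apply: measurableT_comp => //; exact: normr_measurable.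
Qed.

Lemma real_le_integrable f g : measurable_fun D f -> mu.-integrable D (EFin \o g) ->
  (forall x, D x -> `|f x| <= `|g x|) -> mu.-integrable D (EFin \o f).
Proof.
move=> mf ig fg; apply: (le_integrable mD _ _ ig); first exact/measurable_EFinP.
by move=> x Dx /=; rewrite lee_fin; exact: fg.
Qed.

Lemma le_norm_integral f g : measurable_fun D f -> measurable_fun D g ->
  (forall x, D x -> `|f x| <= g x) ->
  (\int[mu]_(x in D) (`|f x|)%:E <= \int[mu]_(x in D) (g x)%:E)%E.
Proof.
move=> mf mg fg; apply: ge0_le_integral => //; first exact: measurable_norm.
exact/measurable_EFinP.
Qed.

Lemma ae_norm_integral f g : measurable_fun D f -> measurable_fun D g ->
  {ae mu, forall x, D x -> f x = g x} ->
  (\int[mu]_(x in D) (`|f x|)%:E = \int[mu]_(x in D) (`|g x|)%:E)%E.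
Proof.
move=> mf mg fg; apply: ae_eq_integral => //; try exact: measurable_norm.
by apply: filterS fg => x h Dx; rewrite h.
Qed.

Lemma ae_integrable f g : mu.-integrable D (EFin \o g) -> measurable_fun D f ->
  {ae mu, forall x, D x -> f x = g x} -> mu.-integrable D (EFin \o f).
Proof.
move=> /integrableP[/measurable_EFinP mg ig] mf fg.
apply/integrableP; split; first exact/measurable_EFinP.
by rewrite (ae_norm_integral mf mg).
Qed.

Lemma norm_Rintegral_mul f g (B c : R) : 0 <= B -> measurable_fun D f ->
  mu.-integrable D (EFin \o (f \* g)) -> (forall x, D x -> `|g x| <= B) ->
  (\int[mu]_(x in D) (`|f x|)%:E < c%:E)%E ->
  `|\int[mu]_(x in D) (f x * g x)| <= B * c.
Proof.
move=> B0 mf ifg gB hf.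
rewrite (le_trans (le_normr_Rintegral mD ifg))// /Rintegral -lee_fin fineK; last first.
  exact: integrable_fin_num (integrable_norm ifg).
apply: (@le_trans _ _ (B%:E * \int[mu]_(x in D) (`|f x|)%:E)%E); last first.
  by rewrite EFinM lee_wpmul2l ?lee_fin// ltW.
rewrite -ge0_integralZl_EFin//; last exact: measurable_norm.
apply: ge0_le_integral => //.
- apply: measurable_norm; apply/measurable_EFinP; exact: measurable_int ifg.
- by apply: measurable_funeM; exact: measurable_norm.
by move=> x Dx; rewrite -EFinM lee_fin normrM mulrC ler_wpM2r// gB.
Qed.

Lemma norm_integral_triangle f g : measurable_fun D f -> measurable_fun D g ->
  (\int[mu]_(x in D) (`|g x|)%:E <=
   \int[mu]_(x in D) (`|f x|)%:E + \int[mu]_(x in D) (`|f x - g x|)%:E)%E.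
Proof.
move=> mf mg; have mn h := @measurable_norm h; have mfg := mn _ (measurable_funB mf mg).
rewrite -ge0_integralD//; try exact: mn.
apply: ge0_le_integral => //; try exact: mn.
- by apply: emeasurable_funD => //; exact: mn.
by move=> x _; rewrite -EFinD lee_fin -{1}(subKr (f x) (g x)) ler_normB.
Qed.

Lemma measurable_superlevel f (c : R) : measurable_fun D f ->
  measurable [set x | D x /\ c < `|f x|].
Proof.
move=> mf; have mnf : measurable_fun D (fun x => `|f x|).
  by apply/measurable_EFinP; exact: measurable_norm.
have := mnf mD `]c, +oo[%classic (measurable_itv _).
rewrite (_ : D `&` _ = [set x | D x /\ c < `|f x|])//.
by apply/seteqP; split => x /=; rewrite in_itv/= andbT.
Qed.

Lemma superlevel_fin f (c : R) : measurable_fun D f -> (mu D < +oo)%E ->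
  mu [set x | D x /\ c < `|f x|] \is a fin_num.
Proof.
move=> mf muD; rewrite ge0_fin_numE// (le_lt_trans _ muD)//.
by apply: le_measure; rewrite ?inE//; [exact: measurable_superlevel|move=> x []].
Qed.

(** Where |f| > 2c, either |g| > c or |f - g| > c, and the second event is small by
the Chebyshev inequality. *)
Lemma superlevel_approx f g (c e : R) : measurable_fun D f -> measurable_fun D g ->
  (mu D < +oo)%E -> 0 < c -> (\int[mu]_(x in D) (`|f x - g x|)%:E <= e%:E)%E ->
  fine (mu [set x | D x /\ c *+ 2 < `|f x|]) <=
  fine (mu [set x | D x /\ c < `|g x|]) + e / c.
Proof.
move=> mf mg muD c0 fge.
have mfg : measurable_fun D (f \- g) by exact: measurable_funB.
have cheb : (mu [set x | D x /\ (c < `|(f \- g) x|)%R] <= (e / c)%:E)%E.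
  rewrite mulrC EFinM -[X in (X <= _)%E]mul1e -(mulVf (lt0r_neq0 c0)) EFinM -muleA.
  rewrite lee_wpmul2l ?lee_fin ?invr_ge0 ?(ltW c0)//.
  apply: le_trans fge; rewrite -integral_cst; last exact: measurable_superlevel.
  apply: (@le_trans _ _ (\int[mu]_(x in [set x | D x /\ (c < `|(f \- g) x|)%R]) (`|f x - g x|)%:E)%E).
    apply: ge0_le_integral => //.
    - exact: measurable_superlevel.
    - by move=> x _; rewrite lee_fin ltW.
    - by apply: (measurable_funS mD) => [x []//|]; exact: measurable_norm.
    - by move=> x [_ /ltW]; rewrite lee_fin.
  apply: ge0_subset_integral => //; first exact: measurable_superlevel.
    exact: measurable_norm.
  by move=> x [].
rewrite -lee_fin EFinD !fineK ?superlevel_fin//.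
apply: (le_trans _ (leeD2l _ cheb)).
apply: (le_trans _ (measureU2 _ _ _)); last 2 first.
- exact: measurable_superlevel.
- exact: measurable_superlevel.
apply: le_measure; rewrite ?inE//.
- exact: measurable_superlevel.
- by apply: measurableU; exact: measurable_superlevel.
move=> x [Dx cf]; have [cg|cg] := ltP c `|g x|; [by left|right; split => //=].
rewrite ltNge; apply/negP => cfg; move: cf; rewrite ltNge => /negP; apply.
by rewrite -(subrK (g x) (f x)) (le_trans (ler_normD _ _))// mulr2n lerD.
Qed.

Lemma measurable_tail f (N : R) : measurable_fun D f ->
  measurable_fun D (fun x => if N < `|f x| then `|f x| else 0).
Proof.
move=> mf; have mnf : measurable_fun D (fun x => `|f x|).
  by apply/measurable_EFinP; exact: measurable_norm.
apply: measurable_fun_if => //.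
- by apply: measurable_fun_ltr => //; exact: measurable_cst.
- by apply: measurable_funS mnf => //; apply: subIsetl.
Qed.

Lemma tail_integral_mono f (M N : R) : measurable_fun D f -> M <= N ->
  (\int[mu]_(x in D) (if (N < `|f x|)%R then `|f x| else 0)%:E <=
   \int[mu]_(x in D) (if (M < `|f x|)%R then `|f x| else 0)%:E)%E.
Proof.
move=> mf MN; apply: ge0_le_integral => //.
- by move=> x _; rewrite lee_fin; case: ifP.
- by apply/measurable_EFinP; exact: measurable_tail.
- by apply/measurable_EFinP; exact: measurable_tail.
move=> x _; rewrite lee_fin; case: ifP => [Nf|_]; last by case: ifP.
by rewrite (le_lt_trans MN Nf).
Qed.

Lemma tail_integral f (e : R) : mu.-integrable D (EFin \o f) -> 0 < e ->
  exists2 N : R, 0 <= N &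
    (\int[mu]_(x in D) (if N < `|f x| then `|f x| else 0)%:E < e%:E)%E.
Proof.
move=> intf e0; have mf : measurable_fun D f.
  by apply/measurable_EFinP; exact: measurable_int intf.
pose F (k : nat) x := (if k%:R < `|f x| then `|f x| else 0)%:E : \bar R.
have mF k : measurable_fun D (F k) by apply/measurable_EFinP; exact: measurable_tail.
have Fcvg : {ae mu, forall x, D x -> F k x @[k --> \oo] --> 0%E}.
  apply: aeW => x Dx; apply: cvg_near_cst.
  exists (Num.bound `|f x|) => // k /= hk; rewrite /F ifF//.
  apply/negbTE; rewrite -leNgt ltW// (lt_le_trans (archi_boundP _))//.
  by rewrite ler_nat.
have Fle : {ae mu, forall x k, D x -> (`|F k x| <= (`|f x|)%:E)%E}.
  by apply: aeW => x k Dx; rewrite lee_fin; case: ifP => _; rewrite ?normr_id ?normr0.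
have [_ _] := @dominated_convergence _ _ _ mu D mD F (cst 0%E) (fun x => (`|f x|)%:E)
  mF (measurable_cst _) Fcvg (integrable_norm intf) Fle.
rewrite integral0 => cv.
have e0' : (0 < e%:E)%E by rewrite lte_fin.
have [k _ hk] : \forall k \near \oo, (\int[mu]_(x in D) F k x < e%:E)%E.
  exact: (cv _ (open_ereal_lt' e0')).
exists k%:R => //; exact: (hk k (leqnn _)).
Qed.

(** Here H is the derivative of an outer function. Write
  H(w) Dw - H(v) Dv = H(v) (Dw - Dv) + (H(w) - H(v)) Dw
and bound the last term by the Lipschitz property of H where |Dw| <= N and by
2 |Dw| elsewhere. *)
Lemma chain_estimate (H : R -> R) (w v Dw Dv : T -> R) (K N : R) :
  measurable_fun D w -> measurable_fun D v -> measurable_fun D Dw -> measurable_fun D Dv ->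
  measurable_fun setT H -> 0 <= K -> 0 <= N ->
  (forall s, `|H s| <= 1) -> (forall s t, `|H s - H t| <= K * `|s - t|) ->
  (\int[mu]_(x in D) (`|H (w x) * Dw x - H (v x) * Dv x|)%:E <=
   \int[mu]_(x in D) (`|Dw x - Dv x|)%:E + (K * N)%:E * \int[mu]_(x in D) (`|w x - v x|)%:E
   + 2%:E * \int[mu]_(x in D) (if N < `|Dw x| then `|Dw x| else 0)%:E)%E.
Proof.
move=> mw mv mDw mDv mH K0 N0 H1 HL.
have KN0 : 0 <= K * N by exact: mulr_ge0.
have m1 : measurable_fun D (fun x => (`|Dw x - Dv x|)%:E).
  by apply: measurable_norm; exact: measurable_funB.
have m2 : measurable_fun D (fun x => (`|w x - v x|)%:E).
  by apply: measurable_norm; exact: measurable_funB.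
have m3 : measurable_fun D (fun x => (if N < `|Dw x| then `|Dw x| else 0)%:E).
  by apply/measurable_EFinP; exact: measurable_tail.
have p2 x : D x -> (0 <= (K * N)%:E * (`|w x - v x|)%:E)%E.
  by move=> _; rewrite -EFinM lee_fin mulr_ge0.
have p3' x : D x -> (0 <= (if N < `|Dw x| then `|Dw x| else 0)%:E)%E.
  by move=> _; rewrite lee_fin; case: ifP.
have p3 x : D x -> (0 <= 2%:E * (if N < `|Dw x| then `|Dw x| else 0)%:E)%E.
  by move=> Dx; rewrite mule_ge0// p3'.
have m2' := measurable_funeM (K * N)%:E m2; have m3' := measurable_funeM 2%:E m3.
rewrite -ge0_integralZl_EFin// -ge0_integralZl_EFin//.
rewrite -ge0_integralD// -ge0_integralD//; last 2 first.
- by move=> x Dx; apply: adde_ge0 => //; exact: p2.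
- exact: emeasurable_funD.
apply: ge0_le_integral => //.
- apply: measurable_norm; apply: measurable_funB; apply: measurable_funM => //.
    exact: measurableT_comp.
  exact: measurableT_comp.
- by apply: emeasurable_funD => //; exact: emeasurable_funD.
move=> x Dx; rewrite -!EFinM -!EFinD lee_fin.
rewrite (_ : H (w x) * Dw x - H (v x) * Dv x =
  H (v x) * (Dw x - Dv x) + (H (w x) - H (v x)) * Dw x); last by ring.
rewrite (le_trans (ler_normD _ _))// -addrA lerD//.
  by rewrite normrM ler_piMl.
rewrite normrM; have [NDw|NDw] := ltP N `|Dw x|; last first.
  rewrite mulr0 addr0 (le_trans (ler_pM _ _ (HL _ _) NDw))//.
  by rewrite le_eqVlt; apply/orP; left; apply/eqP; ring.
rewrite ler_wpDl ?mulr_ge0// ler_wpM2r//.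
by rewrite (le_trans (ler_normB _ _))// (_ : 2%R = 1 + 1)// lerD.
Qed.

End integral_estimates.

(** * A smooth truncation *)

Section soft_truncation.
Context {R : realType}.

Lemma lipschitz_derive (f f' : R -> R) (K : R) :
  (forall s : R, is_derive s 1 f (f' s)) -> (forall s, `|f' s| <= K) ->
  forall s t, `|f s - f t| <= K * `|s - t|.
Proof.
move=> df f'K; have K0 : 0 <= K by apply: le_trans (f'K 0); exact: normr_ge0.
have cf : continuous f.
  by move=> s; apply: differentiable_continuous; apply/derivable1_diffP; have [] := df s.
have main s t : s <= t -> `|f s - f t| <= K * `|s - t|.
  move=> st; have [] := @MVT_segment R f f' s t st (fun x _ => df x).
    exact: continuous_subspaceT.
  by move=> c _ E; rewrite distrC E normrM [`|s - t|]distrC ler_wpM2r.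
move=> s t; have [st|/ltW ts] := leP s t; first exact: main.
by rewrite distrC [`|s - t|]distrC; exact: main.
Qed.

Variables (e c : R).
Hypotheses (e0 : 0 < e) (c0 : 0 <= c).
Local Notation h := (soft_abs e).

(** The derivative of soft_abs. *)
Definition soft_sign (x : R) : R := x / h x.

Lemma le_soft_abs x : `|x| <= h x.
Proof.
by rewrite -sqrtr_sqr ler_sqrt ?lerDr ?sqr_ge0// ltW// soft_abs_arg_gt0.
Qed.


Lemma soft_abs_le x : h x <= `|x| + e.
Proof.
have xe0 : 0 <= `|x| + e by rewrite addr_ge0// ltW.
rewrite -(ger0_norm xe0) -sqrtr_sqr ler_sqrt ?sqr_ge0// sqrrD real_normK ?num_real//.
have : 0 <= `|x| * e *+ 2 by rewrite mulrn_wge0// mulr_ge0// ltW.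
by move: (_ *+ 2) => z z0; lra.
Qed.

Lemma soft_sign_bound x : `|soft_sign x| <= 1.
Proof.
rewrite /soft_sign normrM normfV (gtr0_norm (soft_abs_gt0 e0 x)).
by rewrite ler_pdivrMr ?mul1r ?le_soft_abs ?soft_abs_gt0.
Qed.

Lemma soft_signN x : soft_sign (- x) = - soft_sign x.
Proof. by rewrite /soft_sign /soft_abs sqrrN mulNr. Qed.

Lemma is_derive_soft_sign (x : R) :
  is_derive x 1 soft_sign (e ^+ 2 * (h x)^-1 ^+ 3).
Proof.
have hM := @is_deriveM R R^o id (fun t => (h t)^-1) x 1 _ _ (is_derive_id _ _)
  (is_derive_soft_absV e0 x).
apply: (is_derive_eq hM); rewrite /GRing.scale/=.
have := sqr_soft_abs e0 x; have := gt_eqF (soft_abs_gt0 e0 x); move: (h x) => y y0 yE.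
have -> : e ^+ 2 = y ^+ 2 - x ^+ 2 by rewrite yE addrK.
field. by rewrite y0.
Qed.

Lemma soft_sign_derive_bound x : 0 <= e ^+ 2 * (h x)^-1 ^+ 3 <= e^-1.
Proof.
have h0 := soft_abs_gt0 e0 x.
apply/andP; split; first by rewrite mulr_ge0 ?exprn_ge0 ?invr_ge0 ?ltW.
have eh : e <= h x.
  by rewrite -[X in X <= _](gtr0_norm e0) -sqrtr_sqr ler_sqrt ?lerDl ?sqr_ge0// ltW// soft_abs_arg_gt0.
rewrite exprVn ler_pdivrMr ?exprn_gt0// ler_pdivlMl//.
by rewrite -exprS lerXn2r// nnegrE ltW.
Qed.

Lemma soft_sign_lip s t : `|soft_sign s - soft_sign t| <= e^-1 * `|s - t|.
Proof.
apply: (lipschitz_derive is_derive_soft_sign) => x.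
by have /andP[a b] := soft_sign_derive_bound x; rewrite ger0_norm.
Qed.

Lemma soft_sign_mono s t : s <= t -> soft_sign s <= soft_sign t.
Proof.
move=> st; have [] := @MVT_segment R soft_sign _ s t st (fun x _ => is_derive_soft_sign x).
  apply: continuous_subspaceT => x; apply: differentiable_continuous.
  by apply/derivable1_diffP; have [] := is_derive_soft_sign x.
move=> z _ E; rewrite -subr_ge0 E mulr_ge0 ?subr_ge0//.
by have /andP[] := soft_sign_derive_bound z.
Qed.

Lemma soft_sign_far x d : 0 < d -> d <= x -> 1 - soft_sign x <= e / d.
Proof.
move=> d0 dx; have dd := soft_sign_mono dx.
apply: (@le_trans _ _ (1 - soft_sign d)); first by rewrite lerB.
have h0 := soft_abs_gt0 e0 d; have hd := soft_abs_le d; rewrite (gtr0_norm d0) in hd.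
have dh := le_soft_abs d; rewrite (gtr0_norm d0) in dh.
rewrite /soft_sign -[1](divff (lt0r_neq0 h0)) -mulrBl ler_pdivrMr// mulrAC ler_pdivlMr//.
by rewrite ler_pM ?subr_ge0 ?(ltW d0)// lerBlDl.
Qed.

(** A smooth version of sign(s) max(|s| - c, 0), which equals
s + |s - c| / 2 - |s + c| / 2. *)
Definition soft_trunc (s : R) : R := s + 2^-1 * h (s - c) - 2^-1 * h (s + c).
Definition soft_trunc' (s : R) : R := 1 + 2^-1 * soft_sign (s - c) - 2^-1 * soft_sign (s + c).

Lemma soft_trunc0 : soft_trunc 0 = 0.
Proof. by rewrite /soft_trunc sub0r add0r add0r /soft_abs sqrrN subrr. Qed.

Lemma soft_truncN s : soft_trunc (- s) = - soft_trunc s.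
Proof.
rewrite /soft_trunc /soft_abs -opprD sqrrN [- s + c]addrC -[c - s]opprB sqrrN; ring.
Qed.

Lemma is_derive_shift_comp (f f' : R -> R) (a s : R) :
  (forall x : R, is_derive x 1 f (f' x)) ->
  is_derive s 1 (fun t : R => f (t + a)) (f' (s + a)).
Proof.
move=> df; have dt : is_derive s 1 (fun t : R => t + a) 1.
  have := @is_deriveD R R^o R^o id (cst a) s 1 _ _ (is_derive_id _ _) (@is_derive_cst R R^o R^o a s 1).
  by move=> h'; apply: (is_derive_eq h'); rewrite addr0.
have hc := @is_derive1_comp R f (fun t : R => t + a) s _ _ (df (s + a)) dt.
by apply: (is_derive_eq hc); rewrite mulr1.
Qed.

Lemma is_derive_soft_trunc (s : R) : is_derive s 1 soft_trunc (soft_trunc' s).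
Proof.
have d1 := is_derive_shift_comp (- c) s (is_derive_soft_abs e0).
have d2 := is_derive_shift_comp c s (is_derive_soft_abs e0).
have z1 := @is_deriveZ R R^o R^o _ (2^-1) s 1 _ d1.
have z2 := @is_deriveZ R R^o R^o _ (2^-1) s 1 _ d2.
have a1 := @is_deriveD R R^o R^o id _ s 1 _ _ (is_derive_id _ _) z1.
have a2 := @is_deriveB R R^o R^o _ _ s 1 _ _ a1 z2.
exact: a2.
Qed.

Lemma derive1_soft_trunc s : derive1 soft_trunc s = soft_trunc' s.
Proof. by have hd := is_derive_soft_trunc s; rewrite derive1E derive_val. Qed.

(** Translates of smooth functions generate an algebra stable under derivation. *)
Lemma smooth1_soft_trunc : smooth1 soft_trunc.
Proof.
pose S (g : R -> R) := exists2 a, smooth1 a & exists b, g = fun t => a (t + b).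
have Sb (b : R) (a : R -> R) : smooth1 a -> @generated R R^o S (fun t => a (t + b)).
  by move=> sa; apply: Gen_base; exists a => //; exists b.
have Sid : smooth1 (@id R).
  apply: (@smooth1_generated _ (fun g => g = id)); last by apply: Gen_base.
  move=> g ->; exists (fun=> 1); last exact: Gen_cst.
  by move=> s; exact: is_derive_id.
apply: (@smooth1_generated _ S).
  move=> _ [a sa [b ->]]; exists (fun t => derive1 a (t + b)); last exact/Sb/smooth1_derive1.
  by move=> s; apply: is_derive_shift_comp => x; exact: smooth1_is_derive.
rewrite (_ : soft_trunc = ((fun t => id (t + 0)) \+ ((fun=> 2^-1) \* (fun t => h (t + - c)))) \+
   ((fun=> - 2^-1) \* (fun t => h (t + c)))).
  have sh := smooth1_soft_abs e0.
  exact: (Gen_add (Gen_add (Sb 0 _ Sid) (Gen_mul (Gen_cst _ _) (Sb (- c) _ sh)))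
    (Gen_mul (Gen_cst _ _) (Sb c _ sh))).
by apply/funext => t; rewrite /soft_trunc/= addr0 mulNr.
Qed.

Lemma soft_trunc'_bound s : 0 <= soft_trunc' s <= 1.
Proof.
have := soft_sign_bound (s - c); have := soft_sign_bound (s + c).
have := @soft_sign_mono (s - c) (s + c).
rewrite lerD2l ge0_cp// /soft_trunc' !ler_norml => /(_ isT).
move: (soft_sign _) (soft_sign _) => a b ab /andP[b1 b2] /andP[a1 a2].
by apply/andP; split; lra.
Qed.

Lemma soft_trunc'_lip s t : `|soft_trunc' s - soft_trunc' t| <= e^-1 * `|s - t|.
Proof.
have h1 := soft_sign_lip (s - c) (t - c); have h2 := soft_sign_lip (s + c) (t + c).
rewrite (_ : s - c - (t - c) = s - t) in h1; last by ring.
rewrite (_ : s + c - (t + c) = s - t) in h2; last by ring.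
rewrite (_ : _ - _ = 2^-1 * (soft_sign (s - c) - soft_sign (t - c)) -
   2^-1 * (soft_sign (s + c) - soft_sign (t + c))); last by rewrite /soft_trunc'; ring.
rewrite (le_trans (ler_normB _ _))// !normrM ger0_norm ?invr_ge0//.
by move: (e^-1 * _) h1 h2 => E h1 h2; lra.
Qed.

(** Well inside the interval where |s| < c, both signs in the derivative are close
to their limits and cancel the constant 1. *)
Lemma soft_trunc'_small s d : 0 < d -> `|s| <= c - d -> soft_trunc' s <= e / d.
Proof.
move=> d0; rewrite ler_norml => /andP[s1 s2].
have h1 : 1 - soft_sign (- (s - c)) <= e / d by apply: soft_sign_far => //; lra.
have h2 : 1 - soft_sign (s + c) <= e / d by apply: soft_sign_far => //; lra.
by rewrite soft_signN in h1; rewrite /soft_trunc'; lra.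
Qed.

Lemma soft_trunc_large s M : c <= M -> M <= `|s| -> M - c - e / 2 <= `|soft_trunc s|.
Proof.
have pos t : c <= M -> M <= t -> M - c - e / 2 <= soft_trunc t.
  move=> cM Mt; have := le_soft_abs (t - c); have := soft_abs_le (t + c).
  have tc0 : 0 <= t - c by lra.
  have tc0' : 0 <= t + c by move: c0; lra.
  rewrite (ger0_norm tc0) (ger0_norm tc0').
  rewrite /soft_trunc; lra.
move=> cM; have [s0|s0] := leP 0 s.
  by rewrite (ger0_norm s0) => Ms; rewrite (le_trans (pos _ cM Ms))// ler_norm.
rewrite (ltr0_norm s0) => Ms; rewrite (le_trans (pos _ cM Ms))//.
by rewrite soft_truncN -normrN ler_norm.
Qed.

End soft_truncation.

(** * The space W_0^{1,1} and its chain rule *)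

Section W011_theory.
Context {R : realType} {n : nat}.
Variable Omega : set 'rV[R]_n.
Hypothesis openO : open Omega.
Implicit Types (g v w phi psi : 'rV[R]_n -> R).
Local Notation mu := (@rV_lebesgue R n).
Local Notation weakD := (weakD Omega).

Let mO : measurable (Omega : set (rV_leb R n)).
Proof. exact: open_leb. Qed.

Lemma in_L1P v : in_Lp Omega 1 v <-> mu.-integrable Omega (EFin \o v).
Proof.
have E : (\int[mu]_(x in Omega) (`|v x| `^ 1)%:E = \int[mu]_(x in Omega) (`|v x|)%:E)%E.
  by under eq_integral do rewrite powRr1//.
split=> [[mv]|/integrableP[/measurable_EFinP mv iv]]; last by split; rewrite ?E.
by rewrite E => iv; apply/integrableP; split => //; exact/measurable_EFinP.
Qed.

Lemma L1_L1loc v : mu.-integrable Omega (EFin \o v) -> in_L1loc Omega v.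
Proof.
move=> iv; split; first by apply/measurable_EFinP; exact: measurable_int iv.
move=> K KO cK; have mK := compact_leb cK.
by have /integrableP[] := integrableS mO mK KO iv.
Qed.

Lemma W11_weakD i w : in_W11 Omega w -> is_weak_partial Omega i w (weakD i w).
Proof. by move=> [_ /(_ i)[g hg _]]; exact: weakDP hg. Qed.

Lemma W11_weakD_integrable i w : in_W11 Omega w -> mu.-integrable Omega (EFin \o weakD i w).
Proof.
move=> hw; have [_ /(_ i)[g hg /in_L1P ig]] := hw.
have [_ lD _] := W11_weakD i hw.
have [mD _] := lD.
exact: (ae_integrable mO ig mD (weakD_ae openO hg)).
Qed.

Lemma W011_approx w (e : R) : in_W011 Omega w -> 0 < e ->
  exists phi, [/\ test_function Omega phi,
    (\int[mu]_(x in Omega) (`|w x - phi x|)%:E < e%:E)%E &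
    forall i, (\int[mu]_(x in Omega) (`|weakD i w x - partial i phi x|)%:E < e%:E)%E].
Proof.
move=> [Ww happ] e0; have [phi tphi] := happ e e0.
rewrite /normW11 => hlt; exists phi; have [sphi _ _] := tphi.
have I0 v : (0 <= \int[mu]_(x in Omega) (`|v x|)%:E)%E by apply: integral_ge0 => x _; rewrite lee_fin.
split=> //.
  apply: le_lt_trans hlt; rewrite leeDl//; apply: sume_ge0 => i _; exact: I0.
move=> i; have wp := weak_partialB openO (W11_weakD i Ww) (test_weak_partial i mO sphi).
have hae := weakD_ae openO wp.
have [_ [m1 _] _] := wp; have [_ [m2 _] _] := weakDP wp.
rewrite -(ae_norm_integral mO m2 m1 hae).
apply: le_lt_trans hlt; rewrite (bigD1 i)//= addeCA leeDl// adde_ge0//.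
by apply: sume_ge0 => j _; exact: I0.
Qed.

(** Test functions and their derivatives are bounded, so integration by parts
passes to limits in L^1. *)
Lemma limit_weak_partial i v g :
  mu.-integrable Omega (EFin \o v) -> mu.-integrable Omega (EFin \o g) ->
  (forall e : R, 0 < e -> exists phi, [/\ test_function Omega phi,
    (\int[mu]_(x in Omega) (`|v x - phi x|)%:E < e%:E)%E &
    (\int[mu]_(x in Omega) (`|g x - partial i phi x|)%:E < e%:E)%E]) ->
  is_weak_partial Omega i v g.
Proof.
move=> iv ig happ; have lv := L1_L1loc iv; have lg := L1_L1loc ig.
split=> // psi tpsi.
have [B1 B10 psiB] := test_bounded tpsi.
have [B2 B20 dpsiB] := test_partial_bounded i tpsi.
have [spsi _ _] := tpsi.
apply/eqP; rewrite -addr_eq0 -normr_le0; apply/ler_addgt0Pr => e e0; rewrite add0r.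
have B0 : 0 < B1 + B2 by exact: addr_gt0.
have [phi [tphi h1 h2]] := happ _ (divr_gt0 e0 B0).
have [sphi _ _] := tphi.
have lphi : in_L1loc Omega phi by apply: continuous_L1loc => //; exact: smooth_continuous.
have ldphi : in_L1loc Omega (partial i phi).
  by apply: continuous_L1loc => //; exact/smooth_continuous/smooth_partial.
have ib := integration_by_parts_test i mO sphi tpsi.
have idv := L1loc_partial_integrable openO i (in_L1locB openO lv lphi) tpsi.
have idg := L1loc_test_integrable openO (in_L1locB openO lg ldphi) tpsi.
have [m1 _] := in_L1locB openO lv lphi; have [m2 _] := in_L1locB openO lg ldphi.
have e1 := norm_Rintegral_mul mO (ltW B20) m1 idv (fun x _ => dpsiB x) h1.
have e2 := norm_Rintegral_mul mO (ltW B10) m2 idg (fun x _ => psiB x) h2.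
have -> : \int[mu]_(x in Omega) (v x * partial i psi x) + \int[mu]_(x in Omega) (g x * psi x) =
  \int[mu]_(x in Omega) ((v \- phi) x * partial i psi x) +
  \int[mu]_(x in Omega) ((g \- partial i phi) x * psi x).
  under [X in _ = X + _]eq_Rintegral do rewrite /= mulrBl.
  under [X in _ = _ + X]eq_Rintegral do rewrite /= mulrBl.
  rewrite (RintegralB mO (L1loc_partial_integrable openO i lv tpsi) (L1loc_partial_integrable openO i lphi tpsi)).
  rewrite (RintegralB mO (L1loc_test_integrable openO lg tpsi) (L1loc_test_integrable openO ldphi tpsi)).
  by rewrite ib; ring.
rewrite (le_trans (ler_normD _ _))// (le_trans (lerD e1 e2))// -mulrDl addrC.
by rewrite mulrCA divff ?mulr1// gt_eqF.
Qed.

(** The approximants identify g as the weak gradient by limit_weak_partial; only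
then are they known to be close to v in the norm of W^{1,1}. *)
Lemma W011_closed v (g : 'I_n -> 'rV[R]_n -> R) :
  mu.-integrable Omega (EFin \o v) ->
  (forall i, mu.-integrable Omega (EFin \o g i)) ->
  (forall e : R, 0 < e -> exists phi, [/\ test_function Omega phi,
    (\int[mu]_(x in Omega) (`|v x - phi x|)%:E < e%:E)%E &
    forall i, (\int[mu]_(x in Omega) (`|g i x - partial i phi x|)%:E < e%:E)%E]) ->
  in_W011 Omega v /\ forall i, is_weak_partial Omega i v (g i).
Proof.
move=> iv ig happ.
have wp i : is_weak_partial Omega i v (g i).
  by apply: limit_weak_partial => // e e0; have [phi [t a b]] := happ e e0; exists phi.
split=> //; split.
  by split; [exact/in_L1P|move=> i; exists (g i) => //; exact/in_L1P].
move=> e e0; have e'0 : 0 < e / n.+1%:R by rewrite divr_gt0.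
have [phi [tphi h1 h2]] := happ _ e'0; exists phi => //; have [sphi _ _] := tphi.
rewrite /normW11 (_ : e%:E = (e / n.+1%:R)%:E + \sum_(i < n) (e / n.+1%:R)%:E)%E; last first.
  rewrite sumEFin -EFinD sumr_const card_ord -[in RHS](mulr1n (e / _)) -mulrnDr add1n.
  by rewrite -[_ *+ _]mulr_natr divfK// pnatr_eq0.
have fin1 : (\sum_(i < n) \int[mu]_(x in Omega) (`|weakD i (v \- phi)%R x|)%:E <=
    \sum_(i < n) (e / n.+1%:R)%:E)%E.
  apply: lee_sum => i _.
  have wpB := weak_partialB openO (wp i) (test_weak_partial i mO sphi).
  have [_ [m1 _] _] := wpB; have [_ [m2 _] _] := weakDP wpB.
  by rewrite (ae_norm_integral mO m2 m1 (weakD_ae openO wpB)) ltW// h2.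
apply: (le_lt_trans (leeD2l _ fin1)); rewrite lteD2rE//.
by rewrite sumEFin.
Qed.

(** If phi is a test function close to w, then G o phi is a test function and
chain_estimate shows that its gradient is close to G'(w) Dw. *)
Lemma W011_comp (G : R -> R) (K : R) w : smooth1 G -> G 0 = 0 ->
  (forall s, `|derive1 G s| <= 1) ->
  (forall s t, `|derive1 G s - derive1 G t| <= K * `|s - t|) ->
  in_W011 Omega w ->
  in_W011 Omega (G \o w) /\
  forall i, is_weak_partial Omega i (G \o w) (fun x => derive1 G (w x) * weakD i w x).
Proof.
move=> sG G0 G1 GK Ww; have [W11w _] := Ww.
have iw : mu.-integrable Omega (EFin \o w) by apply/in_L1P; have [] := W11w.
have mw : measurable_fun (Omega : set (rV_leb R n)) w by apply/measurable_EFinP; exact: measurable_int iw.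
have iD i := W11_weakD_integrable i W11w.
have mD i : measurable_fun (Omega : set (rV_leb R n)) (weakD i w).
  by apply/measurable_EFinP; exact: measurable_int (iD i).
have GL s t : `|G s - G t| <= `|s - t|.
  rewrite -[leRHS]mul1r; apply: (lipschitz_derive (f' := derive1 G)) => //.
  by move=> x; exact: smooth1_is_derive.
have cG : continuous G.
  move=> s; apply: differentiable_continuous; apply/derivable1_diffP.
  by have [] := smooth1_is_derive s sG.
have cG' : continuous (derive1 G).
  move=> s; apply: differentiable_continuous; apply/derivable1_diffP.
  by have [] := smooth1_is_derive s (smooth1_derive1 sG).
have mG : measurable_fun setT G by exact: continuous_measurable_fun.
have mG' : measurable_fun setT (derive1 G) by exact: continuous_measurable_fun.
have K0 : 0 <= K.
  by have := GK 1 0; rewrite subr0 normr1 mulr1; apply: le_trans.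
have mGw : measurable_fun (Omega : set (rV_leb R n)) (G \o w) by exact: measurableT_comp.
have mGD i : measurable_fun (Omega : set (rV_leb R n)) (fun x => derive1 G (w x) * weakD i w x).
  exact: (measurable_funM (measurableT_comp mG' mw) (mD i)).
apply: W011_closed.
- apply: (real_le_integrable mO mGw iw) => x _.
  by have := GL (w x) 0; rewrite G0 !subr0.
- move=> i; apply: (real_le_integrable mO (mGD i) (iD i)) => x _.
  by rewrite normrM ler_piMl.
move=> e e0.
have e30 : 0 < e / 3 by rewrite divr_gt0.
have e60 : 0 < e / 3 / 2 by rewrite divr_gt0.
have /choice[N0 hN0] : forall i, exists N : R, 0 <= N /\
    (\int[mu]_(x in Omega) (if N < `|weakD i w x| then `|weakD i w x| else 0)%:E < (e / 3 / 2)%:E)%E.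
  by move=> i; have [N a b] := tail_integral mO (iD i) e60; exists N.
pose N := \sum_i N0 i.
have Ni i : N0 i <= N by rewrite /N (bigD1 i)//= lerDl sumr_ge0// => j _; have [] := hN0 j.
have NN : 0 <= N by rewrite sumr_ge0// => i _; have [] := hN0 i.
(* The tail height N is fixed before the distance d, since the Lipschitz term
   of chain_estimate is of size K N d. *)
pose d := e / 3 / (1 + K * N).
have KN1 : 1 <= 1 + K * N by rewrite lerDl mulr_ge0.
have KN0 : 0 < 1 + K * N by apply: lt_le_trans KN1.
have d0 : 0 < d by rewrite divr_gt0.
have de : d <= e / 3 by rewrite ler_pdivrMr// ler_peMr// ltW.
have KNd : K * N * d <= e / 3.
  by rewrite mulrCA ler_piMr ?(ltW e30)// ler_pdivrMr// mul1r lerDr.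
have [phi [tphi h1 h2]] := W011_approx Ww d0; have [sphi _ _] := tphi.
have mphi : measurable_fun (Omega : set (rV_leb R n)) phi.
  by apply: measurable_funTS; exact/continuous_leb/smooth_continuous.
have mdphi i : measurable_fun (Omega : set (rV_leb R n)) (partial i phi).
  by apply: measurable_funTS; exact/continuous_leb/smooth_continuous/smooth_partial.
exists (G \o phi); split.
- exact: test_function_comp.
- have mG1 : measurable_fun (Omega : set (rV_leb R n)) (fun x => G (w x) - G (phi x)).
    exact: (measurable_funB mGw (measurableT_comp mG mphi)).
  have mwp : measurable_fun (Omega : set (rV_leb R n)) (fun x => `|w x - phi x|).
    by apply/measurable_EFinP; apply: measurable_norm; exact: measurable_funB mw mphi.
  have est := @le_norm_integral _ _ _ mu Omega mO _ _ mG1 mwp (fun x _ => GL _ _).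
  apply: (le_lt_trans est).
  by apply: (lt_le_trans h1); rewrite lee_fin (le_trans de)// ler_pdivrMr// ler_peMr ?(ltW e0)// ler1n.
move=> i; have -> : partial i (G \o phi) = fun x => derive1 G (phi x) * partial i phi x.
  by apply/funext => x; exact: partial_comp.
have est := @chain_estimate _ _ _ mu Omega mO _ _ _ _ _ _ _ mw mphi (mD i) (mdphi i) mG' K0 NN G1 GK.
apply: (le_lt_trans est).
have -> : e%:E = ((e / 3)%:E + (e / 3)%:E + 2%:E * (e / 3 / 2)%:E)%E.
  by rewrite -EFinM -!EFinD; congr (_%:E); field.
have tail : (\int[mu]_(x in Omega) (if N < `|weakD i w x| then `|weakD i w x| else 0)%:E < (e / 3 / 2)%:E)%E.
  exact: (le_lt_trans (@tail_integral_mono _ _ _ mu _ mO _ _ _ (mD i) (Ni i)) (hN0 i).2).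
have main : (\int[mu]_(x in Omega) (`|weakD i w x - partial i phi x|)%:E +
    (K * N)%:E * \int[mu]_(x in Omega) (`|w x - phi x|)%:E <= (e / 3)%:E + (e / 3)%:E)%E.
  apply: leeD; first by apply: ltW; apply: (lt_le_trans (h2 i)); rewrite lee_fin.
  apply: (@le_trans _ _ ((K * N)%:E * d%:E)%E); last by rewrite -EFinM lee_fin.
  by apply: lee_wpmul2l; [rewrite lee_fin mulr_ge0|exact: ltW].
apply: (le_lt_trans (leeD2r _ main)); rewrite lteD2lE//.
by rewrite lte_pmul2l// lte_fin.
Qed.

End W011_theory.

(** * A weak Gagliardo inequality *)

Section gagliardo.
Context {R : realType} {n : nat}.
Variable Omega : set 'rV[R]_n.+2.
Hypotheses (openO : open Omega) (bndO : bounded_set Omega).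
Implicit Types (g v w phi psi : 'rV[R]_n.+2 -> R).
Local Notation mu := (@rV_lebesgue R n.+2).
Local Notation borel := (rV_borel_lebesgue R n.+2).
Local Notation weakD := (weakD Omega).

Let mO : measurable (Omega : set (rV_leb R n.+2)).
Proof. exact: open_leb. Qed.

Lemma set_coord_id m (i : 'I_m) (x : 'rV[R]_m) : set_coord i (x ord0 i) x = x.
Proof. by apply/rowP => j; rewrite mxE; case: eqP => [->|]. Qed.

(** The Loomis-Whitney inequality for H_i = |D_i phi| / s: phi vanishes far away on
every line, so its value at a point is controlled by the integral of |D_i phi|
over the line through that point. *)
Lemma test_gagliardo phi (s : R) (B : 'I_n.+2 -> R) :
  test_function Omega phi -> 0 < s ->
  (forall i, 0 < B i) ->
  (forall i, \int[mu]_(x in Omega) (`|partial i phi x|)%:E <= (B i)%:E)%E ->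
  fine (mu [set x | s < `|phi x|]) ^+ n.+1 <= \prod_i (B i / s).
Proof.
move=> tphi s0 B0 hB; have [K [cK KO phi0]] := test_function_supp tphi.
have [sphi _ _] := tphi; have [M [M0 KM]] := compact_cube cK.
set E := [set x | s < `|phi x|].
have mE : measurable E.
  apply: open_borel; rewrite (_ : E = (fun x => `|phi x|) @^-1` [set t | s < t])//.
  apply: open_comp; last exact: open_gt.
  by move=> x _; apply: continuous_comp; [exact: smooth_continuous|exact: norm_continuous].
have EM : E `<=` cube M.
  move=> x Ex; apply: KM; apply: contrapT => /phi0 px.
  by move: Ex; rewrite /E/= px normr0 ltNge ltW.
have mp i : measurable_fun [set: 'rV[R]_n.+2] (partial i phi).
  by apply: continuous_borel; exact/smooth_continuous/smooth_partial.
pose H i x := (`|partial i phi x| / s)%:E.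
have mH i : measurable_fun [set: 'rV[R]_n.+2] (H i).
  apply/measurable_EFinP; apply: measurable_funM => //.
  by apply: measurableT_comp => //; exact: normr_measurable.
have H0 i x : (0 <= H i x)%E by rewrite lee_fin divr_ge0// ltW.
have p0 i := @partial_supp _ _ _ _ i (rV_compact_closed cK) phi0.
have EH i x : E x -> (1 <= \int[@lebesgue_measure R]_t H i (set_coord i t x))%E.
  move=> Ex.
  have L : ((`|phi (set_coord i (x ord0 i) x)|)%:E <=
      \int[@lebesgue_measure R]_t (`|partial i phi (set_coord i t x)|)%:E)%E.
    apply: (@line_bound R (fun t => phi (set_coord i t x))
      (fun t => partial i phi (set_coord i t x)) M (x ord0 i)).
    - by move=> t; exact: is_derive_set_coord.
    - by apply: continuous_set_coord; exact/smooth_continuous/smooth_partial.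
    - by move=> t Mt; apply: phi0 => /KM; exact: cube_line_out.
  rewrite set_coord_id in L.
  under eq_integral do rewrite /H mulrC EFinM.
  have mline : measurable_fun setT (fun t : R => (`|partial i phi (set_coord i t x)|)%:E).
    apply/measurable_EFinP; apply: measurableT_comp; first exact: normr_measurable.
    by apply: measurableT_comp => //; exact: measurable_set_coord.
  rewrite ge0_integralZl_EFin//; last by rewrite invr_ge0 ltW.
  apply: (@le_trans _ _ (s^-1%:E * `|phi x|%:E)%E).
    by rewrite -EFinM lee_fin ler_pdivlMl// mulr1 ltW.
  by rewrite lee_wpmul2l// lee_fin invr_ge0 ltW.
have HB i : (\int[borel]_x H i x <= (B i / s)%:E)%E.
  under eq_integral do rewrite /H mulrC EFinM.
  have mnp : measurable_fun [set: 'rV[R]_n.+2] (fun x => (`|partial i phi x|)%:E).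
    by apply/measurable_EFinP; apply: measurableT_comp => //; exact: normr_measurable.
  rewrite ge0_integralZl_EFin//; last by rewrite invr_ge0 ltW.
  rewrite mulrC EFinM lee_wpmul2l ?lee_fin ?invr_ge0 ?(ltW s0)//.
  rewrite -integral_lebesgue_borel//; apply: le_trans (hB i).
  rewrite [leRHS]integral_mkcond le_eqVlt; apply/orP; left; apply/eqP.
  apply: eq_integral => x _; rewrite patchE; case: ifPn => // /negP.
  by rewrite inE => nOx; rewrite p0 ?normr0// => /KO.
have Bs i : 0 < B i / s by rewrite divr_gt0.
have := loomis_whitney mE EM mH H0 EH Bs HB.
rewrite (lebesgue_borelE mE); set m := fine _; have m0 : 0 <= m by rewrite fine_ge0.
have [->|m1] := eqVneq m 0.
  by move=> _; rewrite expr0n/= prodr_ge0// => i _; rewrite ltW.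
by rewrite exprS ler_pM2l// lt_neqAle eq_sym m1.
Qed.

(** Approximate by test functions: the strict bounds leave room for the error in
the gradients, the doubled level for the error in the values. *)
Lemma W011_gagliardo v (s : R) (B : 'I_n.+2 -> R) : in_W011 Omega v -> 0 < s ->
  (forall i, \int[mu]_(x in Omega) (`|weakD i v x|)%:E < (B i)%:E)%E ->
  fine (mu [set x | Omega x /\ s *+ 2 < `|v x|]) ^+ n.+1 <= \prod_i (B i / s).
Proof.
move=> Wv s0 hB; have [W11v _] := Wv.
have B0 i : 0 < B i.
  by rewrite -lte_fin (le_lt_trans _ (hB i))//; apply: integral_ge0 => x _; rewrite lee_fin.
have iv : mu.-integrable Omega (EFin \o v) by apply/in_L1P; have [] := W11v.
have mv : measurable_fun (Omega : set (rV_leb R n.+2)) v.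
  by apply/measurable_EFinP; exact: measurable_int iv.
have iD i := W11_weakD_integrable openO i W11v.
have mD i : measurable_fun (Omega : set (rV_leb R n.+2)) (weakD i v).
  by apply/measurable_EFinP; exact: measurable_int (iD i).
have muO : (mu Omega < +oo)%E by exact: bounded_lebesgue_fin.
set X := fine _; set P := \prod_i _.
have P0 : 0 <= P by apply: prodr_ge0 => i _; rewrite divr_ge0 ?ltW.
pose I i := fine (\int[mu]_(x in Omega) (`|weakD i v x|)%:E).
have IE i : (\int[mu]_(x in Omega) (`|weakD i v x|)%:E = (I i)%:E)%E.
  by rewrite fineK//; exact: integrable_fin_num (integrable_norm (iD i)).
(* The room left by the strict bounds on the gradient. *)
pose d := \big[Num.min/1]_i (B i - I i).
have d0 : 0 < d.
  by apply: lt_bigmin => // i _; rewrite subr_gt0 -lte_fin -IE.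
have dB i : I i + d <= B i by rewrite -lerBrDl; exact: bigmin_le_cond.
set Q := P `^ (n.+1%:R^-1).
suff XQ : X <= Q.
  have X0 : 0 <= X by rewrite fine_ge0.
  apply: (le_trans (lerXn2r _ _ _ XQ)); rewrite ?nnegrE ?powR_ge0//.
  by rewrite -powR_mulrn ?powR_ge0// -powRrM mulVf ?pnatr_eq0// powRr1.
apply/ler_addgt0Pr => e e0.
pose e' := Num.min d (e * s).
have e'0 : 0 < e' by rewrite lt_min d0 mulr_gt0.
have [phi [tphi h1 h2]] := W011_approx openO Wv e'0; have [sphi _ _] := tphi.
have mphi : measurable_fun (Omega : set (rV_leb R n.+2)) phi.
  by apply: measurable_funTS; exact/continuous_leb/smooth_continuous.
have mdphi i : measurable_fun (Omega : set (rV_leb R n.+2)) (partial i phi).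
  by apply: measurable_funTS; exact/continuous_leb/smooth_continuous/smooth_partial.
have h2' i : (\int[mu]_(x in Omega) (`|partial i phi x|)%:E <= (B i)%:E)%E.
  apply: (@le_trans _ _ ((I i)%:E + e'%:E)%E); last first.
    by rewrite -EFinD lee_fin (le_trans _ (dB i))// lerD2l ge_min lexx.
  rewrite -IE; apply: le_trans (leeD2l _ (ltW (h2 i))).
  exact: norm_integral_triangle.
have gn := test_gagliardo tphi s0 B0 h2'.
have Yle : fine (mu [set x | Omega x /\ s < `|phi x|]) <= Q.
  have [K [_ KO phi0]] := test_function_supp tphi.
  have -> : [set x | Omega x /\ s < `|phi x|] = [set x | s < `|phi x|].
    apply/seteqP; split => x /=; first by move=> [].
    move=> sx; split => //; apply: KO; apply: contrapT => /phi0 p0.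
    by move: sx; rewrite p0 normr0 ltNge ltW.
  rewrite -(@ler_pXn2r _ n.+1)// ?nnegrE ?powR_ge0 ?fine_ge0//.
  by rewrite /Q -[leRHS]powR_mulrn ?powR_ge0// -powRrM mulVf ?pnatr_eq0// powRr1.
have cmp := superlevel_approx mO mv mphi muO s0 (ltW h1).
apply: (le_trans cmp); rewrite lerD// ler_pdivrMr// /e' ge_min lexx orbT//.
Qed.

End gagliardo.

(** * Inequalities between powers *)

Section power_inequalities.
Context {R : realType}.
Implicit Types (x y k p a c f K : R).

Lemma powR_mono a x y : 0 <= a -> 0 <= x -> x <= y -> x `^ a <= y `^ a.
Proof.
move=> a0 x0 xy; apply: ge0_ler_powR => //; rewrite nnegrE//.
exact: le_trans xy.
Qed.

(** If y <= k x^(p-1) the first term suffices; otherwise x is controlled by a power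
of y and the second one does. *)
Lemma young_eps k p x y : 0 < k -> 1 < p -> 0 <= x -> 0 <= y ->
  x * y <= k * x `^ p + k^-1 `^ (p - 1)^-1 * y `^ (p / (p - 1)).
Proof.
move=> k0 p1 x0 y0; have p10 : 0 < p - 1 by rewrite subr_gt0.
have p0 : 0 < p by exact: lt_trans p1.
have [h|h] := leP y (k * x `^ (p - 1)).
  rewrite (le_trans (ler_wpM2l x0 h))// mulrCA mulr_powRB1//.
  by rewrite lerDl mulr_ge0 ?powR_ge0.
have xle : x <= (k^-1 * y) `^ (p - 1)^-1.
  have -> : x = (x `^ (p - 1)) `^ (p - 1)^-1.
    by rewrite -powRrM divff ?powRr1// gt_eqF.
  apply: powR_mono; rewrite ?powR_ge0 ?invr_ge0 ?ltW//.
  by rewrite ltr_pdivlMl.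
apply: ler_wpDl; first by rewrite mulr_ge0 ?powR_ge0 ?ltW.
apply: (le_trans (ler_wpM2r y0 xle)).
rewrite powRM ?invr_ge0 ?(ltW k0)// -mulrA ler_wpM2l ?powR_ge0//.
rewrite mulrC -[X in X * _](powRr1 y0).
have -> : p / (p - 1) = 1 + (p - 1)^-1.
  by field; rewrite gt_eqF.
have [->|yN0] := eqVneq y 0; first by rewrite powRr1// mul0r powR_ge0.
by rewrite powRD// yN0 implybT.
Qed.

Lemma powR_le1D a c f : 0 <= a -> a <= c -> 0 <= f -> f `^ a <= 1 + f `^ c.
Proof.
move=> a0 ac f0; have [f1|f1] := leP f 1.
  rewrite (le_trans (powR_mono a0 f0 f1))// powR1 lerDl powR_ge0//.
by rewrite ler_wpDl// ler_powR// ltW.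
Qed.

Lemma powR_split K a c f : 0 < K -> 0 < a -> a < c -> 0 <= f ->
  f `^ a <= K `^ a + K `^ (a - c) * f `^ c.
Proof.
move=> K0 a0 ac f0; have [fK|Kf] := leP f K.
  rewrite (le_trans (powR_mono (ltW a0) f0 fK))// lerDl mulr_ge0 ?powR_ge0//.
apply: ler_wpDl; first exact: powR_ge0.
have fN0 : f != 0 by rewrite gt_eqF// (lt_trans K0).
have -> : f `^ a = f `^ (a - c) * f `^ c by rewrite -powRD ?subrK// fN0 implybT.
apply: ler_wpM2r; first exact: powR_ge0.
rewrite -[a - c]opprB !powRN lef_pV2 ?posrE ?powR_gt0//; last exact: lt_trans Kf.
by apply: powR_mono; rewrite ?ltW// subr_gt0.
Qed.

Lemma powRD_le a x y : 0 <= a -> 0 <= x -> 0 <= y ->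
  (x + y) `^ a <= 2 `^ a * (x `^ a + y `^ a).
Proof.
move=> a0 x0 y0; wlog xy : x y x0 y0 / x <= y.
  move=> wl; have [|/ltW] := leP x y; first exact: wl.
  by move=> yx; rewrite addrC [x `^ a + _]addrC; exact: wl.
apply: (@le_trans _ _ ((2 * y) `^ a)).
  by apply: powR_mono; rewrite ?addr_ge0// mulr_natl mulr2n lerD2r.
by rewrite powRM// ler_wpM2l ?powR_ge0// lerDr powR_ge0.
Qed.

Lemma powR_sum_le n a (x : 'I_n -> R) : 0 < a -> (forall i, 0 <= x i) ->
  (\sum_i x i) `^ a <= n%:R `^ a * \sum_i x i `^ a.
Proof.
move=> a0 x0; have S0 : 0 <= \sum_i x i `^ a by apply: sumr_ge0 => i _; exact: powR_ge0.
case: n x x0 S0 => [|n] x x0 S0.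
  by rewrite !big_ord0 mulr0 powR0// gt_eqF.
pose j := [arg max_(i > ord0) x i]%O.
have xj i : x i <= x j by rewrite /j; case: arg_maxP => // k _; exact.
apply: (@le_trans _ _ ((n.+1%:R * x j) `^ a)).
  apply: powR_mono; [exact: ltW|exact: sumr_ge0|].
  apply: (le_trans (ler_sum _ (fun i _ => xj i))).
  by rewrite sumr_const card_ord mulr_natl.
rewrite powRM// ler_wpM2l ?powR_ge0// (bigD1 j)//= lerDl.
by apply: sumr_ge0 => i _; exact: powR_ge0.
Qed.

End power_inequalities.

(** * Lebesgue spaces and the energy estimate *)

Section Lp_facts.
Context d (T : measurableType d) (R : realType).
Variables (mu : {measure set T -> \bar R}) (D : set T) (mD : measurable D).
Hypothesis muD : (mu D < +oo)%E.
Implicit Types (f g u v : T -> R) (a c p r : R).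

Definition Lp_on r f := measurable_fun D f /\ mu.-integrable D (fun x => (`|f x| `^ r)%:E).

Lemma measurable_powRn f r : measurable_fun D f -> measurable_fun D (fun x => `|f x| `^ r).
Proof.
move=> mf; apply: (measurableT_comp (measurable_powR r)).
by apply: measurableT_comp => //; exact: normr_measurable.
Qed.

Lemma integrable_cstD (k : R) : mu.-integrable D (fun=> k%:E).
Proof.
apply/integrableP; split; first exact: measurable_cst.
by rewrite integral_cst// lte_mul_pinfty.
Qed.

Lemma integrable_affine (k l : R) g : mu.-integrable D (EFin \o g) ->
  mu.-integrable D (EFin \o (fun x => k + l * g x)).
Proof.
move=> ig; have := integrableD mD (integrable_cstD k) (integrableZl mD l ig).
by apply: eq_integrable => // x _ /=; rewrite EFinD EFinM.
Qed.

Lemma Lp_dominated r f g : measurable_fun D f -> mu.-integrable D (EFin \o g) ->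
  (forall x, D x -> `|f x| `^ r <= g x) -> Lp_on r f.
Proof.
move=> mf ig fg; split => //.
apply: (real_le_integrable mD (measurable_powRn r mf) ig) => x Dx.
by rewrite ger0_norm ?powR_ge0// (le_trans (fg _ Dx))// ler_norm.
Qed.

Lemma Lp_incl a c f : 0 <= a -> a <= c -> Lp_on c f -> Lp_on a f.
Proof.
move=> a0 ac [mf ifc].
have := integrable_affine 1 1 ifc; move/(Lp_dominated (r := a) mf); apply => x _.
by rewrite mul1r powR_le1D.
Qed.

Lemma Lp_mul p u v : 1 < p -> Lp_on (p / (p - 1)) u -> Lp_on p v ->
  mu.-integrable D (EFin \o (u \* v)).
Proof.
move=> p1 [mu_ iu] [mv iv].
have ig := integrableD mD iv iu.
apply: (real_le_integrable mD (measurable_funM mu_ mv)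
  (g := fun x => `|v x| `^ p + `|u x| `^ (p / (p - 1)))).
  by apply: eq_integrable ig => // x _ /=; rewrite EFinD.
move=> x _; rewrite normrM mulrC [leRHS]ger0_norm ?addr_ge0 ?powR_ge0//.
have := young_eps ltr01 p1 (normr_ge0 (v x)) (normr_ge0 (u x)).
by rewrite invr1 powR1 !mul1r.
Qed.

Lemma Lp_add r u v : 0 <= r -> Lp_on r u -> Lp_on r v -> Lp_on r (u \+ v).
Proof.
move=> r0 [mu_ iu] [mv iv].
have ig := integrable_affine 0 (2 `^ r) (g := fun x => `|u x| `^ r + `|v x| `^ r).
have {}ig := ig _; apply: Lp_dominated (ig _) _.
- exact: measurable_funD.
- by have := integrableD mD iu iv; apply: eq_integrable => // x _ /=; rewrite EFinD.
move=> x _; rewrite add0r; apply: le_trans (powRD_le r0 (normr_ge0 _) (normr_ge0 _)).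
by apply: powR_mono => //; exact: ler_normD.
Qed.

Lemma Lp_opp r u : Lp_on r u -> Lp_on r (\- u).
Proof.
move=> [mu_ iu]; split; first exact: measurable_funN.
by under eq_fun do rewrite normrN.
Qed.

Lemma Lp_scale_le r f g : 0 <= r -> measurable_fun D f -> Lp_on r g ->
  (forall x, D x -> `|f x| <= `|g x|) -> Lp_on r f.
Proof.
move=> r0 mf [mg ig] fg; apply: (Lp_dominated mf ig) => x Dx.
by apply: powR_mono => //; exact: fg.
Qed.

(** This is the Hoelder inequality between the exponents 0 and c for the measure
g dmu, up to a factor 2: split |f| at the height K that balances the two parts. *)
Lemma interpolation g f a c (J E : R) :
  measurable_fun D g -> measurable_fun D f ->
  (forall x, D x -> 0 <= g x) -> 0 < a -> a < c -> 0 < J -> 0 < E ->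
  (\int[mu]_(x in D) (g x)%:E <= J%:E)%E ->
  (\int[mu]_(x in D) (g x * `|f x| `^ c)%:E <= E%:E)%E ->
  (\int[mu]_(x in D) (g x * `|f x| `^ a)%:E <= (2 * (E `^ (a / c) * J `^ (1 - a / c)))%:E)%E.
Proof.
move=> mg mf g0 a0 ac J0 E0 gJ gE.
have c0 : 0 < c by exact: lt_trans ac.
(* The height at which K^a J and K^(a - c) E coincide. *)
pose K := (E / J) `^ c^-1.
have EJ0 : 0 < E / J by rewrite divr_gt0.
have K0 : 0 < K by rewrite powR_gt0.
have m1 : measurable_fun D (fun x => (g x)%:E) by exact/measurable_EFinP.
have m2 r : measurable_fun D (fun x => (g x * `|f x| `^ r)%:E).
  by apply/measurable_EFinP; apply: measurable_funM => //; exact: measurable_powRn.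
apply: (@le_trans _ _ (\int[mu]_(x in D) ((K `^ a)%:E * (g x)%:E +
   (K `^ (a - c))%:E * (g x * `|f x| `^ c)%:E))%E).
  apply: ge0_le_integral => //.
  - by move=> x Dx; rewrite lee_fin mulr_ge0 ?powR_ge0// g0.
  - by apply: emeasurable_funD; apply: measurable_funeM.
  - move=> x Dx; rewrite -!EFinM -EFinD lee_fin.
    rewrite [X in X + _]mulrC mulrCA -mulrDr ler_wpM2l ?g0//.
    exact: powR_split.
rewrite ge0_integralD//; last 4 first.
- by move=> x Dx; rewrite -EFinM lee_fin mulr_ge0 ?powR_ge0// g0.
- exact: measurable_funeM.
- by move=> x Dx; rewrite -EFinM lee_fin !mulr_ge0 ?powR_ge0// g0.
- exact: measurable_funeM.
have q1 x : D x -> (0 <= (g x)%:E)%E by move=> Dx; rewrite lee_fin g0.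
have q2 x : D x -> (0 <= (g x * `|f x| `^ c)%:E)%E.
  by move=> Dx; rewrite lee_fin mulr_ge0 ?powR_ge0 ?g0.
rewrite (ge0_integralZl_EFin mu mD q1 m1 (powR_ge0 _ _)).
rewrite (ge0_integralZl_EFin mu mD q2 (m2 c) (powR_ge0 _ _)).
have KaJ : K `^ a * J = E `^ (a / c) * J `^ (1 - a / c).
  rewrite /K -powRrM mulrC [c^-1 * a]mulrC powRM ?invr_ge0 ?(ltW E0) ?(ltW J0)//.
  rewrite mulrCA; congr (_ * _).
  rewrite powRB ?(gt_eqF J0) ?implybT// powRr1 ?(ltW J0)//; congr (_ * _).
  by rewrite -powR_inv1 ?(ltW J0)// -powRrM mulN1r powRN.
have KE : K `^ (a - c) * E = K `^ a * J.
  rewrite powRB ?(gt_eqF K0) ?implybT// -mulrA; congr (_ * _).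
  rewrite /K -powRrM mulVf ?gt_eqF// powRr1 ?ltW//.
  by rewrite invf_div divfK// gt_eqF.
rewrite -KaJ mulr_natl mulr2n -{2}KE EFinD !EFinM.
by apply: leeD; apply: lee_wpmul2l => //; rewrite lee_fin powR_ge0.
Qed.

Lemma real_integrableD f g : mu.-integrable D (EFin \o f) -> mu.-integrable D (EFin \o g) ->
  mu.-integrable D (EFin \o (fun x => f x + g x)).
Proof. by move=> fi gi; exact: (integrableD mD fi gi). Qed.

Lemma real_integrableZ (k : R) f : mu.-integrable D (EFin \o f) ->
  mu.-integrable D (EFin \o (fun x => k * f x)).
Proof. by move=> fi; exact: (integrableZl mD k fi). Qed.

Lemma real_integrable_sum n (F : 'I_n -> T -> R) :
  (forall i, mu.-integrable D (EFin \o F i)) ->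
  mu.-integrable D (EFin \o (fun x => \sum_i F i x)).
Proof.
move=> iF; elim: (index_enum _) => [|i s ih].
  by under eq_fun do rewrite big_nil; exact: integrable_cstD.
by under eq_fun do rewrite big_cons; exact: real_integrableD.
Qed.

Lemma Rintegral_sum n (F : 'I_n -> T -> R) :
  (forall i, mu.-integrable D (EFin \o F i)) ->
  \int[mu]_(x in D) (\sum_i F i x) = \sum_i \int[mu]_(x in D) F i x.
Proof.
move=> iF; rewrite /Rintegral -[RHS]/(fine (\sum_i fine _)%:E) -sumEFin.
have -> : (\int[mu]_(x in D) (\sum_i F i x)%:E = \sum_i \int[mu]_(x in D) (F i x)%:E)%E.
  by under eq_integral do rewrite -sumEFin; exact: integral_sum.
by congr fine; apply: eq_bigr => i _; rewrite fineK//; exact: integrable_fin_num (iF i).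
Qed.

Lemma ae_ge0_Rintegral f : mu.-integrable D (EFin \o f) ->
  {ae mu, forall x, D x -> 0 <= f x} -> 0 <= \int[mu]_(x in D) f x.
Proof.
move=> fi f0.
have mf : measurable_fun D f by apply/measurable_EFinP; exact: measurable_int fi.
have -> : \int[mu]_(x in D) f x = \int[mu]_(x in D) `|f x|.
  congr fine; apply: ae_eq_integral => //.
  - exact/measurable_EFinP.
  - exact: measurable_norm.
  by apply: filterS f0 => x h Dx; rewrite ger0_norm ?h.
by apply: Rintegral_ge0.
Qed.

Lemma bounded_mul_integrable f g : measurable_fun D g -> (forall x, D x -> 0 <= g x <= 1) ->
  mu.-integrable D (EFin \o f) -> mu.-integrable D (EFin \o (fun x => g x * f x)).
Proof.
move=> mg g01 fi.
have mf : measurable_fun D f by apply/measurable_EFinP; exact: measurable_int fi.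
apply: (real_le_integrable mD (measurable_funM mg mf) fi) => x Dx.
by have /andP[g0 g1] := g01 _ Dx; rewrite normrM (ger0_norm g0) ler_piMl.
Qed.

Section energy.
Variables (n : nat) (p : 'I_n -> R).
Hypothesis p1 : forall i, 1 < p i.

(** To be read with A_i = a_i(x, Du), B_i = a_i(x, D theta), F_i = f^i, w the
gradient of u - theta and g = G'(u - theta), so that g w is the gradient of the
test function. Subtract the integrals of B_i g w_i from the weak equation, use
monotonicity on the left, and absorb half of the energy with young_eps. *)
Lemma energy_test (k : R) (A B F w : 'I_n -> T -> R) g :
  0 < k -> measurable_fun D g -> (forall x, D x -> 0 <= g x <= 1) ->
  (forall i, Lp_on (p i / (p i - 1)) (A i)) -> (forall i, Lp_on (p i / (p i - 1)) (B i)) ->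
  (forall i, Lp_on (p i / (p i - 1)) (F i)) -> (forall i, Lp_on (p i) (w i)) ->
  {ae mu, forall x, D x -> k * \sum_i `|w i x| `^ p i <= \sum_i (A i x - B i x) * w i x} ->
  \int[mu]_(x in D) (\sum_i A i x * (g x * w i x)) =
  \int[mu]_(x in D) (\sum_i F i x * (g x * w i x)) ->
  \int[mu]_(x in D) (g x * \sum_i `|w i x| `^ p i) <=
  2 / k * \int[mu]_(x in D) (g x *
    \sum_i (k / 2)^-1 `^ (p i - 1)^-1 * `|F i x - B i x| `^ (p i / (p i - 1))).
Proof.
move=> k0 mg g01 LA LB LF Lw mono weq.
have pp0 i : 0 <= p i / (p i - 1).
  by rewrite divr_ge0 ?subr_ge0 ?ltW// (lt_trans ltr01).
have iSw : mu.-integrable D (EFin \o (fun x => \sum_i `|w i x| `^ p i)).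
  by apply: real_integrable_sum => i; exact: (Lw i).2.
have iS := bounded_mul_integrable mg g01 iSw.
have LFB i : Lp_on (p i / (p i - 1)) (fun x => F i x - B i x).
  by apply: (Lp_add (pp0 i) (LF i)); exact: (Lp_opp (LB i)).
set Y := fun x => _ * (\sum_i (k / 2)^-1 `^ _ * _).
have iY : mu.-integrable D (EFin \o Y).
  apply: (bounded_mul_integrable mg g01); apply: real_integrable_sum => i.
  by apply: real_integrableZ; exact: (LFB i).2.
have iprod (U : 'I_n -> T -> R) : (forall i, Lp_on (p i / (p i - 1)) (U i)) ->
    mu.-integrable D (EFin \o (fun x => \sum_i U i x * (g x * w i x))).
  move=> LU; apply: real_integrable_sum => i.
  have := bounded_mul_integrable mg g01 (Lp_mul (p1 i) (LU i) (Lw i)).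
  by apply: eq_integrable => // x _ /=; rewrite mulrCA.
have iA := iprod _ LA; have iB := iprod _ LB; have iF := iprod _ LF.
set S := fun x => g x * _ in iS *.
have le1 : k * \int[mu]_(x in D) S x <=
    \int[mu]_(x in D) (\sum_i F i x * (g x * w i x)) -
    \int[mu]_(x in D) (\sum_i B i x * (g x * w i x)).
  rewrite -weq -(RintegralB mD iA iB) -(RintegralZl _ mD iS) -subr_ge0.
  have iAB := integrableB mD iA iB; have ikS := real_integrableZ k iS.
  rewrite -(RintegralB mD iAB ikS).
  apply: ae_ge0_Rintegral; first exact: (integrableB mD iAB ikS).
  apply: filterS mono => x h Dx; have /andP[g0 _] := g01 _ Dx.
  have := ler_wpM2l g0 (h Dx); rewrite -subr_ge0; congr (0 <= _).
  rewrite /S -sumrB mulrCA; congr (_ - _); rewrite mulr_sumr; apply: eq_bigr => i _.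
  by rewrite mulrBl mulrBr !(mulrCA (g x)).
have le2 : \int[mu]_(x in D) (\sum_i F i x * (g x * w i x)) -
    \int[mu]_(x in D) (\sum_i B i x * (g x * w i x)) <=
    k / 2 * \int[mu]_(x in D) S x + \int[mu]_(x in D) Y x.
  have ikS := real_integrableZ (k / 2) iS.
  rewrite -(RintegralB mD iF iB) -(RintegralZl _ mD iS) -(RintegralD mD ikS iY).
  apply: le_Rintegral => //; first exact: (integrableB mD iF iB).
    exact: (real_integrableD ikS iY).
  move=> x Dx; have /andP[g0 _] := g01 _ Dx.
  rewrite /S /Y mulrCA -mulrDr -sumrB mulr_sumr -big_split/= mulr_sumr.
  apply: ler_sum => i _; rewrite -mulrBl mulrCA; apply: ler_wpM2l => //.
  rewrite (le_trans (ler_norm _))// normrM mulrC.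
  by apply: young_eps; rewrite ?divr_gt0.
move: (le_trans le1 le2) => le3.
rewrite -(ler_pM2l (_ : 0 < k / 2)) ?divr_gt0//.
rewrite mulrA (_ : k / 2 * (2 / k) = 1) ?mul1r; last by field; rewrite gt_eqF.
by lra.
Qed.

(** Two interpolations. The function F_i - B_i lies in L^c with c above the dual
exponent a = p_i / (p_i - 1) and 1 - a / c = b a, so its part in energy_test is
of order J^(b a), hence of order J^beta for bounded J, since beta <= b a.
Passing from the power p_i of w_i to the first power then costs
J^(1 - 1 / p_i). The constant depends on J0 but not on g, which is what allows
all truncation levels to be treated at once. *)
Lemma energy_decay (k b beta J0 : R) (A B F w : 'I_n -> T -> R) :
  0 < k -> 0 < b -> 0 < J0 -> (forall i, 0 < p i - 1 - b * p i) ->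
  (forall i, beta <= b * (p i / (p i - 1))) ->
  (forall i, Lp_on (p i / (p i - 1)) (A i)) ->
  (forall i, Lp_on (p i / (p i - 1 - b * p i)) (B i)) ->
  (forall i, Lp_on (p i / (p i - 1 - b * p i)) (F i)) ->
  (forall i, Lp_on (p i) (w i)) ->
  {ae mu, forall x, D x -> k * \sum_i `|w i x| `^ p i <= \sum_i (A i x - B i x) * w i x} ->
  exists2 C : R, 0 < C & forall g (J : R),
    measurable_fun D g -> (forall x, D x -> 0 <= g x <= 1) ->
    \int[mu]_(x in D) (\sum_i A i x * (g x * w i x)) =
    \int[mu]_(x in D) (\sum_i F i x * (g x * w i x)) ->
    0 < J -> J <= J0 -> (\int[mu]_(x in D) (g x)%:E <= J%:E)%E ->
    forall i, (\int[mu]_(x in D) (`|g x * w i x|)%:E <=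
      (C * J `^ (1 - (1 - beta) / p i))%:E)%E.
Proof.
move=> k0 b0 J00 pb bb LA LB LF Lw mono.
have p0 i : 0 < p i by exact: lt_trans (p1 i).
have p10 i : 0 < p i - 1 by rewrite subr_gt0.
pose c i := p i / (p i - 1 - b * p i); pose a i := p i / (p i - 1).
have a0 i : 0 < a i by rewrite divr_gt0.
have ac i : a i < c i.
  rewrite /a /c ltr_pM2l// ltf_pV2 ?posrE//.
  by rewrite ltrBlDr ltrDl mulr_gt0.
have c0 i : 0 < c i by exact: lt_trans (ac i).
have acE i : 1 - a i / c i = b * a i.
  by rewrite /a /c; field; rewrite !gt_eqF.
have LB' i : Lp_on (a i) (B i) by apply: Lp_incl (LB i); rewrite ltW.
have LF' i : Lp_on (a i) (F i) by apply: Lp_incl (LF i); rewrite ltW.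
pose H i x := F i x - B i x.
have LH i : Lp_on (c i) (H i).
  by apply: (Lp_add (ltW (c0 i)) (LF i)); exact: (Lp_opp (LB i)).
have LHa i : Lp_on (a i) (H i) by apply: Lp_incl (LH i); rewrite ltW.
pose E i : R := 1 + fine (\int[mu]_(x in D) (`|H i x| `^ c i)%:E).
have E0 i : 0 < E i.
  rewrite /E ltr_wpDr// fine_ge0//; apply: integral_ge0 => x _.
  by rewrite lee_fin powR_ge0.
have EH i : (\int[mu]_(x in D) (`|H i x| `^ c i)%:E <= (E i)%:E)%E.
  rewrite EFinD fineK; last by exact: integrable_fin_num (LH i).2.
  by rewrite leeDr// lee_fin.
pose K i := (k / 2)^-1 `^ (p i - 1)^-1.
pose C1 := 1 + 2 / k * \sum_i K i * (2 * (E i `^ (a i / c i) * J0 `^ (b * a i - beta))).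
have C10 : 0 < C1.
  rewrite /C1 ltr_wpDr// mulr_ge0 ?divr_ge0 ?(ltW k0)// sumr_ge0// => i _.
  by rewrite !mulr_ge0// ?powR_ge0.
pose C := 1 + \sum_i 2 * C1 `^ (p i)^-1.
have C_ i : 2 * C1 `^ (p i)^-1 <= C.
  rewrite /C (bigD1 i)//= addrCA lerDl addr_ge0// sumr_ge0// => j _.
  by rewrite mulr_ge0 ?powR_ge0.
have C0 : 0 < C.
  rewrite /C ltr_wpDr// sumr_ge0// => j _.
  by rewrite mulr_ge0 ?powR_ge0.
exists C => // g J mg g01 weq J0' JJ0 gJ i.
have g0 x : D x -> 0 <= g x by move=> /g01 /andP[].
have := energy_test k0 mg g01 LA LB' LF' Lw mono weq.
set S := \int[mu]_(x in D) _; set Y := \int[mu]_(x in D) _ => SY.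
have mw j : measurable_fun D (w j) by exact: (Lw j).1.
have igw j : mu.-integrable D (EFin \o (fun x => g x * `|w j x| `^ p j)).
  exact: (bounded_mul_integrable mg g01 (Lw j).2).
have igH j r : Lp_on r (H j) -> mu.-integrable D (EFin \o (fun x => g x * `|H j x| `^ r)).
  by move=> [_ ih]; exact: (bounded_mul_integrable mg g01 ih).
have gH j : \int[mu]_(x in D) (g x * `|H j x| `^ a j) <=
    2 * (E j `^ (a j / c j) * J0 `^ (b * a j - beta)) * J `^ beta.
  have h1 : (\int[mu]_(x in D) (g x * `|H j x| `^ c j)%:E <= (E j)%:E)%E.
    apply: le_trans (EH j); apply: ge0_le_integral => //.
    - by move=> x Dx; rewrite lee_fin mulr_ge0 ?powR_ge0// g0.
    - by have := igH _ _ (LH j); exact: measurable_int.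
    - by have := (LH j).2; exact: measurable_int.
    move=> x Dx; rewrite lee_fin; have /andP[_ g1] := g01 _ Dx.
    by rewrite ler_piMl ?powR_ge0.
  have := interpolation mg (LH j).1 g0 (a0 j) (ac j) J0' (E0 j) gJ h1.
  rewrite -(@fineK _ (\int[mu]_(x in D) _)%E); last first.
    exact: integrable_fin_num (igH _ _ (LHa j)).
  rewrite lee_fin acE => /le_trans -> //.
  rewrite -!mulrA ler_wpM2l// ler_wpM2l ?powR_ge0//.
  have -> : b * a j = (b * a j - beta) + beta by rewrite subrK.
  rewrite powRD; last by rewrite (gt_eqF J0') implybT.
  rewrite addrK; apply: ler_wpM2r; first exact: powR_ge0.
  by apply: powR_mono; rewrite ?subr_ge0 ?bb// ltW.
have YJ : Y <= (\sum_j K j * (2 * (E j `^ (a j / c j) * J0 `^ (b * a j - beta)))) * J `^ beta.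
  have -> : Y = \sum_j K j * \int[mu]_(x in D) (g x * `|H j x| `^ a j).
    have iKH l := real_integrableZ (K l) (igH l _ (LHa l)).
    under eq_bigr do rewrite -(RintegralZl _ mD (igH _ _ (LHa _))).
    rewrite -(Rintegral_sum iKH); apply: eq_Rintegral => x _.
    by rewrite mulr_sumr; apply: eq_bigr => l _; rewrite mulrCA.
  rewrite mulr_suml; apply: ler_sum => j _; rewrite -mulrA.
  by apply: ler_wpM2l; rewrite ?powR_ge0.
have SJ : S <= C1 * J `^ beta.
  apply: (le_trans SY); rewrite /C1 [leRHS]mulrDl mul1r; apply: ler_wpDl; first exact: powR_ge0.
  by rewrite -[leRHS]mulrA; apply: ler_wpM2l YJ; rewrite divr_ge0 ?(ltW k0).
have CJ0 : 0 < C1 * J `^ beta by rewrite mulr_gt0 ?powR_gt0.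
have gw : (\int[mu]_(x in D) (g x * `|w i x| `^ p i)%:E <= (C1 * J `^ beta)%:E)%E.
  apply: (@le_trans _ _ S%:E); last by rewrite lee_fin.
  have iS : mu.-integrable D (EFin \o (fun x => g x * \sum_j `|w j x| `^ p j)).
    by apply: (bounded_mul_integrable mg g01); apply: real_integrable_sum => j; exact: (Lw j).2.
  rewrite /S /Rintegral fineK; last exact: integrable_fin_num iS.
  apply: ge0_le_integral => //.
  - by move=> x Dx; rewrite lee_fin mulr_ge0 ?powR_ge0// g0.
  - by have := igw i; exact: measurable_int.
  - exact: measurable_int iS.
  move=> x Dx; rewrite lee_fin ler_wpM2l ?g0// (bigD1 i)//= lerDl.
  by apply: sumr_ge0 => l _; exact: powR_ge0.
have := interpolation mg (mw i) g0 ltr01 (p1 i) J0' CJ0 gJ gw.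
have -> : (\int[mu]_(x in D) (g x * `|w i x| `^ 1)%:E = \int[mu]_(x in D) (`|g x * w i x|)%:E)%E.
  apply: eq_integral => x; rewrite inE => Dx.
  by rewrite powRr1// normrM (ger0_norm (g0 _ Dx)).
move=> /le_trans -> //; rewrite lee_fin powRM ?(ltW C10) ?powR_ge0// -powRrM.
rewrite -mulrA -powRD; last by rewrite (gt_eqF J0') implybT.
rewrite mulrA mul1r (_ : beta * _ + _ = 1 - (1 - beta) / p i); last by field; rewrite gt_eqF.
by apply: ler_wpM2r; rewrite ?powR_ge0.
Qed.

End energy.

End Lp_facts.

(** * Measurability of Caratheodory compositions *)

Section caratheodory_measurability.
Context d (T : measurableType d) (R : realType) (n : nat).
Variables (mu : {measure set T -> \bar R}) (D : set T) (mD : measurable D).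

(** On each of the countably many sets where J is constant the composition is one
of the h m. *)
Lemma measurable_countable_range (I : countType) (J : T -> I) (h : I -> T -> R) :
  (forall m, measurable (D `&` [set x | J x = m])) ->
  (forall m, measurable_fun D (h m)) ->
  measurable_fun D (fun x => h (J x) x).
Proof.
move=> mJ mh _ Y mY.
rewrite (_ : _ `&` _ =
  \bigcup_(m in [set: I]) ((D `&` [set x | J x = m]) `&` (D `&` h m @^-1` Y))).
  apply: countable_bigcupT_measurable; first exact: countableP.
  by move=> m; apply: measurableI; [exact: mJ|exact: mh].
apply/seteqP; split=> x.
  by move=> [Dx Yx]; exists (J x).
by move=> [m _ [[Dx /= <-] [_ Yx]]].
Qed.

Definition grid_floor (k : nat) (y : 'rV[R]_n) : {ffun 'I_n -> int} :=
  [ffun i => Num.floor (k.+1%:R * y ord0 i)].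

Definition grid_point (k : nat) (m : {ffun 'I_n -> int}) : 'rV[R]_n :=
  \row_i ((m i)%:~R / k.+1%:R).

Lemma grid_cvg (y : 'rV[R]_n) : grid_point k (grid_floor k y) @[k --> \oo] --> y.
Proof.
apply/cvg_ballP => e e0; near=> k; apply/rV_ballP => // i.
rewrite !mxE ffunE; set F := (Num.floor _)%:~R.
have k0 : (0 : R) < k.+1%:R by rewrite ltr0n.
have /andP[] := floor_itv (k.+1%:R * y ord0 i); rewrite intrD -/F => lF uF.
rewrite ger0_norm; last by rewrite subr_ge0 ler_pdivrMr// mulrC.
rewrite ltrBlDr -ltrBlDl ltr_pdivlMr//.
rewrite mulrBl ltrBlDr mulrC (lt_trans uF)// ltrD2l.
near: k; have := near_infty_natSinv_lt (PosNum e0).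
by apply: filterS => k /=; rewrite -[_^-1]mul1r ltr_pdivrMr.
Unshelve. all: by end_near. Qed.

(** By continuity in the second variable the composition is the limit of
a(x, U_k(x)), where U_k rounds U to a grid and so has countable range. This
holds off a null set, which completeness makes harmless. *)
Lemma measurable_caratheodory (cmu : measure_is_complete mu)
    (a : T -> 'rV[R]_n -> R) (U : T -> 'rV[R]_n) :
  (forall z, measurable_fun D (a ^~ z)) ->
  {ae mu, forall x, D x -> continuous (a x)} ->
  (forall i, measurable_fun D (fun x => U x ord0 i)) ->
  measurable_fun D (fun x => a x (U x)).
Proof.
move=> ma [N [mN N0 aN]] mU.
pose I x : R := \1_(~` N) x.
have mI : measurable_fun D I by apply: measurable_indic; exact: measurableC.
have mlim : measurable_fun D (fun x => I x * a x (U x)).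
  apply: (@measurable_fun_cvg _ _ _ D
    (fun k x => I x * a x (grid_point k (grid_floor k (U x))))).
    move=> k; apply: measurable_funM => //.
    apply: (@measurable_countable_range _ (fun x => grid_floor k (U x))
      (fun m x => a x (grid_point k m))) => [m|m]; last exact: ma.
    rewrite (_ : _ `&` _ = D `&` \bigcap_(i in [set: 'I_n])
        (D `&` (fun x => U x ord0 i) @^-1`
          `[(m i)%:~R / k.+1%:R, (m i + 1)%:~R / k.+1%:R[%classic)).
      apply: measurableI => //; apply: fin_bigcap_measurable => // i _.
      exact: mU.
    have k0 : (0 : R) < k.+1%:R by rewrite ltr0n.
    apply/seteqP; split=> x [Dx]; rewrite /=.
      move=> <-; split => // i _; split => //=; rewrite in_itv/= ffunE.
      by rewrite ler_pdivrMr// ltr_pdivlMr// mulrC floor_itv.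
    move=> mx; split => //; apply/ffunP => i; rewrite ffunE.
    have [_ /=] := mx i Logic.I; rewrite in_itv/= ler_pdivrMr// ltr_pdivlMr// mulrC.
    exact: floor_def.
  move=> x Dx; have [Nx|Nx] := pselect (N x).
    rewrite (_ : I x = 0); last by rewrite /I indicE memNset//= => /(_ Nx).
    by rewrite mul0r; under eq_fun do rewrite mul0r; exact: cvg_cst.
  apply: cvgM; first exact: cvg_cst.
  have ca : continuous (a x) by apply: contrapT => h; apply/Nx/aN => /(_ Dx).
  exact: (cvg_comp _ _ (@grid_cvg (U x)) (ca (U x))).
apply/measurable_EFinP; move/measurable_EFinP: mlim.
apply: (ae_measurable_fun cmu) => //; exists N; split => // x /= h.
apply: contrapT => Nx; apply: h => Dx /=.
by rewrite /I indicE mem_set// mul1r.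
Qed.

End caratheodory_measurability.

(** * Iteration over dyadic levels *)

Section iteration.
Context {R : realType}.

(** The exponent t = alpha / (1 - gamma) is the fixed point of the recursion,
alpha + t gamma = t, so a bound m(s) < K s^(-t) is reproduced at 2s with
constant C 2^t K^gamma. This is less than K once K is large, and the trivial
bound J0 starts the induction. The bound is kept strict so that it can itself
be taken as J. *)
Lemma decay_iteration (m : R -> R) (J0 C alpha gamma : R) :
  0 < J0 -> 0 < C -> 0 < alpha -> 0 <= gamma -> gamma < 1 ->
  (forall tau, 0 < tau -> m tau < J0) ->
  (forall tau J, 0 < tau -> m tau < J -> J <= J0 ->
     m (2 * tau) <= C * tau `^ (- alpha) * J `^ gamma) ->
  exists2 K, 0 < K & forall tau, 0 < tau -> m tau <= K / tau `^ (alpha / (1 - gamma)).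
Proof.
move=> J00 C0 a0 g0 g1 mJ0 step.
have g10 : 0 < 1 - gamma by rewrite subr_gt0.
set t := alpha / (1 - gamma).
have t0 : 0 < t by rewrite divr_gt0.
(* K is chosen so that C 2^t < K^(1 - gamma) and J0 <= K. *)
pose A := 1 + C * 2 `^ t.
have A0 : 0 < A by rewrite /A ltr_wpDr// mulr_ge0 ?powR_ge0// ltW.
pose K := J0 + A `^ (1 - gamma)^-1.
have K0 : 0 < K by rewrite /K ltr_wpDr// powR_ge0.
have KA : A <= K `^ (1 - gamma).
  apply: (@le_trans _ _ ((A `^ (1 - gamma)^-1) `^ (1 - gamma))).
    by rewrite -powRrM mulVf ?(gt_eqF g10)// powRr1// ltW.
  by apply: powR_mono; rewrite ?powR_ge0 ?(ltW g10)// /K lerDr ltW.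
have main k tau : 0 < tau -> tau <= 2 ^+ k -> m tau < K / tau `^ t.
  elim: k tau => [|k ih] tau tau0 tauk.
    apply: (lt_le_trans (mJ0 _ tau0)); rewrite ler_pdivlMr ?powR_gt0//.
    apply: (@le_trans _ _ J0); last by rewrite /K lerDl powR_ge0.
    rewrite ler_piMr ?(ltW J00)// -[leRHS](congr1 (fun f => f t) (powR1 R)).
    by apply: powR_mono; rewrite // ltW.
  have [s s0 tauE] : exists2 s, 0 < s & tau = 2 * s.
    by exists (tau / 2); [rewrite divr_gt0|field].
  have sk : s <= 2 ^+ k by move: tauk; rewrite tauE exprS ler_pM2l.
  pose J := Num.min J0 (K / s `^ t).
  have Ks0 : 0 < K / s `^ t by rewrite divr_gt0// powR_gt0.
  have mJ : m s < J by rewrite /J lt_min mJ0//= ih.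
  have JJ0 : J <= J0 by rewrite /J ge_min lexx.
  have J0' : 0 <= J by rewrite /J le_min !ltW.
  rewrite {1}tauE; apply: (le_lt_trans (step _ _ s0 mJ JJ0)).
  apply: (@le_lt_trans _ _ (C * s `^ (- alpha) * (K / s `^ t) `^ gamma)).
    apply: ler_wpM2l; first by rewrite mulr_ge0 ?powR_ge0// ltW.
    by apply: powR_mono => //; rewrite /J ge_min lexx orbT.
  have -> : C * s `^ (- alpha) * (K / s `^ t) `^ gamma = C * 2 `^ t * K `^ gamma / tau `^ t.
    rewrite powRM ?(ltW K0) ?invr_ge0 ?powR_ge0//.
    rewrite -[(s `^ t)^-1]powRN -powRrM tauE (powRM t _ (ltW s0))//.
    rewrite invfM -[(s `^ t)^-1]powRN.
    have -> : C * s `^ (- alpha) * (K `^ gamma * s `^ (- t * gamma)) =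
      C * K `^ gamma * (s `^ (- alpha) * s `^ (- t * gamma)) by ring.
    rewrite -powRD; last by rewrite (gt_eqF s0) implybT.
    have -> : - alpha + - t * gamma = - t by rewrite /t; field; rewrite gt_eqF.
    by field; rewrite gt_eqF// powR_gt0.
  rewrite ltr_pM2r ?invr_gt0 ?powR_gt0//.
  have {2}-> : K = K `^ (1 - gamma) * K `^ gamma.
    by rewrite -powRD ?(gt_eqF K0) ?implybT// subrK powRr1// ltW.
  rewrite ltr_pM2r ?powR_gt0//; apply: lt_le_trans KA.
  by rewrite /A ltrDr.
exists K => // tau tau0.
have [k tk] : exists k : nat, tau <= 2 ^+ k.
  exists (Num.truncn tau).+1; apply: ltW; apply: (lt_le_trans (truncnS_gt tau)).
  by rewrite -natrX ler_nat ltnW// ltn_expl.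
exact: ltW (main _ _ tau0 tk).
Qed.

End iteration.

(** * Growth conditions *)

Section growth.
Context d (T : measurableType d) (R : realType).
Variables (mu : {measure set T -> \bar R}) (D : set T) (mD : measurable D).
Hypothesis muD : (mu D < +oo)%E.
Local Notation Lp_on := (Lp_on mu D).
Implicit Types (f g h : T -> R).

(** The minimum of |f|^r and |g| is integrable and agrees with |f|^r almost
everywhere. *)
Lemma ae_Lp_dominated r f g : measurable_fun D f -> mu.-integrable D (EFin \o g) ->
  {ae mu, forall x, D x -> `|f x| `^ r <= g x} -> Lp_on r f.
Proof.
move=> mf ig fg; split => //; have mp := measurable_powRn r mf.
have mg : measurable_fun D g by apply/measurable_EFinP; exact: measurable_int ig.
apply: (ae_integrable mD (g := fun x => Num.min (`|f x| `^ r) `|g x|) _ mp).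
  have mm : measurable_fun D (fun x => Num.min (`|f x| `^ r) `|g x|).
    by apply: measurable_minr => //; apply: measurableT_comp => //; exact: normr_measurable.
  apply: (real_le_integrable mD mm ig) => x Dx.
  by rewrite ger0_norm ?le_min ?powR_ge0//= ge_min lexx orbT.
by apply: filterS fg => x hx Dx; rewrite min_l// (le_trans (hx Dx))// ler_norm.
Qed.

Lemma ae_Lp_eq r f g : measurable_fun D f -> Lp_on r g ->
  {ae mu, forall x, D x -> f x = g x} -> Lp_on r f.
Proof.
move=> mf [_ ig] fg; apply: (ae_Lp_dominated mf ig).
by apply: filterS fg => x hx Dx; rewrite hx.
Qed.

(** The r-th power of the growth bound is the power s r of h + sum_j |z_j|^p_j,
which splits into the powers of its terms up to a constant. *)
Lemma Lp_growth n (p : 'I_n -> R) (c r s : R) (A h : T -> R) (z : 'I_n -> T -> R) :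
  0 <= c -> 0 <= s -> 0 <= r -> 0 < s * r -> measurable_fun D A ->
  {ae mu, forall x, D x -> 0 <= h x} ->
  {ae mu, forall x, D x -> `|A x| <= c * (h x + \sum_j `|z j x| `^ p j) `^ s} ->
  Lp_on (s * r) h -> (forall j, Lp_on (p j * (s * r)) (z j)) -> Lp_on r A.
Proof.
move=> c0 s0 r0 k0 mA h0 Ah Lh Lz; set k := s * r in k0 Lh Lz *.
have iz : mu.-integrable D (EFin \o (fun x => \sum_j `|z j x| `^ (p j * k))).
  by apply: (real_integrable_sum mD muD) => j; exact: (Lz j).2.
have ig := real_integrableZ mD (c `^ r * 2 `^ k)
  (real_integrableD mD Lh.2 (real_integrableZ mD (n%:R `^ k) iz)).
apply: (ae_Lp_dominated mA ig).
apply: filterS2 h0 Ah => x hx Ax Dx; have {}hx := hx Dx; have {}Ax := Ax Dx.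
have S0 : 0 <= \sum_j `|z j x| `^ p j by apply: sumr_ge0 => j _; exact: powR_ge0.
apply: (le_trans (powR_mono r0 (normr_ge0 _) Ax)).
rewrite powRM ?powR_ge0// -powRrM -/k -mulrA ler_wpM2l ?powR_ge0//.
apply: (le_trans (powRD_le (ltW k0) hx S0)).
rewrite ler_wpM2l ?powR_ge0// (ger0_norm hx) lerD2l.
apply: (le_trans (powR_sum_le k0 (fun j => powR_ge0 _ _))).
by rewrite ler_wpM2l ?powR_ge0//; apply: ler_sum => j _; rewrite powRrM.
Qed.

Lemma integral_superlevel_le f g (c eta : R) : measurable_fun D f -> measurable_fun D g ->
  0 <= eta -> (forall x, D x -> 0 <= g x <= 1) ->
  (forall x, D x -> `|f x| <= c -> g x <= eta) ->
  (\int[mu]_(x in D) (g x)%:E <= mu [set x | D x /\ (c < `|f x|)%R] + eta%:E * mu D)%E.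
Proof.
move=> mf mg eta0 g01 gc; set E := [set x | _].
have mE : measurable E by exact: measurable_superlevel.
apply: (@le_trans _ _ (\int[mu]_(x in D) ((\1_E x)%:E + eta%:E))%E).
  apply: ge0_le_integral => //.
  - by move=> x Dx; rewrite lee_fin; have /andP[] := g01 _ Dx.
  - exact/measurable_EFinP.
  - apply: emeasurable_funD; last exact: measurable_cst.
    by apply/measurable_EFinP; exact: measurable_indic.
  move=> x Dx; rewrite -EFinD lee_fin indicE; have /andP[g0 g1] := g01 _ Dx.
  have [xE|xE] := boolP (x \in E); first by rewrite (le_trans g1)// lerDl.
  rewrite add0r; apply: gc => //; rewrite leNgt; apply/negP => h.
  by move: xE; rewrite notin_setE; apply.
rewrite ge0_integralD//; last by apply/measurable_EFinP; exact: measurable_indic.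
rewrite integral_indic// integral_cst// leeD2r//.
by apply: le_measure; rewrite ?inE//; by [apply: measurableI|move=> x []].
Qed.

End growth.

Lemma continuous_soft_trunc' (R : realType) (c e : R) : 0 < e -> continuous (soft_trunc' e c).
Proof.
move=> e0 s; have sG' := smooth1_derive1 (smooth1_soft_trunc c e0).
rewrite (_ : soft_trunc' e c = derive1 (soft_trunc e c)); last first.
  by apply/funext => x; rewrite derive1_soft_trunc.
apply: differentiable_continuous; apply/derivable1_diffP.
by have [] := smooth1_is_derive s sG'.
Qed.

Lemma W011_soft_trunc (R : realType) n (Omega : set 'rV[R]_n) w (e c : R) :
  open Omega -> 0 < e -> 0 <= c -> in_W011 Omega w ->
  in_W011 Omega (soft_trunc e c \o w) /\
  forall i, is_weak_partial Omega i (soft_trunc e c \o w)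
    (fun x => soft_trunc' e c (w x) * weakD Omega i w x).
Proof.
move=> openO e0 c0 Ww.
have -> : soft_trunc' e c = derive1 (soft_trunc e c).
  by apply/funext => x; rewrite derive1_soft_trunc.
apply: (@W011_comp _ _ _ openO _ e^-1) Ww.
- exact: smooth1_soft_trunc.
- exact: soft_trunc0.
- move=> s; rewrite derive1_soft_trunc//.
  by have /andP[h0 h1] := soft_trunc'_bound e0 c0 s; rewrite ger0_norm.
- by move=> s t; rewrite !derive1_soft_trunc//; exact: soft_trunc'_lip.
Qed.

(** * Level sets of truncations *)

Section level_sets.
Context {R : realType} {n : nat}.
Variable Omega : set 'rV[R]_n.+2.
Hypothesis openO : open Omega.
Hypothesis bddO : bounded_set Omega.
Local Notation mu := (@rV_lebesgue R n.+2).
Local Notation weakD := (weakD Omega).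
Local Notation level w s := [set x | Omega x /\ s < `|w x|].

Let mO : measurable (Omega : set (rV_leb R n.+2)).
Proof. exact: open_leb. Qed.

Let muO : (mu Omega < +oo)%E.
Proof. exact: bounded_lebesgue_fin. Qed.

(** Truncate at c = 3 tau / 2, halfway between the levels tau and 2 tau. Below tau
the derivative of the truncation is at most e / (tau / 2), so for small e its
integral stays below J, which is strictly larger than the measure of the level
set. Above 2 tau the truncation is at least tau / 4, so W011_gagliardo applied
to it at level tau / 8 controls the level set of w at 2 tau. *)
Lemma level_set_step (w : 'rV[R]_n.+2 -> R) (C J0 : R) (r : 'I_n.+2 -> R) :
  in_W011 Omega w -> 0 < C ->
  (forall (e c J : R), 0 < e -> 0 <= c -> 0 < J -> J <= J0 ->
    (\int[mu]_(x in Omega) (soft_trunc' e c (w x))%:E <= J%:E)%E ->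
    forall i, (\int[mu]_(x in Omega) (`|soft_trunc' e c (w x) * weakD i w x|)%:E <=
      (C * J `^ r i)%:E)%E) ->
  forall tau J, 0 < tau -> fine (mu (level w tau)) < J -> J <= J0 ->
    fine (mu (level w (2 * tau))) ^+ n.+1 <= \prod_i (2 * (C * J `^ r i) / (tau / 16)).
Proof.
move=> Ww C0 est tau J tau0 mJ JJ0; have [W11w _] := Ww.
have iw : mu.-integrable Omega (EFin \o w) by apply/in_L1P => //; have [] := W11w.
have mw : measurable_fun (Omega : set (rV_leb R n.+2)) w.
  by apply/measurable_EFinP; exact: measurable_int iw.
have J0' : 0 < J by apply: le_lt_trans mJ; rewrite fine_ge0.
set m := fine _ in mJ.
have mE : mu (level w tau) = m%:E.
  by rewrite /m fineK//; exact: (superlevel_fin mO tau mw muO).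
pose V := fine (mu Omega) + 1.
have V0 : 0 < V by rewrite ltr_wpDl// fine_ge0.
pose c : R := 3 / 2 * tau; pose dl : R := tau / 2.
have dl0 : 0 < dl by rewrite divr_gt0.
pose e := Num.min (tau / 2) (dl * ((J - m) / V)).
have e0 : 0 < e by rewrite lt_min !mulr_gt0// ?subr_gt0 ?invr_gt0.
have c0 : 0 <= c by rewrite /c mulr_ge0 ?(ltW tau0)// divr_ge0.
have etau : e <= tau / 2 by rewrite /e ge_min lexx.
have eV : e / dl * V <= J - m.
  by rewrite -ler_pdivlMr// ler_pdivrMr// mulrC /e ge_min lexx orbT.
pose g x := soft_trunc' e c (w x); pose G := soft_trunc e c.
have g01 x : 0 <= g x <= 1 by exact: soft_trunc'_bound.
have mg : measurable_fun (Omega : set (rV_leb R n.+2)) g.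
  have mT : measurable_fun setT (soft_trunc' e c).
    exact: continuous_measurable_fun (continuous_soft_trunc' e0).
  exact: (measurableT_comp mT mw).
have gJ : (\int[mu]_(x in Omega) (g x)%:E <= J%:E)%E.
  have h := @integral_superlevel_le _ _ _ mu Omega mO w g tau (e / dl) mw mg.
  have {}h := h (divr_ge0 (ltW e0) (ltW dl0)) (fun x _ => g01 x).
  have small x : Omega x -> `|w x| <= tau -> g x <= e / dl.
    move=> _ wx; apply: (soft_trunc'_small e0 dl0).
    by rewrite (_ : c - dl = tau)// /c /dl; field.
  apply: (le_trans (h small)).
  apply: (@le_trans _ _ (m%:E + (e / dl * V)%:E)%E); last first.
    by rewrite -EFinD lee_fin -lerBrDl.
  have OV : (mu Omega <= V%:E)%E.
    by rewrite -(@fineK _ (mu Omega)) ?ge0_fin_numE// lee_fin /V lerDl.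
  have mE' : (mu (level w tau) <= m%:E)%E by rewrite mE.
  apply: leeD; first exact: mE'.
  rewrite (EFinM (e / dl) V); apply: lee_wpmul2l; last exact: OV.
  by rewrite lee_fin divr_ge0// ltW.
have [WG DG] := W011_soft_trunc openO e0 c0 Ww.
have hB i : (\int[mu]_(x in Omega) (`|weakD i (G \o w) x|)%:E < (2 * (C * J `^ r i))%:E)%E.
  have ae1 := weakD_ae openO (DG i).
  have [_ [m1 _] _] := DG i; have [_ [m2 _] _] := weakDP (DG i).
  have -> := ae_norm_integral mO m2 m1 ae1.
  apply: (le_lt_trans (est e c J e0 c0 J0' JJ0 gJ i)); rewrite lte_fin ltr_pMl// ?mulr_gt0 ?powR_gt0//.
  by rewrite ltr1n.
have s0 : 0 < tau / 16 by rewrite divr_gt0.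
have := W011_gagliardo openO bddO WG s0 hB; apply: le_trans.
have mGw : measurable_fun (Omega : set (rV_leb R n.+2)) (G \o w).
  have [[mG _] _] := WG.1; exact: mG.
rewrite lerXn2r ?nnegrE ?fine_ge0//.
have mG' := measurable_superlevel mO (tau / 16 *+ 2) mGw.
have mw' := measurable_superlevel mO (2 * tau) mw.
apply: fine_le; [exact: (superlevel_fin mO _ mw muO)|exact: (superlevel_fin mO _ mGw muO)|].
apply: le_measure; rewrite ?inE//.
move=> x [Ox wx]; split => //=.
have cM : c <= 2 * tau by rewrite /c; lra.
apply: lt_le_trans (@soft_trunc_large _ e c e0 c0 (w x) (2 * tau) cM (ltW wx)).
by rewrite /c; lra.
Qed.

End level_sets.

(** * The energy estimate for solutions *)

Section ae_integrals.
Context d (T : measurableType d) (R : realType).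
Variables (mu : {measure set T -> \bar R}) (D : set T) (mD : measurable D).

Lemma ae_eq_Rintegral (f g : T -> R) : measurable_fun D f -> measurable_fun D g ->
  {ae mu, forall x, D x -> f x = g x} -> \int[mu]_(x in D) f x = \int[mu]_(x in D) g x.
Proof.
move=> mf mg fg; congr fine; apply: ae_eq_integral => //.
- exact/measurable_EFinP.
- exact/measurable_EFinP.
by apply: filterS fg => x h Dx; rewrite h.
Qed.

Lemma ae_eq_Rintegral_pairing n (A U V : 'I_n -> T -> R) :
  (forall i, measurable_fun D (A i)) -> (forall i, measurable_fun D (U i)) ->
  (forall i, measurable_fun D (V i)) ->
  (forall i, {ae mu, forall x, D x -> U i x = V i x}) ->
  \int[mu]_(x in D) (\sum_i A i x * U i x) = \int[mu]_(x in D) (\sum_i A i x * V i x).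
Proof.
move=> mA mU mV UV; apply: ae_eq_Rintegral.
- by apply: measurable_sum => i; exact: measurable_funM.
- by apply: measurable_sum => i; exact: measurable_funM.
apply: filterS (filter_forall _ UV) => x h Dx.
by apply: eq_bigr => i _; rewrite h.
Qed.

End ae_integrals.

Section solutions.
Context {R : realType} {n : nat}.
Variable Omega : set 'rV[R]_n.
Hypothesis openO : open Omega.
Hypothesis bddO : bounded_set Omega.
Local Notation mu := (@rV_lebesgue R n).
Local Notation weakD := (weakD Omega).
Local Notation weak_grad := (weak_grad Omega).
Local Notation Lp_on := (Lp_on mu Omega).

Let mO : measurable (Omega : set (rV_leb R n)).
Proof. exact: open_leb. Qed.

Let muO : (mu Omega < +oo)%E.
Proof. exact: bounded_lebesgue_fin. Qed.

Lemma in_LpP r v : in_Lp Omega r v <-> Lp_on r v.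
Proof.
split=> [[mv iv]|[mv /integrableP[_ iv]]]; split => //.
  apply/integrableP; split; first by apply/measurable_EFinP; exact: measurable_powRn.
  by under eq_integral do rewrite gee0_abs ?lee_fin ?powR_ge0//.
by move: iv; under eq_integral do rewrite gee0_abs ?lee_fin ?powR_ge0//.
Qed.

Lemma weak_partial_measurable i v g : is_weak_partial Omega i v g ->
  measurable_fun (Omega : set (rV_leb R n)) g.
Proof. by move=> [_ [mg _] _]. Qed.

(** The derivative of the truncation is at most 1, so the gradient keeps its
integrability. *)
Lemma W01_soft_trunc (p : 'I_n -> R) w (e c : R) : (forall i, 0 <= p i) ->
  0 < e -> 0 <= c -> in_W01 Omega p w ->
  in_W01 Omega p (soft_trunc e c \o w) /\
  forall i, is_weak_partial Omega i (soft_trunc e c \o w)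
    (fun x => soft_trunc' e c (w x) * weakD i w x).
Proof.
move=> p0 e0 c0 [Ww Lw]; pose G := soft_trunc e c.
have [WG DG'] := W011_soft_trunc openO e0 c0 Ww.
split; last exact: DG'.
split; first exact: WG.
move=> i; apply/in_LpP.
have m1 := weak_partial_measurable (DG' i).
have m2 := weak_partial_measurable (weakDP (DG' i)).
apply: (ae_Lp_eq mO m2 _ (weakD_ae openO (DG' i))).
have /in_LpP Lwi := Lw i.
apply: (Lp_scale_le mO (p0 i) m1 Lwi) => x _.
have /andP[h0 h1] := soft_trunc'_bound e0 c0 (w x).
by rewrite normrM ler_piMl// ger0_norm.
Qed.

(** Checks the hypotheses of energy_decay. The flux of u has only the dual
integrability that growth gives for Du in L^p_j; the flux of theta is better
because D_j theta is in L^q_j, and the bound on b is exactly what makes the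
exponent p_i / (p_i - 1 - b p_i) admissible. *)
Lemma solution_energy_decay (p q : 'I_n -> R) (h : 'rV[R]_n -> R)
    (a : 'I_n -> 'rV[R]_n -> 'rV[R]_n -> R) (c1 nu b beta J0 : R)
    (theta u : 'rV[R]_n -> R) (f : 'I_n -> 'rV[R]_n -> R) :
  (forall k, 1 < p k) -> (forall k, p k < q k) ->
  {ae mu, forall x, Omega x -> 0 <= h x} ->
  in_Lp Omega (max_exponent (fun k => q k / p k)) h ->
  (forall i, caratheodory_function Omega (a i)) ->
  0 < c1 -> 0 < nu ->
  {ae mu, forall x, Omega x -> forall i (z : 'rV[R]_n),
     `|a i x z| <=
       c1 * (h x + \sum_(j < n) `|z ord0 j| `^ p j) `^ (1 - (p i)^-1)} ->
  {ae mu, forall x, Omega x -> forall z z' : 'rV[R]_n,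
     nu * \sum_(i < n) `|z ord0 i - z' ord0 i| `^ p i <=
       \sum_(i < n) (a i x z - a i x z') * (z ord0 i - z' ord0 i)} ->
  in_W1 Omega q theta ->
  0 < b -> (forall i j, b <= (1 - p j / q j) * (1 - (p i)^-1)) ->
  (forall i, beta <= b * (p i / (p i - 1))) -> 0 < J0 ->
  (forall i, in_Lp Omega (p i / (p i - 1 - b * p i)) (f i)) ->
  bvp_solution Omega p a f theta u ->
  let w := u \- theta in
  exists2 C : R, 0 < C & forall e c J : R, 0 < e -> 0 <= c -> 0 < J -> J <= J0 ->
    (\int[mu]_(x in Omega) (soft_trunc' e c (w x))%:E <= J%:E)%E ->
    forall i, (\int[mu]_(x in Omega) (`|soft_trunc' e c (w x) * weakD i w x|)%:E <=
      (C * J `^ (1 - (1 - beta) / p i))%:E)%E.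
Proof.
move=> p1 pq h0 Lh ca c10 nu0 growth mono [W11t Lt] b0 bpq bb J00 Lf [W01w weq] w.
have p0 i : 0 < p i by exact: lt_trans (p1 i).
have p10 i : 0 < p i - 1 by rewrite subr_gt0.
have q0 i : 0 < q i by exact: lt_trans (pq i).
have pb i : 0 < p i - 1 - b * p i.
  rewrite subr_gt0 -ltr_pdivlMr//; apply: (le_lt_trans (bpq i i)).
  rewrite (_ : (p i - 1) / p i = 1 - (p i)^-1); last by field; rewrite gt_eqF.
  by rewrite gtr_pMl ?subr_gt0 ?invf_lt1// gtrBl divr_gt0.
have [Ww Lw] := W01w; have [W11w _] := Ww.
have wt i := W11_weakD i W11t; have ww i := W11_weakD i W11w.
have wu i : is_weak_partial Omega i u (fun x => weakD i theta x + weakD i w x).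
  have := weak_partialD openO (wt i) (ww i).
  by congr is_weak_partial; apply/funext => x /=; rewrite addrC subrK.
have mt i := weak_partial_measurable (wt i).
have mw i := weak_partial_measurable (ww i).
have mu_ i := weak_partial_measurable (weakDP (wu i)).
have aeu i := weakD_ae openO (wu i).
have {Lt}Lt i r : 0 <= r -> r <= q i -> Lp_on r (weakD i theta).
  by move=> r0 rq; have /in_LpP := Lt i; exact: Lp_incl.
have {}Lw i : Lp_on (p i) (weakD i w) by apply/in_LpP; exact: Lw.
have Lu i : Lp_on (p i) (weakD i u).
  apply: (ae_Lp_eq mO (mu_ i) _ (aeu i)).
  by apply: (Lp_add mO muO (ltW (p0 i)) _ (Lw i)); apply: Lt; rewrite ltW.
have mA v i : (forall j, measurable_fun (Omega : set (rV_leb R n)) (weakD j v)) ->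
    measurable_fun (Omega : set (rV_leb R n)) (fun x => a i x (weak_grad v x)).
  move=> mv; have [maz aec] := ca i.
  apply: (measurable_caratheodory mO (@lebesgue_complete R n) maz aec) => j.
  by under eq_fun do rewrite mxE; exact: mv.
have growthD v i : {ae mu, forall x, Omega x -> `|a i x (weak_grad v x)| <=
    c1 * (h x + \sum_j `|weakD j v x| `^ p j) `^ (1 - (p i)^-1)}.
  apply: filterS growth => x gx Ox; apply: (le_trans (gx Ox _ _)).
  by under eq_bigr do rewrite mxE.
have s0 i : 0 <= 1 - (p i)^-1 by rewrite subr_ge0 invf_le1// ltW.
have Lh' r i : 0 <= r -> r <= q i / p i -> Lp_on r h.
  move=> r0 rq; have /in_LpP := Lh; apply: Lp_incl => //.
  by apply: (le_trans rq); rewrite /max_exponent; exact: le_bigmax.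
have LA i : Lp_on (p i / (p i - 1)) (fun x => a i x (weak_grad u x)).
  have k1 : (1 - (p i)^-1) * (p i / (p i - 1)) = 1 by field; rewrite !gt_eqF.
  apply: (Lp_growth mO muO (ltW c10) (s0 i) _ _ (mA u i mu_) h0 (growthD u i)).
  - by rewrite divr_ge0// ltW.
  - by rewrite k1.
  - by rewrite k1; apply: (Lh' 1 i) => //; rewrite ler_pdivlMr// mul1r ltW.
  - by move=> j; rewrite k1 mulr1; exact: Lu.
have LB i : Lp_on (p i / (p i - 1 - b * p i)) (fun x => a i x (weak_grad theta x)).
  set r := _ / _; have r0 : 0 < r by rewrite divr_gt0.
  have kE : (1 - (p i)^-1) * r = (p i - 1) / (p i - 1 - b * p i).
    by rewrite /r; field; rewrite !gt_eqF.
  have k0 : 0 < (1 - (p i)^-1) * r by rewrite kE divr_gt0.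
  (* A rearrangement of the bound on b. *)
  have kq j : (1 - (p i)^-1) * r <= q j / p j.
    rewrite kE ler_pdivrMr// mulrAC ler_pdivlMr// mulrBr lerBrDr -lerBrDl.
    have := bpq i j; rewrite -(ler_pM2r (mulr_gt0 (p0 i) (q0 j))).
    rewrite (_ : (1 - p j / q j) * _ * _ = (q j - p j) * (p i - 1)); last first.
      by field; rewrite !gt_eqF.
    by move=> hb; apply: (le_trans _ (le_trans hb _)); rewrite le_eqVlt; apply/orP; left; apply/eqP; ring.
  apply: (Lp_growth mO muO (ltW c10) (s0 i) (ltW r0) k0 (mA theta i mt) h0 (growthD theta i)).
  - exact: (Lh' _ i (ltW k0) (kq i)).
  - move=> j; apply: Lt; first by rewrite mulr_ge0// ltW.
    by rewrite mulrC -ler_pdivlMr.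
have Lf' i : Lp_on (p i / (p i - 1 - b * p i)) (f i) by apply/in_LpP; exact: Lf.
have monoD : {ae mu, forall x, Omega x -> nu * \sum_i `|weakD i w x| `^ p i <=
    \sum_i (a i x (weak_grad u x) - a i x (weak_grad theta x)) * weakD i w x}.
  apply: filterS2 mono (filter_forall _ aeu) => x mx ux Ox.
  have E i : weak_grad u x ord0 i - weak_grad theta x ord0 i = weakD i w x.
    by rewrite !mxE ux// addrAC subrr add0r.
  have := mx Ox (weak_grad u x) (weak_grad theta x).
  under eq_bigr do rewrite E.
  by under [X in _ <= X -> _]eq_bigr do rewrite E.
have [C C0 est] := energy_decay mO muO p1 nu0 b0 J00 pb bb LA LB Lf' Lw monoD.
exists C => // e c J e0 c0 J0' JJ0 gJ.
have mw0 : measurable_fun (Omega : set (rV_leb R n)) w by have [[]] := W11w.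
have mT : measurable_fun setT (soft_trunc' e c).
  exact: continuous_measurable_fun (continuous_soft_trunc' e0).
have mg : measurable_fun (Omega : set (rV_leb R n)) (fun x => soft_trunc' e c (w x)).
  exact: (measurableT_comp mT mw0).
apply: (est _ J mg) => //; first by move=> x _; exact: soft_trunc'_bound.
have [W01G DG] := W01_soft_trunc (fun i => ltW (p0 i)) e0 c0 W01w.
have mG i := weak_partial_measurable (DG i).
have mG' i := weak_partial_measurable (weakDP (DG i)).
have aeG i := weakD_ae openO (DG i).
rewrite -(ae_eq_Rintegral_pairing mO (fun i => (LA i).1) mG' mG aeG).
rewrite -(ae_eq_Rintegral_pairing mO (fun i => (Lf' i).1) mG' mG aeG).
exact: weq.
Qed.

End solutions.

(** * Exponents and conclusion *)

Section exponents.
Context {R : realType}.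

(** Here N is the dimension, r the harmonic mean and s its Sobolev exponent. The
bound on beta reads r < N (1 - beta), which is positivity of the denominators
of both t and 1 - gamma. *)
Lemma stampacchia_exponents (N r beta : R) (s := N * r / (N - r))
    (t := s / (1 - beta * s / r)) (gamma := (N - (1 - beta) * (N / r)) / (N - 1)) :
  1 < r -> r < N -> 0 < beta -> beta < r / s ->
  [/\ s < t, 0 <= gamma, gamma < 1 & N / (N - 1) / (1 - gamma) = t].
Proof.
move=> r1 rN b0; have r0 : 0 < r by exact: lt_trans r1.
have N0 : 0 < N by exact: lt_trans rN.
have N1 : 0 < N - 1 by rewrite subr_gt0 (lt_trans r1).
have Nr : 0 < N - r by rewrite subr_gt0.
have s0 : 0 < s by rewrite /s divr_gt0// mulr_gt0.
have -> : r / s = 1 - r / N by rewrite /s; field; rewrite !gt_eqF.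
move=> bN; have bNr : 0 < N * (1 - beta) - r.
  have : r / N < 1 - beta by lra.
  by rewrite ltr_pdivrMr// mulrC subr_gt0.
have x1 : 1 - beta * s / r = (N * (1 - beta) - r) / (N - r).
  by rewrite /s; field; rewrite !gt_eqF.
have g1 : 1 - gamma = (N * (1 - beta) - r) / r / (N - 1).
  by rewrite /gamma; field; rewrite !gt_eqF.
split.
- rewrite /t ltr_pdivlMr ?x1 ?divr_gt0// gtr_pMr// ltr_pdivrMr// mul1r.
  by rewrite ltrD2r gtr_pMr// ltrBlDr ltrDl.
- rewrite /gamma divr_ge0 ?(ltW N1)// subr_ge0 mulrA ler_pdivrMr// mulrC ler_pM2l//.
  lra.
- by rewrite -subr_gt0 g1 !divr_gt0.
- rewrite g1 /t x1 /s; field; rewrite !gt_eqF//.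
Qed.

Lemma hmean_gt1 n (p : 'I_n.+1 -> R) : (forall k, 1 < p k) -> 1 < exponent_hmean p.
Proof.
move=> p1; have p0 k : 0 < p k by exact: lt_trans (p1 k).
rewrite /exponent_hmean; set S := \sum_k _.
have S0 : 0 < S.
  by rewrite /S (bigD1 ord0)//= ltr_wpDr ?invr_gt0// sumr_ge0// => k _; rewrite invr_ge0 ltW.
rewrite invf_gt1 ?mulr_gt0 ?invr_gt0 ?ltr0n// ltr_pdivrMl ?ltr0n// mulr1.
apply: (@lt_le_trans _ _ (\sum_(k < n.+1) 1)); last by rewrite sumr_const card_ord.
by apply: ltr_sum => [|k _]; [apply/hasP; exists ord0; rewrite ?mem_index_enum|rewrite invf_lt1].
Qed.

Lemma sum_inv_hmean n (p : 'I_n.+1 -> R) : \sum_k (p k)^-1 = n.+1%:R / exponent_hmean p.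
Proof.
by rewrite /exponent_hmean invrK mulrA divff ?mul1r// pnatr_eq0.
Qed.

Lemma min_le1_le n (s : 'I_n -> R) j : min_le1 s <= s j.
Proof. by rewrite /min_le1; exact: bigmin_le_cond. Qed.

Lemma min_le1_ge0 n (s : 'I_n -> R) : (forall j, 0 <= s j) -> 0 <= min_le1 s.
Proof. by move=> s0; rewrite /min_le1; apply: le_bigmin. Qed.

Lemma prodr_powR n (J : R) (r : 'I_n -> R) : 0 < J ->
  \prod_i J `^ r i = J `^ (\sum_i r i).
Proof.
move=> J0; apply/esym; apply: (big_morph (fun x => J `^ x)) => [x y|].
  by rewrite powRD// (gt_eqF J0) implybT.
exact: powRr0.
Qed.

(** The dimension is n + 2, so the root is of order n + 1. *)
Lemma gagliardo_root n (X C tau J : R) (r : 'I_n.+2 -> R) :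
  0 <= X -> 0 < C -> 0 < tau -> 0 < J ->
  X ^+ n.+1 <= \prod_i (2 * (C * J `^ r i) / (tau / 16)) ->
  X <= (32 * C) `^ (n.+2%:R / n.+1%:R) * tau `^ (- (n.+2%:R / n.+1%:R)) *
       J `^ ((\sum_i r i) / n.+1%:R).
Proof.
move=> X0 C0 tau0 J0; set a := n.+2%:R / _.
have n0 : n.+1%:R != 0 :> R by rewrite pnatr_eq0.
have -> : \prod_i (2 * (C * J `^ r i) / (tau / 16)) =
    (32 * C / tau) `^ n.+2%:R * J `^ (\sum_i r i).
  have E i : 2 * (C * J `^ r i) / (tau / 16) = 32 * C / tau * J `^ r i.
    by field; rewrite gt_eqF.
  rewrite (eq_bigr _ (fun i _ => E i)) big_split/= prodr_powR// prodr_const card_ord powR_mulrn//.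
  by rewrite divr_ge0 ?mulr_ge0 ?ltW.
move=> hX; have -> : X = (X ^+ n.+1) `^ n.+1%:R^-1.
  by rewrite -powR_mulrn// -powRrM divff// powRr1.
apply: (le_trans (powR_mono _ (exprn_ge0 _ X0) hX)); first by rewrite invr_ge0.
rewrite powRM ?powR_ge0// -!powRrM -/a powRM ?invr_ge0 ?mulr_ge0 ?(ltW C0) ?(ltW tau0)//.
by rewrite powRN -powR_inv1 ?(ltW tau0)// -powRrM mulN1r powRN.
Qed.

End exponents.

Theorem theorem1p2 (R : realType) (n : nat) (Omega : set 'rV[R]_n)
    (p q : 'I_n -> R) (h : 'rV[R]_n -> R)
    (a : 'I_n -> 'rV[R]_n -> 'rV[R]_n -> R) (c1 nu : R)
    (theta : 'rV[R]_n -> R) (b : R) (f : 'I_n -> 'rV[R]_n -> R) :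
  let pm := max_exponent p in
  let pbar := exponent_hmean p in
  let pstar := sobolev_exponent n pbar in
  (2 <= n)%N ->
  bounded_set Omega -> open Omega ->
  (forall k, 1 < p k) ->
  (forall k, p k < q k) ->
  pbar < n%:R ->
  {ae rV_lebesgue, forall x, Omega x -> 0 <= h x} ->
  in_Lp Omega (max_exponent (fun k => q k / p k)) h ->
  (forall i, caratheodory_function Omega (a i)) ->
  0 < c1 ->
  0 < nu ->
  {ae rV_lebesgue, forall x, Omega x -> forall i (z : 'rV[R]_n),
     `|a i x z| <=
       c1 * (h x + \sum_(j < n) `|z ord0 j| `^ p j) `^ (1 - (p i)^-1)} ->
  {ae rV_lebesgue, forall x, Omega x -> forall z z' : 'rV[R]_n,
     nu * \sum_(i < n) `|z ord0 i - z' ord0 i| `^ p i <=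
       \sum_(i < n) (a i x z - a i x z') * (z ord0 i - z' ord0 i)} ->
  in_W1 Omega q theta ->
  0 < b ->
  b <= min_le1 (fun j => 1 - p j / q j) * min_le1 (fun i => 1 - (p i)^-1) ->
  b < (pm - 1) / pm * (pbar / pstar) ->
  (forall i, in_Lp Omega (p i / (p i - 1 - b * p i)) (f i)) ->
  let t := pstar / (1 - b * pstar / pbar * (pm / (pm - 1))) in
  pstar < t /\
  forall u : 'rV[R]_n -> R, bvp_solution Omega p a f theta u ->
    in_weak_Lp Omega t (u \- theta).
Proof.
move=> pm pbar pstar n2.
case: n n2 Omega p q h a theta f @pm @pbar @pstar => [//|[//|n]] _ Omega p q h a theta f pm pbar pstar.
move=> bddO openO p1 pq pbarn h0 Lh ca c10 nu0 growth mono W1t b0 bmin bpm Lf t.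
have p0 k : 0 < p k by exact: lt_trans (p1 k).
have p10 k : 0 < p k - 1 by rewrite subr_gt0.
have q0 k : 0 < q k by exact: lt_trans (pq k).
have ppm k : p k <= pm by rewrite /pm /max_exponent; exact: le_bigmax.
have pm1 : 0 < pm - 1 by rewrite subr_gt0 (lt_le_trans (p1 ord0)).
have pm0 : 0 < pm by rewrite (lt_le_trans (p0 ord0)).
have r1 : 1 < pbar by exact: hmean_gt1.
have bpq i j : b <= (1 - p j / q j) * (1 - (p i)^-1).
  apply: (le_trans bmin); apply: ler_pM; try exact: min_le1_le.
  - by apply: min_le1_ge0 => k; rewrite subr_ge0 ler_pdivrMr// mul1r ltW.
  - by apply: min_le1_ge0 => k; rewrite subr_ge0 invf_le1// ltW.
pose beta := b * (pm / (pm - 1)).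
have beta0 : 0 < beta by rewrite mulr_gt0// divr_gt0.
have betab i : beta <= b * (p i / (p i - 1)).
  rewrite ler_pM2l// ler_pdivrMr// mulrAC ler_pdivlMr//.
  by rewrite mulrBr mulrBr mulr1 mulr1 mulrC lerD2l lerN2.
have betar : beta < pbar / pstar.
  move: bpm; rewrite -(ltr_pM2r (divr_gt0 pm0 pm1)) -/beta.
  have -> : (pm - 1) / pm * (pbar / pstar) * (pm / (pm - 1)) = pbar / pstar.
    by set X := pbar / pstar; field; rewrite !gt_eqF.
  exact.
have [st g0 g1 tE] := stampacchia_exponents r1 pbarn beta0 betar.
have tdef : t = pstar / (1 - beta * pstar / pbar).
  rewrite /t /beta; congr (_ / (1 - _)).
  by rewrite mulrAC; congr (_ / _); rewrite mulrAC.
rewrite tdef; split => // u sol; pose w := u \- theta.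
have [[[W11w _] _] _] := sol.
have Ww : in_W011 Omega w by case: sol => [[]].
have mw : measurable_fun (Omega : set (rV_leb R n.+2)) w by have [[]] := W11w.
split; first exact: mw.
(* Strictly above the measure of every level set. *)
pose J0 := fine (@rV_lebesgue R n.+2 Omega) + 1.
have J00 : 0 < J0 by rewrite /J0 ltr_wpDl// fine_ge0.
have [C C0 est] := solution_energy_decay openO bddO p1 pq h0 Lh ca c10 nu0 growth mono
  W1t b0 bpq betab J00 Lf sol.
have step := level_set_step openO bddO Ww C0 est.
have muO := bounded_lebesgue_fin (open_leb openO) bddO.
have levfin tau := superlevel_fin (open_leb openO) tau mw muO.
pose m tau := fine (@rV_lebesgue R n.+2 [set x | Omega x /\ tau < `|w x|]).
pose alpha : R := n.+2%:R / (n.+2%:R - 1).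
have nE : n.+2%:R - 1 = n.+1%:R :> R by rewrite -[n.+2]addn1 natrD addrK.
have sumE : \sum_i (1 - (1 - beta) / p i) = n.+2%:R - (1 - beta) * (n.+2%:R / pbar).
  by rewrite sumrB sumr_const card_ord -mulr_sumr sum_inv_hmean.
have mJ0 tau : 0 < tau -> m tau < J0.
  move=> _; rewrite /m /J0 ltr_pwDr// fine_le//.
  - exact: levfin.
  - by rewrite ge0_fin_numE.
  apply: le_measure; rewrite ?inE; [exact: (measurable_superlevel (open_leb openO))|exact: open_leb|by move=> x []].
have a0 : 0 < alpha by rewrite /alpha nE divr_gt0.
have K0 : 0 < (32 * C) `^ alpha by rewrite powR_gt0// mulr_gt0.
have decay tau J : 0 < tau -> m tau < J -> J <= J0 ->
    m (2 * tau) <= (32 * C) `^ alpha * tau `^ (- alpha) *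
      J `^ ((n.+2%:R - (1 - beta) * (n.+2%:R / pbar)) / (n.+2%:R - 1)).
  move=> tau0 mJ JJ0; rewrite /alpha nE -sumE.
  apply: gagliardo_root => //; first by rewrite fine_ge0.
    by apply: le_lt_trans mJ; rewrite fine_ge0.
  exact: step.
have [K K00 mK] := decay_iteration J00 K0 a0 g0 g1 mJ0 decay.
exists K => // tau tau0.
by rewrite -(fineK (levfin tau)) lee_fin -[pstar]/(_ * _ / _) -tE; exact: mK.
Qed.
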